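(* Let $q\ge 7$ be an odd prime power, $\Sigma_\infty$ a hyperplane of $\mathrm{PG}(4,q)$, and let $\mathcal C$ be a set of $q^2$ affine points together with a set of affine planes ($\mathcal C$-planes) satisfying: (A1) each $\mathcal C$-plane meets $\mathcal C$ in a $q$-arc, and every plane meeting $\mathcal C$ in more than four points is a $\mathcal C$-plane; (A2) any two distinct points of $\mathcal C$ lie in exactly one $\mathcal C$-plane; (A3) each affine point is either in $\mathcal C$, or on no $\mathcal C$-plane, or on exactly two $\mathcal C$-planes. Let $\mathcal S=\{t_A: A\in\mathcal C\}\cup\{t_\infty\}$ (a regular spread of $\Sigma_\infty$), so that the Bruck–Bose plane $\mathcal P(\mathcal S)\cong\mathrm{PG}(2,q^2)$. Let $T_\infty$ be the point at infinity of $\mathcal P(\mathcal S)$ corresponding to $t_\infty$. Then the set consisting of the points of $\mathcal P(\mathcal S)$ corresponding to $\mathcal C$, together with $T_\infty$, is a conic of $\mathcal P(\mathcal S)\cong\mathrm{PG}(2,q^2)$.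
   Context: Affine points/lines/planes are those not contained in $\Sigma_\infty$. A $k$-arc is a set of $k$ points of a plane, no three collinear. For a $\mathcal C$-plane $\pi$, the $q$-arc $\pi\cap\mathcal C$ lies ($q$ odd) in a unique conic $(\pi\cap\mathcal C)\cup\{\pi_\infty\}$ of $\pi$; $\pi_\infty$ is the $\infty$-point of $\pi$, and an $\infty$-point is the $\infty$-point of some $\mathcal C$-plane. The $\mathcal C$-line of $\pi$ is $\pi\cap\Sigma_\infty$; a $0$-point is a point of $\Sigma_\infty$ on no $\mathcal C$-line. The set of all $\infty$-points and $0$-points is a line $t_\infty$ of $\Sigma_\infty$. For $A\in\mathcal C$ and a $\mathcal C$-plane $\pi\ni A$, $A_\pi$ is the point where the tangent at $A$ in $\pi$ to the conic $(\pi\cap\mathcal C)\cup\{\pi_\infty\}$ meets $\Sigma_\infty$; $t_A$ is the set of the $q+1$ points $A_\pi$ over the $q+1$ $\mathcal C$-planes $\pi\ni A$; each $t_A$ is a line and $\mathcal S$ is a regular spread. Bruck–Bose plane $\mathcal P(\mathcal S)$: affine points are the affine points of $\mathrm{PG}(4,q)$, affine lines are the affine planes of $\mathrm{PG}(4,q)$ meeting $\Sigma_\infty$ in a line of $\mathcal S$, and the line at infinity has as points the elements of $\mathcal S$ (an affine plane through $s\in\mathcal S$ is incident with $s$); for regular $\mathcal S$ it is isomorphic to $\mathrm{PG}(2,q^2)$. *)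

(* Defs.v *)
From mathcomp Require Import all_boot all_algebra.
From mathcomp Require Import finmap.
From mathcomp Require Import boolp classical_sets functions.
Set Implicit Arguments.
Unset Strict Implicit.
Unset Printing Implicit Defensive.
Import GRing.Theory.
Local Open Scope ring_scope.

(* The subspaces of PG(n, F) are the vector subspaces of F^(n+1): projective
   dimension d is vector dimension d + 1, and incidence is inclusion. *)
Notation subspace F n := {vspace 'rV[F]_n.+1}.

Definition is_point (F : fieldType) (n : nat) (U : subspace F n) : bool :=
  \dim U == 1%N.
Definition is_line (F : fieldType) (n : nat) (U : subspace F n) : bool :=
  \dim U == 2%N.
Definition is_plane (F : fieldType) (n : nat) (U : subspace F n) : bool :=
  \dim U == 3%N.
Definition is_hyperplane (F : fieldType) (n : nat) (U : subspace F n) : bool :=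
  \dim U == n.

Definition affine (F : fieldType) (n : nat) (Sinf U : subspace F n) : bool :=
  ~~ (U <= Sinf)%VS.

Definition meets (F : fieldType) (n : nat) (U W : subspace F n) : Prop :=
  exists P : subspace F n, [/\ is_point P, (P <= U)%VS & (P <= W)%VS].

Definition collinear (F : fieldType) (n : nat) (P Q R : subspace F n) : Prop :=
  exists l : subspace F n,
    [/\ is_line l, (P <= l)%VS, (Q <= l)%VS & (R <= l)%VS].

Definition is_arc (F : fieldType) (n k : nat) (pi : subspace F n)
    (K : {fset subspace F n}) : Prop :=
  [/\ is_plane pi,
      #|` K|%fset = k,
      forall P, P \in K -> is_point P /\ (P <= pi)%VS &
      forall P Q R, P \in K -> Q \in K -> R \in K ->
        P != Q -> P != R -> Q != R -> ~ collinear P Q R].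

(* Nonsingular conic of the plane pi, in the coordinates given by some basis
   of pi.  A symmetric Gram matrix describes every quadratic form, and its
   invertibility is nonsingularity of the conic, in odd characteristic only;
   that is the only case in which this is used. *)
Definition is_conic (F : fieldType) (n : nat) (pi : subspace F n)
    (O : set (subspace F n)) : Prop :=
  exists (e : 3.-tuple 'rV[F]_n.+1) (M : 'M[F]_3),
    [/\ basis_of pi e, M^T = M, M \in unitmx &
        O = [set P | exists x : 'rV[F]_3,
               [/\ x != 0, x *m M *m x^T = 0 &
                   P = <[\sum_(i < 3) x 0 i *: e`_i]>%VS]]%classic].

Definition is_tangent (F : fieldType) (n : nat) (pi : subspace F n)
    (O : set (subspace F n)) (A l : subspace F n) : Prop :=
  [/\ is_line l, (l <= pi)%VS & (O `&` [set P | (P <= l)%VS] = [set A])%classic].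

Definition is_spread (F : fieldType) (Sg : subspace F 4)
    (S : set (subspace F 4)) : Prop :=
  (forall l, S l -> is_line l /\ (l <= Sg)%VS) /\
  (forall P, is_point P -> (P <= Sg)%VS -> exists! l, S l /\ (P <= l)%VS).

(* The regulus determined by three pairwise skew lines of the solid Sg: the
   lines of Sg that meet every transversal of l1, l2, l3. *)
Definition regulus (F : fieldType) (Sg l1 l2 l3 : subspace F 4) :
    set (subspace F 4) :=
  [set l | [/\ is_line l, (l <= Sg)%VS &
      forall m, is_line m -> (m <= Sg)%VS ->
        meets m l1 -> meets m l2 -> meets m l3 -> meets m l]]%classic.

Definition is_regular_spread (F : fieldType) (Sg : subspace F 4)
    (S : set (subspace F 4)) : Prop :=
  is_spread Sg S /\
  forall l1 l2 l3, S l1 -> S l2 -> S l3 -> l1 != l2 -> l1 != l3 -> l2 != l3 ->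
    (regulus Sg l1 l2 l3 `<=` S)%classic.

(* Points of P(S): the affine points of PG(4, q) and the elements of S.  Lines
   of P(S): the affine planes through a line of S, and the line at infinity,
   represented by the hyperplane Sinf itself.  With this encoding incidence in
   P(S) is inclusion of subspaces. *)
Definition bb_point (F : fieldType) (Sinf : subspace F 4)
    (S : set (subspace F 4)) : set (subspace F 4) :=
  [set P | (is_point P /\ affine Sinf P) \/ S P]%classic.

Definition bb_line (F : fieldType) (Sinf : subspace F 4)
    (S : set (subspace F 4)) : set (subspace F 4) :=
  [set m | [/\ is_plane m, affine Sinf m & S (m :&: Sinf)%VS]
           \/ m = Sinf]%classic.

(* phi is the point map of an isomorphism from P(S) onto PG(2, K). *)
Definition bb_iso (F K : fieldType) (Sinf : subspace F 4)
    (S : set (subspace F 4)) (phi : subspace F 4 -> subspace K 2) : Prop :=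
  set_bij (bb_point Sinf S) [set P | is_point P]%classic phi /\
  exists psi : subspace F 4 -> subspace K 2,
    set_bij (bb_line Sinf S) [set l | is_line l]%classic psi /\
    forall P m, bb_point Sinf S P -> bb_line Sinf S m ->
      (P <= m)%VS = (phi P <= psi m)%VS.

Definition points_in (F : fieldType) (C : {fset subspace F 4})
    (pi : subspace F 4) : {fset subspace F 4} :=
  [fset P in C | (P <= pi)%VS]%fset.

Definition planes_through (F : fieldType) (CP : {fset subspace F 4})
    (U : subspace F 4) : {fset subspace F 4} :=
  [fset pi in CP | (U <= pi)%VS]%fset.

Definition axiom_A1 (F : finFieldType) (C CP : {fset subspace F 4}) : Prop :=
  (forall pi, pi \in CP -> is_arc #|F| pi (points_in C pi)) /\
  (forall pi, is_plane pi -> (4 < #|` points_in C pi|%fset)%N -> pi \in CP).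

Definition axiom_A2 (F : finFieldType) (C CP : {fset subspace F 4}) : Prop :=
  forall A B, A \in C -> B \in C -> A != B ->
    exists! pi, [/\ pi \in CP, (A <= pi)%VS & (B <= pi)%VS].

Definition axiom_A3 (F : finFieldType) (Sinf : subspace F 4)
    (C CP : {fset subspace F 4}) : Prop :=
  forall P, is_point P -> affine Sinf P ->
    [\/ P \in C, #|` planes_through CP P|%fset = 0%N |
        #|` planes_through CP P|%fset = 2%N].

Definition completed_arc (F : fieldType) (C : {fset subspace F 4})
    (pi N : subspace F 4) : set (subspace F 4) :=
  ([set` points_in C pi] `|` [set N])%classic.

(* N is the point pi_oo. *)
Definition infty_point_of (F : fieldType) (C : {fset subspace F 4})
    (pi N : subspace F 4) : Prop :=
  is_conic pi (completed_arc C pi N).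

(* X is the point A_pi. *)
Definition tangent_point (F : fieldType) (Sinf : subspace F 4)
    (C : {fset subspace F 4}) (A pi X : subspace F 4) : Prop :=
  exists N l, [/\ infty_point_of C pi N,
    is_tangent pi (completed_arc C pi N) A l & X = (l :&: Sinf)%VS].

Definition t_of (F : fieldType) (Sinf : subspace F 4)
    (C CP : {fset subspace F 4}) (A : subspace F 4) : set (subspace F 4) :=
  [set X | exists pi, [/\ pi \in CP, (A <= pi)%VS &
                          tangent_point Sinf C A pi X]]%classic.

Definition zero_point (F : fieldType) (Sinf : subspace F 4)
    (CP : {fset subspace F 4}) (X : subspace F 4) : Prop :=
  [/\ is_point X, (X <= Sinf)%VS &
      forall pi, pi \in CP -> ~~ (X <= pi :&: Sinf)%VS].

Definition t_infty (F : fieldType) (Sinf : subspace F 4)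
    (C CP : {fset subspace F 4}) : set (subspace F 4) :=
  [set X | (exists2 pi, pi \in CP & infty_point_of C pi X)
           \/ zero_point Sinf CP X]%classic.

(* The sets t_A and t_oo are defined as sets of points; l is the line whose
   set of points is T. *)
Definition line_of_points (F : fieldType) (n : nat) (T : set (subspace F n))
    (l : subspace F n) : Prop :=
  is_line l /\ T = [set P | is_point P /\ (P <= l)%VS]%classic.

Definition spread_of (F : fieldType) (Sinf : subspace F 4)
    (C CP : {fset subspace F 4}) : set (subspace F 4) :=
  [set l | (exists2 A, A \in C & line_of_points (t_of Sinf C CP A) l)
           \/ line_of_points (t_infty Sinf C CP) l]%classic.

(* C together with the point T_oo of P(S). *)
Definition bb_closure (F : fieldType) (Sinf : subspace F 4)
    (C CP : {fset subspace F 4}) : set (subspace F 4) :=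
  ([set` C] `|` line_of_points (t_infty Sinf C CP))%classic.

(* Main.v *)
(** In a C-plane pi, every affine point not in C lies on exactly one other C-plane.
    Counting shows that the lines in which pi meets these planes all pass through
    one point at infinity, the node of pi, and a parity argument shows that
    C-planes without common point of C have the same node. The C-planes disjoint
    on C from one of two given ones then provide coordinates in which C is a graph
    { (1, x, y, xy, f(x, y)) }. Every further C-plane is the graph of an
    affine function y = ax + b with a <> 0, along which f is quadratic; as q >= 7,
    f has degree 2, and f = al x^2 + be y^2 after a shear, where be / al is not a
    square by (A3).

    With kap^2 = be / al in K = F(kap), F^5 becomes F x K x K in such a way that
    C = { (1, X, X^2) }. The infinite point of a C-plane is (0, 0, D^2), the
    tangents at X have directions (0, D, 2XD), and S consists of the K-lines of
    0 x K x K; hence P(S) is PG(2, K), where C becomes the parabola Y = X^2. An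
    arbitrary isomorphism P(S) -> PG(2, K) preserves collinearity, so it maps the
    parabola to an oval, which is a conic by Segre's theorem, proved with his
    lemma of tangents. *)

From HB Require Import structures.
Require Import Defs.
From mathcomp Require Import all_boot all_fingroup all_solvable all_algebra all_field zify ring.
Set Implicit Arguments.
Unset Strict Implicit.
Unset Printing Implicit Defensive.
Import GRing.Theory.
Local Open Scope ring_scope.

(** * Finite affine planes *)

(** By (A2) and counting, the points of C and the traces of the C-planes form an affine plane of
    order q, so parallel classes are available before any coordinates. The obstacle is that (A3)
    does not say how two C-planes meet off C: instead of a line, two planes with disjoint traces
    might share a single isolated affine point. Much of the first half excludes such points; there q
    >= 7 enters as q - 2 > 4, the bound of (A1) that turns a plane with q - 2 points of C into a
    C-plane.

    The final model explains (A3). A point (1, X, Y) off C lies on the C-plane through (1, X, X^2)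
    in direction D exactly when Y - X^2 is in F D^2. Every element of F is a square in K. So if Y -
    X^2 is a nonsquare of K there is no such plane, and if it is a nonzero square D^2 there are two,
    in the directions D and kap D; these have the same infinite point, because kap^2 is in F.
    Partners at a point of C are such pairs. *)

Lemma double_count_sum (T I : finType) (B : I -> {set T}) (J : {set I})
    (X : {set T}) :
  (\sum_(j in J) #|B j :&: X| = \sum_(x in X) #|[set j in J | x \in B j]|)%N.
Proof.
transitivity (\sum_(j in J) \sum_(x in X) (x \in B j))%N.
  apply: eq_bigr => j _; rewrite -sum1_card big_mkcond [RHS]big_mkcond /=.
  by apply: eq_bigr => x _; rewrite inE andbC; case: (x \in X); case: (x \in B j).
rewrite exchange_big /=; apply: eq_bigr => x Xx.
rewrite -sum1_card big_mkcond [RHS]big_mkcond /=.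
by apply: eq_bigr => j _; rewrite inE; case: (j \in J); case: (x \in B j).
Qed.

Lemma double_count (T I : finType) (B : I -> {set T}) (J : {set I})
    (X : {set T}) (k : nat) :
  (forall x, x \in X -> #|[set j in J | x \in B j]| = k) ->
  (\sum_(j in J) #|B j :&: X| = k * #|X|)%N.
Proof.
move=> hk; rewrite double_count_sum (eq_bigr (fun=> k)) //.
by rewrite sum_nat_const mulnC.
Qed.

Lemma double_count_le (T I : finType) (B : I -> {set T}) (J : {set I})
    (X : {set T}) :
  (forall x i j, x \in X -> i \in J -> j \in J -> x \in B i -> x \in B j -> i = j) ->
  (\sum_(j in J) #|B j :&: X| <= #|X|)%N.
Proof.
move=> hk; rewrite double_count_sum -sum1_card leq_sum // => x Xx.
rewrite leqNgt; apply/negP => /card_gt1P[i [j []]].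
by rewrite !inE => /andP[Ji xi] /andP[Jj xj] /eqP; apply; apply: hk xi xj.
Qed.

Section AffinePlane.
Variables (T I : finType) (D : {set T}) (B : I -> {set T}) (q : nat).
Hypotheses (q_gt1 : (1 < q)%N) (BD : forall i, B i \subset D)
  (cardB : forall i, #|B i| = q) (cardD : #|D| = (q ^ 2)%N)
  (join : forall a b, a \in D -> b \in D -> a != b ->
     exists i, (a \in B i) && (b \in B i))
  (join_inj : forall a b i j, a != b -> a \in B i -> b \in B i ->
     a \in B j -> b \in B j -> i = j).

(** The blocks through [a] cut the other q^2 - 1 points into sets of q - 1. *)
Lemma pencil_card a : a \in D -> #|[set i | a \in B i]| = q.+1.
Proof.
move=> Da; set J := [set i | _].
have: (\sum_(j in J) #|B j :&: (D :\ a)| = 1 * #|D :\ a|)%N.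
  apply: double_count => x; rewrite !inE => /andP[xa Dx].
  have ax : a != x by rewrite eq_sym.
  have [i /andP[ai xi]] := join Da Dx ax.
  apply/eqP/cards1P; exists i; apply/setP => j; rewrite !inE.
  apply/andP/eqP => [[aj xj]|->]; last by [].
  exact: join_inj ax _ _ _ _.
rewrite (eq_bigr (fun=> q.-1)); last first.
  move=> j; rewrite inE => aj; rewrite setIDA (setIidPl (BD j)).
  by rewrite -(cardB j) (cardsD1 a (B j)) aj.
rewrite sum_nat_const mul1n => E.
have := cardsD1 a D; rewrite Da cardD -E => {}E.
have : (#|J| * q.-1 = q.+1 * q.-1)%N by nia.
by move/eqP; rewrite eqn_mul2r; case: eqP => [|_ /eqP//]; lia.
Qed.

Definition parallel i j := [disjoint B i & B j].

Lemma par_sym i j : parallel i j = parallel j i.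
Proof. exact: disjoint_sym. Qed.

Lemma parN i j : ~~ parallel i j -> exists2 a, a \in B i & a \in B j.
Proof. by rewrite /parallel -setI_eq0 => /set0Pn[a /setIP[]]; exists a. Qed.

Lemma parP i j a : parallel i j -> a \in B i -> a \notin B j.
Proof. by move=> /disjointFr H /H ->. Qed.

(** Joining [b] to the q points of the block [i] gives one block for each of them. *)
Lemma pencil_meet b i : b \in D -> b \notin B i ->
  #|[set j | (b \in B j) && ~~ parallel j i]| = q.
Proof.
move=> Db bi.
have: (\sum_(j in [set j | (b \in B j) && ~~ parallel j i]) #|B j :&: B i| =
   1 * #|B i|)%N.
  apply: double_count => x xi.
  have Dx : x \in D by apply: subsetP xi.
  have bx : b != x by apply: contraNneq bi => ->.
  have [j /andP[bj xj]] := join Db Dx bx.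
  apply/eqP/cards1P; exists j; apply/setP => k; rewrite !inE.
  apply/andP/eqP => [[/andP[bk _] xk]|->].
    exact: join_inj bx _ _ _ _.
  by rewrite bj xj; split=> //; apply/negP => /parP/(_ xj); rewrite xi.
rewrite cardB mul1n => <-.
rewrite (eq_bigr (fun=> 1)) ?sum1_card // => j.
rewrite inE => /andP[bj /parN[a aj ai]].
apply/eqP/cards1P; exists a; apply/setP => x; rewrite !inE.
apply/andP/eqP => [[xj xi]|->//]; apply/eqP; apply: contraNT bi => xa.
by rewrite -(join_inj xa xj aj xi ai).
Qed.

(** Of the q + 1 blocks through [b], q meet the block [i]; one is left. *)
Lemma playfair b i : b \in D -> b \notin B i ->
  exists j, forall k, (b \in B k) && parallel k i = (k == j).
Proof.
move=> Db bi.
have: #|[set j | (b \in B j) && parallel j i]| = 1.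
  have := cardsID [set j | parallel j i] [set j | b \in B j].
  rewrite pencil_card // => E.
  suff: #|[set j | b \in B j] :\: [set j | parallel j i]| = q.
    move=> E2; rewrite E2 in E; apply: (@addIn q); rewrite add1n -E.
    by congr (_ + _)%N; apply: eq_card => j; rewrite !inE.
  rewrite -(pencil_meet Db bi); apply: eq_card => j.
  by rewrite !inE andbC.
case/eqP/cards1P => j /setP E; exists j => k.
by have := E k; rewrite !inE.
Qed.

Lemma par_uniq b i j k : b \in D -> b \in B j -> b \in B k ->
  parallel j i -> parallel k i -> j = k.
Proof.
move=> Db bj bk pj pk.
have bi : b \notin B i by apply: parP bj.
have [l Hl] := playfair Db bi.
have := Hl j; have := Hl k; rewrite bj bk pj pk /=.
by move=> /esym/eqP-> /esym/eqP->.
Qed.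

(** The parallels to [i] partition the q^2 - q points outside [B i] into sets of size q. *)
Lemma par_card i : #|[set j | parallel j i]| = q.-1.
Proof.
have: (\sum_(j in [set j | parallel j i]) #|B j :&: (D :\: B i)| = 1 * #|D :\: B i|)%N.
  apply: double_count => x; rewrite inE => /andP[xi Dx].
  have [j Hj] := playfair Dx xi.
  apply/eqP/cards1P; exists j; apply/setP => k; rewrite !inE -Hj.
  by rewrite andbC.
rewrite mul1n (eq_bigr (fun=> q)); last first.
  move=> j; rewrite inE => pj; rewrite setIDA (setIidPl (BD j)).
  by rewrite -(cardB j); congr #|pred_of_set _|; apply/setDidPl.
rewrite sum_nat_const cardsD (setIidPr (BD i)) cardD cardB => E.
have : (#|[set j | parallel j i]| * q = q.-1 * q)%N by rewrite E; nia.
by move/eqP; rewrite eqn_mul2r; case: eqP => [|_ /eqP//]; lia.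
Qed.

Lemma par_irr i : ~~ parallel i i.
Proof.
have /card_gt0P[a ai] : (0 < #|B i|)%N by rewrite cardB ltnW.
by apply/negP => /parP/(_ ai); rewrite ai.
Qed.

Lemma par_trans i j k : parallel i j -> parallel j k -> i != k -> parallel i k.
Proof.
move=> ij jk; apply: contraNT => /parN[a ai ak].
apply/eqP; apply: (@par_uniq a j) => //; first by apply: subsetP ai.
by rewrite par_sym.
Qed.

Lemma class_through a i : a \in D -> exists j, (a \in B j) && ((j == i) || parallel j i).
Proof.
move=> Da; case: (boolP (a \in B i)) => ai.
  by exists i; rewrite ai eqxx.
have [j Hj] := playfair Da ai; exists j.
have := Hj j; rewrite eqxx => /andP[-> ->]; by rewrite orbT.
Qed.

End AffinePlane.

(** * Affine points of a vector space with a hyperplane *)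

(* A constant that [simpl] leaves alone, unlike the implicit arguments of [#|F|]. *)
Definition fcard (F : finFieldType) : nat := #|F|.

Section AffineVectors.
Variables (F : finFieldType) (n : nat).
Local Notation V := 'rV[F]_n.
Variables (h : {scalar V}) (Sinf : {vspace V}).
Hypothesis hS : forall v, (v \in Sinf) = (h v == 0).
Local Notation q := (fcard F).
Implicit Types U W : {vspace V}.

Definition aff U := [set v : V | (v \in U) && (h v == 1)].

Lemma in_aff U v : (v \in aff U) = (v \in U) && (h v == 1).
Proof. by rewrite inE. Qed.

Lemma aff_exists U : ~~ (U <= Sinf)%VS -> exists u, u \in aff U.
Proof.
case/subvPn => u Uu; rewrite hS => hu.
by exists ((h u)^-1 *: u); rewrite inE memvZ //= linearZ /= mulVf.
Qed.

Lemma affN0 U u : u \in aff U -> ~~ (U <= Sinf)%VS.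
Proof.
rewrite inE => /andP[Uu /eqP hu]; apply/subvPn; exists u => //.
by rewrite hS hu oner_eq0.
Qed.

Lemma aff_decomp U u : u \in aff U -> (<[u]> + U :&: Sinf)%VS = U.
Proof.
rewrite inE => /andP[Uu /eqP hu]; apply/eqP; rewrite eqEsubv subv_add -memvE Uu.
rewrite capvSl /=; apply/subvP => v Uv.
rewrite -[v](subrK (h v *: u)) addrC memv_add ?memvZ ?memv_line //.
by rewrite memv_cap memvB ?memvZ //= hS linearB linearZ /= hu mulr1 subrr.
Qed.

Lemma dim_capS U : ~~ (U <= Sinf)%VS -> \dim (U :&: Sinf) = (\dim U).-1.
Proof.
move=> /aff_exists[u Hu]; move: (Hu); rewrite inE => /andP[Uu /eqP hu].
rewrite -{2}(aff_decomp Hu) dimv_disjoint_sum.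
  by rewrite dim_vline; case: eqP => // u0; rewrite u0 linear0 in hu; move/esym/eqP: hu; rewrite oner_eq0.
apply/eqP; rewrite -subv0; apply/subvP => v; rewrite !memv_cap memv0 hS.
case/and3P => /vlineP[k ->] _; rewrite linearZ /= hu mulr1 => /eqP->.
by rewrite scale0r.
Qed.

Lemma card_aff U : ~~ (U <= Sinf)%VS -> #|aff U| = (q ^ (\dim U).-1)%N.
Proof.
move=> Ua; have [u Hu] := aff_exists Ua.
move: (Hu); rewrite inE => /andP[Uu /eqP hu].
rewrite -dim_capS // -card_vspace -[RHS](card_imset _ (addrI u)).
apply: eq_card => v; apply/idP/imsetP => [|[w Hw ->]].
  rewrite inE => /andP[Uv /eqP hv]; exists (v - u); last by rewrite addrC subrK.
  by rewrite memv_cap hS memvB //= linearB /= hu hv subrr.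
move: Hw; rewrite memv_cap hS inE => /andP[Uw /eqP hw].
by rewrite memvD //= linearD /= hu hw addr0.
Qed.

Lemma h1_neq0 u : h u = 1 -> u != 0.
Proof. by move=> hu; apply/eqP => u0; move/eqP: hu; rewrite u0 linear0 eq_sym oner_eq0. Qed.

Lemma dim_line2 x m : h x = 1 -> m != 0 -> h m = 0 -> \dim (<[x]> + <[m]>) = 2%N.
Proof.
move=> hx m0 hm; rewrite dimv_disjoint_sum ?dim_vline ?m0 ?(h1_neq0 hx) //.
apply/eqP; rewrite -subv0; apply/subvP => v; rewrite memv_cap memv0.
case/andP => /vlineP[k ->] /vlineP[l] /(congr1 h).
by rewrite !linearZ /= hx hm mulr0 mulr1 => ->; rewrite scale0r.
Qed.

Lemma dim2_span U x m : \dim U = 2%N -> x \in U -> m \in U -> h x = 1 ->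
  m != 0 -> h m = 0 -> U = (<[x]> + <[m]>)%VS.
Proof.
move=> dU Ux Um hx m0 hm; apply/esym/eqP; rewrite eqEdim dU dim_line2 //.
by rewrite subv_add -!memvE Ux Um.
Qed.

Lemma dim2_aff2 U x y : \dim U = 2%N -> x \in aff U -> y \in aff U -> x != y ->
  U = (<[x]> + <[y]>)%VS.
Proof.
rewrite !inE => dU /andP[Ux /eqP hx] /andP[Uy /eqP hy] xy.
have yx0 : y - x != 0 by rewrite subr_eq0 eq_sym.
have hyx : h (y - x) = 0 by rewrite linearB /= hx hy subrr.
apply/eqP; rewrite eqEsubv subv_add -!memvE Ux Uy andbT.
rewrite (dim2_span dU Ux _ hx yx0 hyx); last by rewrite memvB.
rewrite subv_add addvSl -memvE memvB //.
  by rewrite memvE addvSr.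
by rewrite memvE addvSl.
Qed.

Lemma dim_aff2 x y : h x = 1 -> h y = 1 -> x != y -> \dim (<[x]> + <[y]>) = 2%N.
Proof.
move=> hx hy xy.
have yx0 : y - x != 0 by rewrite subr_eq0 eq_sym.
have hyx : h (y - x) = 0 by rewrite linearB /= hx hy subrr.
rewrite -(dim_line2 hx yx0 hyx); congr (\dim _); apply/eqP.
rewrite eqEsubv !subv_add !addvSl -!memvE /=; apply/andP; split.
  by rewrite -[y in y \in _](subrK x) addrC memv_add ?memv_line.
by rewrite addrC memv_add ?memvN ?memv_line.
Qed.

Lemma aff_line_eq a b x : h a = 1 -> h b = 1 -> h x = 1 -> a != b -> a != x ->
  x \in (<[a]> + <[b]>)%VS -> (<[a]> + <[b]> = <[a]> + <[x]>)%VS.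
Proof.
move=> ha hb hx ab ax xU; apply: dim2_aff2 ax; first exact: dim_aff2.
  by rewrite inE ha eqxx andbT memvE addvSl.
by rewrite inE hx eqxx andbT.
Qed.

End AffineVectors.

(** * Nodes of the C-planes *)

(* The configuration of the theorem with a point outside [Sinf] represented by
   its unique vector on which the functional [h] takes the value 1. *)
Record configuration (F : finFieldType) (h : {scalar 'rV[F]_5})
    (Sinf : {vspace 'rV[F]_5}) (I : finType) (pl : I -> {vspace 'rV[F]_5})
    (cs : {set 'rV[F]_5}) : Prop := Configuration {
  cf_q : (7 <= fcard F)%N;
  cf_odd : odd (fcard F);
  cf_h : forall v, (v \in Sinf) = (h v == 0);
  cf_dim : forall i, \dim (pl i) = 3%N;
  cf_aff : forall i, ~~ (pl i <= Sinf)%VS;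
  cf_cs : forall a, a \in cs -> h a = 1;
  cf_card : #|cs| = (fcard F ^ 2)%N;
  cf_arc_card : forall i, #|[set a in cs | a \in pl i]| = (fcard F);
  cf_arc : forall i a b c, a \in cs -> b \in cs -> c \in cs ->
    a \in pl i -> b \in pl i -> c \in pl i -> a != b -> a != c -> b != c ->
    c \notin (<[a]> + <[b]>)%VS;
  cf_big : forall U : {vspace 'rV[F]_5}, \dim U = 3%N ->
    (4 < #|[set a in cs | a \in U]|)%N -> exists i, U = pl i;
  cf_join : forall a b, a \in cs -> b \in cs -> a != b ->
    exists i, (a \in pl i) && (b \in pl i);
  cf_inj : forall a b i j, a \in cs -> b \in cs -> a != b ->
    a \in pl i -> b \in pl i -> a \in pl j -> b \in pl j -> i = j;
  cf_two : forall v i, h v = 1 -> v \notin cs -> v \in pl i ->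
    #|[set j | v \in pl j]| = 2%N
}.

(** * Affine intersections of two C-planes *)

Section Geometry.
Variables (F : finFieldType) (h : {scalar 'rV[F]_5}) (Sinf : {vspace 'rV[F]_5})
  (I : finType) (pl : I -> {vspace 'rV[F]_5}) (cs : {set 'rV[F]_5}).
Hypothesis cf : configuration h Sinf pl cs.
Local Notation V := 'rV[F]_5.
Local Notation q := (fcard F).
Implicit Types (i j k : I) (a b v w x y : V).

Let hS := cf_h cf.
Let q7 := cf_q cf.

Definition cblock i := [set a in cs | a \in pl i].
Local Notation B := cblock.

Lemma in_cblock i a : (a \in B i) = (a \in cs) && (a \in pl i).
Proof. by rewrite inE. Qed.

Lemma cblock_h i a : a \in B i -> h a = 1.
Proof. by rewrite inE => /andP[/(cf_cs cf)]. Qed.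

Local Notation par := (parallel B).

Lemma q_gt1 : (1 < q)%N. Proof. by lia. Qed.
Lemma cblock_sub i : B i \subset cs.
Proof. by apply/subsetP => a; rewrite inE => /andP[]. Qed.
Lemma cblock_card i : #|B i| = q. Proof. exact: cf_arc_card cf i. Qed.
Lemma cblock_join a b : a \in cs -> b \in cs -> a != b ->
  exists i, (a \in B i) && (b \in B i).
Proof.
by move=> ca cb /(cf_join cf ca cb)[i Hi]; exists i; rewrite !inE ca cb.
Qed.
Lemma cblock_inj a b i j : a != b -> a \in B i -> b \in B i ->
  a \in B j -> b \in B j -> i = j.
Proof.
rewrite !inE => ab /andP[ca ai] /andP[cb bi] /andP[_ aj] /andP[_ bj].
by apply: (cf_inj cf (a := a) (b := b)).
Qed.

Let parC := par_card q_gt1 cblock_sub cblock_card (cf_card cf) cblock_join cblock_inj.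
Let parI := par_irr q_gt1 cblock_card.

Definition meetpt i j := [set v : V | [&& v \in pl i, v \in pl j, h v == 1 & v \notin cs]].
Local Notation G := meetpt.

Lemma meetptC i j : G i j = G j i.
Proof. by apply/setP => v; rewrite !inE andbCA. Qed.

Definition offpt i := [set v : V | [&& v \in pl i, h v == 1 & v \notin cs]].
Local Notation E := offpt.

Lemma offpt_card i : (#|E i| = q * q.-1)%N.
Proof.
have -> : E i = aff h (pl i) :\: B i.
  apply/setP => v; rewrite !inE; case: (v \in pl i); rewrite ?andbF //= andbT.
  by rewrite andbC.
rewrite cardsD (setIidPr _) ?cblock_card ?(card_aff hS (cf_aff cf i)) ?(cf_dim cf) /=.
  by rewrite -subn1 mulnBr muln1 mulnn.
apply/subsetP => a Ba; rewrite inE (cblock_h Ba) eqxx andbT.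
by move: Ba; rewrite inE => /andP[].
Qed.

Lemma other_plane v i : h v = 1 -> v \notin cs -> v \in pl i ->
  exists2 j, j != i & forall k, (v \in pl k) = (k == i) || (k == j).
Proof.
move=> hv vcs vi; have /eqP/cards2P[x [y [xy /setP E]]] := cf_two cf hv vcs vi.
have Ek k : (v \in pl k) = (k == x) || (k == y) by have := E k; rewrite !inE.
move: (Ek i); rewrite vi => /esym/orP[/eqP->|/eqP->].
  by exists y => //; rewrite eq_sym.
by exists x => // k; rewrite orbC.
Qed.

Lemma three_planes v i j k : h v = 1 -> v \notin cs -> v \in pl i -> v \in pl j ->
  v \in pl k -> i != j -> (k == i) || (k == j).
Proof.
move=> hv vcs vi vj vk ij; have [l li Hl] := other_plane hv vcs vi.
by move: vj vk; rewrite !Hl eq_sym (negPf ij) /= => /eqP->.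
Qed.

Lemma pl_inj i j : (pl i <= pl j)%VS -> i = j.
Proof.
move=> /subvP ij.
have : (1 < #|B i|)%N by rewrite cblock_card; lia.
case/card_gt1P => a [b [ai bi ab]]; apply: (cblock_inj ab ai bi).
  by move: ai; rewrite !inE => /andP[-> /ij].
by move: bi; rewrite !inE => /andP[-> /ij].
Qed.

Lemma dim_cap_le i j : i != j -> (\dim (pl i :&: pl j) <= 2)%N.
Proof.
move=> ij; rewrite leqNgt; apply: contraNN ij => d3; apply/eqP/pl_inj.
have := dimv_leqif_eq (capvSl (pl i) (pl j)).
rewrite (cf_dim cf) => -[le]; have -> /= : \dim (pl i :&: pl j) == 3%N.
  by rewrite eqn_leq le d3.
by move/esym/eqP <-; rewrite capvSr.
Qed.

Lemma arc_line i a b x : a \in B i -> b \in B i -> a != b ->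
  x \in B i -> x \in (<[a]> + <[b]>)%VS -> (x == a) || (x == b).
Proof.
rewrite !inE => /andP[ca ai] /andP[cb bi] ab /andP[cx xi] xL.
case: (eqVneq x a) => //= xa; case: (eqVneq x b) => //= xb.
have := cf_arc cf ca cb cx ai bi xi ab; rewrite xL eq_sym xa eq_sym xb.
by move=> /(_ isT isT).
Qed.

Lemma line_arc_card i (U : {vspace V}) : \dim U = 2%N -> (U <= pl i)%VS ->
  (#|[set a in cs | a \in U]| <= 2)%N.
Proof.
move=> dU Ui; rewrite leqNgt; apply/negP => /card_gt2P[a [b [c [[Ha Hb Hc] [ab bc ca]]]]].
have tB x : x \in [set a in cs | a \in U] -> x \in B i.
  by rewrite !inE => /andP[-> /(subvP Ui)].
have tA x : x \in [set a in cs | a \in U] -> x \in aff h U.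
  by rewrite !inE => /andP[/(cf_cs cf) -> ->]; rewrite eqxx.
have := arc_line (tB _ Ha) (tB _ Hb) ab (tB _ Hc).
rewrite -(dim2_aff2 dU (tA _ Ha) (tA _ Hb) ab).
have -> : c \in U by move: Hc; rewrite inE => /andP[].
by move=> /(_ isT); rewrite (negPf ca) eq_sym (negPf bc).
Qed.

Lemma aff_split (U : {vspace V}) : ~~ (U <= Sinf)%VS ->
  (#|[set a in cs | a \in U]| + #|[set v in aff h U | v \notin cs]|
    = q ^ (\dim U).-1)%N.
Proof.
move=> Ua; rewrite -(card_aff hS Ua) -(cardsID cs (aff h U)); congr (_ + _)%N.
  apply: eq_card => v; rewrite !inE andbC [RHS]andbC; case: (boolP (v \in cs)) => //= cv.
    by rewrite (cf_cs cf cv) eqxx !andbT.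
  by rewrite andbF.
by apply: eq_card => v; rewrite !inE andbC.
Qed.

Lemma cap_cs_card i j : i != j ->
  (#|[set a in cs | a \in (pl i :&: pl j)%VS]| <= 1)%N.
Proof.
move=> ij; rewrite leqNgt; apply: contraNN ij => /card_gt1P[a [b [Ha Hb ab]]].
move: Ha Hb; rewrite !inE !memv_cap => /and3P[ca ai aj] /and3P[cb bi bj].
by apply/eqP; apply: (cf_inj cf (a := a) (b := b)).
Qed.

Lemma GE i j : G i j = [set v in aff h (pl i :&: pl j) | v \notin cs].
Proof. by apply/setP => v; rewrite !inE memv_cap -!andbA. Qed.

(** Distinct planes share at most one point of C, so a common line, with its q affine points, has at
    least q - 1 of them off C. *)
Lemma cap_line i j x y : i != j -> x != y -> h x = 1 -> h y = 1 ->
  x \in pl i -> x \in pl j -> y \in pl i -> y \in pl j ->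
  (\dim (pl i :&: pl j) = 2%N) /\ (q.-1 <= #|G i j| <= q)%N.
Proof.
move=> ij xy hx hy xi xj yi yj.
have d2 : \dim (pl i :&: pl j) = 2%N.
  have le : (\dim (<[x]> + <[y]>) <= \dim (pl i :&: pl j))%N.
    by apply: dimvS; rewrite subv_cap !subv_add -!memvE xi xj yi yj.
  by apply/eqP; rewrite eqn_leq dim_cap_le //=; rewrite (dim_aff2 hx hy xy) in le.
have affU : ~~ (pl i :&: pl j <= Sinf)%VS.
  by apply/subvPn; exists x; rewrite ?memv_cap ?xi ?xj // hS hx oner_eq0.
split=> //; rewrite GE; have := aff_split affU; have := cap_cs_card ij.
by rewrite d2 /= expn1; lia.
Qed.

(** These are the planes that share an affine line with [pl i]: two common points off C already
    force one. *)
Definition line_neighbours i := [set j | (j != i) && (1 < #|G i j|)%N].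
Local Notation L := line_neighbours.

Lemma bigP i j : j \in L i -> \dim (pl i :&: pl j) = 2%N /\ (q.-1 <= #|G i j| <= q)%N.
Proof.
rewrite inE => /andP[ji /card_gt1P[x [y [Hx Hy xy]]]].
move: Hx Hy; rewrite !inE => /and4P[xi xj /eqP hx _] /and4P[yi yj /eqP hy _].
by apply: (cap_line _ xy); rewrite 1?eq_sym.
Qed.

(** A common point of C and a common point off C span a common line, which then has at least q - 1
    points off C. *)
Lemma big_of_common i j a x : j != i -> a \in B i -> a \in B j -> x \in G i j -> j \in L i.
Proof.
rewrite !inE => ji /andP[ca ai] /andP[_ aj] /and4P[xi xj /eqP hx ncx].
have ax : a != x by apply: contraNneq ncx => <-.
have ij : i != j by rewrite eq_sym.
have [_] := cap_line ij ax (cf_cs cf ca) hx ai aj xi xj; rewrite ji /=.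
by move: q7; clear; lia.
Qed.

(** A common line carries at most q points off C. Planes that share no line have at most one such
    point in common, and none if their traces meet, by [big_of_common]. *)
Lemma meet_card i j : j != i -> (#|G i j| <= q * (j \in L i) + par j i)%N.
Proof.
move=> ji; case: (boolP (j \in L i)) => [/bigP[_]|jL]; first by lia.
rewrite muln0 add0n; case: (boolP (par j i)) => [_|/parN[a aj ai]].
  by move: jL; rewrite inE ji /= -leqNgt.
rewrite leqn0 cards_eq0; apply/eqP; apply: contraNeq jL => /set0Pn[x].
exact: big_of_common ji ai aj.
Qed.

(** Each of the q(q - 1) points of [E i] lies on exactly one other plane. With only q - 1 parallels,
    [meet_card] gives q |L| + (q - 1) >= q(q - 1), that is q |L| >= (q - 1)^2, hence |L| > q - 2. *)
Lemma big_card i : (q.-1 <= #|L i|)%N.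
Proof.
have : (\sum_(j in [set j | j != i]) #|[set v | v \in pl j] :&: E i| = 1 * #|E i|)%N.
  apply: double_count => v; rewrite inE => /and3P[vi /eqP hv ncv].
  have [j ji Hj] := other_plane hv ncv vi.
  apply/eqP/cards1P; exists j; apply/setP => k; rewrite !inE Hj.
  by case: (eqVneq k i) => //= ->; rewrite eq_sym (negPf ji).
rewrite offpt_card mul1n.
have Hs j : j \in [set j | j != i] -> (#|[set v | v \in pl j] :&: E i| <= q * (j \in L i) + par j i)%N.
  rewrite inE => ji; apply: leq_trans (meet_card ji); apply: subset_leq_card.
  by apply/subsetP => v; rewrite !inE => /and4P[-> -> -> ->].
move=> E1; have := leq_sum (index_enum I) Hs; rewrite E1 big_split /= -big_distrr /=.
set s1 := (\sum_(i0 in _) (i0 \in L i))%N; set s2 := (\sum_(i0 in _) par i0 i)%N.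
have b1 : (s1 <= #|L i|)%N.
  rewrite /s1 -[#|L i|]sum1_card (big_mkcond (mem (L i))) [X in (X <= _)%N]big_mkcond /=.
  by apply: leq_sum => j _; case: ifP => // _; case: (j \in L i).
have b2 : (s2 <= q.-1)%N.
  rewrite -(parC i) /s2 -sum1_card (big_mkcond (mem [set j | par j i])) [X in (X <= _)%N]big_mkcond /=.
  by apply: leq_sum => j _; rewrite !inE; case: (j != i); case: (par j i).
by move: q7; nia.
Qed.

Lemma big_disj i j k v : j \in L i -> k \in L i -> j != k -> v \in G i j -> v \notin pl k.
Proof.
rewrite !inE => /andP[ji _] /andP[ki _] jk /and4P[vi vj /eqP hv ncv].
apply/negP => vk; have := three_planes hv ncv vi vj vk.
by rewrite eq_sym ji (negPf ki) eq_sym (negPf jk) => /(_ isT).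
Qed.

(** Points off C whose second C-plane shares no affine line with [pl i]. By [singleP] that plane is
    parallel to [i]; [no_single] shows that there are no such points. *)
Definition isolated_points i := [set v in E i | [forall j, (j \in L i) ==> (v \notin pl j)]].
Local Notation S := isolated_points.

Lemma singleP i v : v \in S i ->
  exists j, [/\ par j i, v \in G i j, #|G i j| = 1%N & forall k, (v \in pl k) = (k == i) || (k == j)].
Proof.
rewrite 2!inE => /andP[/and3P[vi /eqP hv ncv] /forallP HL].
have [j ji Hj] := other_plane hv ncv vi; exists j.
have vj : v \in pl j by rewrite Hj eqxx orbT.
have vG : v \in G i j by rewrite inE vi vj hv eqxx ncv.
have jL : j \notin L i by apply/negP => jL; have := HL j; rewrite jL vj.
have G0 : (0 < #|G i j|)%N by apply/card_gt0P; exists v.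
have G1 : (#|G i j| <= 1)%N by move: jL; rewrite inE ji /= -leqNgt.
split=> //; last by lia.
apply/negPn/negP => /parN[a aj ai]. case/negP: jL. apply: (big_of_common ji ai aj vG).
Qed.

Definition isolated_parallels i := [set j | par j i && (#|G i j| == 1%N)].
Local Notation sg := isolated_parallels.

Lemma sg_sym i j : (j \in sg i) = (i \in sg j).
Proof. by rewrite !inE meetptC par_sym. Qed.

Lemma sg_single i j : j \in sg i -> exists2 v, v \in S i & v \in G i j.
Proof.
rewrite inE => /andP[pji /eqP G1].
have /card_gt0P[v vG] : (0 < #|G i j|)%N by rewrite G1.
have ji : i != j by apply/eqP => ij; move: pji; rewrite ij (negPf (parI j)).
exists v => //; move: (vG); rewrite !inE => /and4P[vi vj /eqP hv ncv].
rewrite vi hv eqxx ncv /=; apply/forallP => k; apply/implyP => kL; apply/negP => vk.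
have := three_planes hv ncv vi vj vk ji; case/orP => /eqP ek.
  by move: kL; rewrite ek inE eqxx.
by move: kL; rewrite ek inE G1 andbF.
Qed.

(** Each isolated parallel corresponds to its one common point with [pl i], and an isolated point to
    its second plane. *)
Lemma sg_card i : #|sg i| = #|S i|.
Proof.
have : (\sum_(j in sg i) #|[set v | v \in pl j] :&: S i| = 1 * #|S i|)%N.
  apply: double_count => v /singleP[j [pj vG G1 Hj]].
  apply/eqP/cards1P; exists j; apply/setP => k; rewrite !inE Hj.
  case: (eqVneq k i) => [->|_] /=.
    by rewrite (negPf (parI i)) /=; case: eqP => // e; move: pj; rewrite -e (negPf (parI i)).
  by case: (eqVneq k j) => [->|_]; rewrite ?andbF ?andbT // pj G1 eqxx.
rewrite mul1n => <-; rewrite -sum1_card; apply: eq_bigr => j Hj.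
have [v vS vG] := sg_single Hj; move: Hj; rewrite inE => /andP[_ /cards1P[w Hw]].
apply/esym/eqP/cards1P; exists v; apply/setP => x.
have -> : v = w by apply/set1P; rewrite -Hw.
apply/idP/set1P => [|->].
  by rewrite !inE => /andP[xj /andP[/and3P[xi hx ncx] _]]; apply/set1P; rewrite -Hw inE xi xj hx.
have vw : v = w by apply/set1P; rewrite -Hw.
by rewrite inE -vw vS andbT inE; move: vG; rewrite inE => /and4P[].
Qed.

Lemma single_card i : (#|S i| <= q.-1)%N.
Proof.
rewrite -sg_card -(parC i); apply: subset_leq_card; apply/subsetP => j.
by rewrite !inE => /andP[].
Qed.
End Geometry.

(** * The common direction of the lines of intersection *)

Section Geometry.
Variables (F : finFieldType) (h : {scalar 'rV[F]_5}) (Sinf : {vspace 'rV[F]_5})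
  (I : finType) (pl : I -> {vspace 'rV[F]_5}) (cs : {set 'rV[F]_5}).
Hypothesis cf : configuration h Sinf pl cs.
Local Notation V := 'rV[F]_5.
Local Notation q := (fcard F).
Local Notation B := (cblock pl cs).
Local Notation G := (meetpt h pl cs).
Local Notation E := (offpt h pl cs).
Local Notation L := (line_neighbours h pl cs).
Local Notation S := (isolated_points h pl cs).
Implicit Types (i j k l : I) (a b v w x y : V).

Let hS := cf_h cf.

Lemma capP i j v : (v \in (pl i :&: pl j)%VS) = (v \in pl i) && (v \in pl j).
Proof. by rewrite memv_cap. Qed.

Lemma big_neq i j : j \in L i -> j != i.
Proof. by rewrite inE => /andP[]. Qed.

Lemma big_pt i j : j \in L i -> exists x, x \in G i j.
Proof.
by rewrite inE => /andP[_ /card_gt1P[x [_ [xG _ _]]]]; exists x.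
Qed.

Lemma G_aff i j x : x \in G i j -> x \in aff h (pl i :&: pl j).
Proof. by rewrite !inE memv_cap => /and4P[-> -> ->]. Qed.

Lemma big_aff i j : j \in L i -> ~~ (pl i :&: pl j <= Sinf)%VS.
Proof. by case/big_pt => x /G_aff /(affN0 hS). Qed.

(** Two lines of different directions in the plane [pl i] meet in an affine point. It lies on three
    C-planes, so (A3) puts it in C. *)
Lemma big_common_cs i j k : j \in L i -> k \in L i -> j != k ->
  (pl i :&: pl j :&: Sinf != pl i :&: pl k :&: Sinf)%VS ->
  exists a, [/\ a \in cs, a \in pl i, a \in pl j & a \in pl k].
Proof.
move=> jL kL jk ne.
have [dj _] := bigP cf jL; have [dk _] := bigP cf kL.
have d1 : (0 < \dim ((pl i :&: pl j) :&: (pl i :&: pl k)))%N.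
  have := dimv_sum_cap (pl i :&: pl j) (pl i :&: pl k).
  have : (\dim (pl i :&: pl j + pl i :&: pl k) <= 3)%N.
    have : (pl i :&: pl j + pl i :&: pl k <= pl i)%VS by rewrite subv_add !capvSl.
    by move/dimvS; rewrite (cf_dim cf).
  by rewrite dj dk; lia.
have PS : ~~ ((pl i :&: pl j) :&: (pl i :&: pl k) <= Sinf)%VS.
  apply: contraNN ne => PS.
  have key l : l \in L i -> ((pl i :&: pl j) :&: (pl i :&: pl k) <= pl i :&: pl l)%VS ->
     ((pl i :&: pl j) :&: (pl i :&: pl k) = pl i :&: pl l :&: Sinf)%VS.
    move=> lL Pl; apply/eqP; rewrite eqEdim subv_cap Pl PS /=.
    by rewrite (dim_capS hS) ?(big_aff lL) //; have [-> _] := bigP cf lL.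
  by rewrite -(key j jL) ?capvSl // -(key k kL) // capvSr.
have [a] := aff_exists hS PS; rewrite inE memv_cap !capP.
case/andP=> /andP[/andP[ai aj] /andP[_ ak]] ha.
exists a; split => //; apply/negPn/negP => ncs.
have aG : a \in G i j by rewrite inE ai aj ha ncs.
by move: (big_disj cf jL kL jk aG); rewrite ak.
Qed.

Lemma cs_line_off i a b : a \in B i -> b \in B i -> a != b ->
  (q.-2 <= #|[set v in E i | v \in (<[a]> + <[b]>)%VS]|)%N.
Proof.
move=> ai bi ab; have ha := cblock_h cf ai; have hb := cblock_h cf bi.
have d2 := dim_aff2 ha hb ab.
have Ui : (<[a]> + <[b]> <= pl i)%VS.
  by move: ai bi; rewrite subv_add -!memvE !in_cblock => /andP[_ ->] /andP[_ ->].
have Ua : ~~ (<[a]> + <[b]> <= Sinf)%VS.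
  apply/subvPn; exists a; last by rewrite hS ha oner_eq0.
  by rewrite memvE addvSl.
have := aff_split cf Ua; have := line_arc_card cf d2 Ui; rewrite d2 expn1.
have -> : [set v in aff h (<[a]> + <[b]>) | v \notin cs] =
   [set v in E i | v \in (<[a]> + <[b]>)%VS].
  apply/setP => v; rewrite !inE; case: (boolP (v \in (<[a]> + <[b]>)%VS)) => vU; rewrite ?andbF // andbT.
  by rewrite (subvP Ui).
lia.
Qed.

(** If all line neighbours passed through [a], one containing a point off C of a secant [ab] would
    contain [b] as well, hence be [i]. So all points off C on two secants through [a] would be
    isolated: at least 2(q - 2), more than the q - 1 allowed by [single_card]. *)
Lemma big_not_concurrent i a : a \in B i -> ~ (forall l, l \in L i -> a \in pl l).
Proof.
move=> ai HL; have q7 := cf_q cf.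
have offS b : b \in B i -> a != b ->
    [set v in E i | v \in (<[a]> + <[b]>)%VS] \subset S i.
  move=> bi ab; apply/subsetP => x; rewrite inE => /andP[xE xab].
  rewrite inE xE /=; apply/forallP => l; apply/implyP => lL; apply/negP => xl.
  have al := HL l lL.
  have xa : a != x.
    by apply: contraTneq xE => <-; rewrite inE; move: ai; rewrite inE => /andP[-> _]; rewrite !andbF.
  have hx : h x = 1 by move: xE; rewrite inE => /and3P[_ /eqP].
  have ha := cblock_h cf ai; have hb := cblock_h cf bi.
  have e := aff_line_eq ha hb hx ab xa xab.
  have bl : b \in pl l.
    have : (<[a]> + <[b]> <= pl l)%VS by rewrite e subv_add -!memvE al xl.
    by move/subvP; apply; rewrite memvE addvSr.
  have li : l = i; last by move: (big_neq lL); rewrite li eqxx.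
  apply: (cblock_inj cf ab) => //.
    by move: ai; rewrite !in_cblock al => /andP[-> _].
  by move: bi; rewrite !in_cblock bl => /andP[-> _].
have : (2 < #|B i|)%N by rewrite (cblock_card cf); lia.
rewrite (cardsD1 a) ai ltnS => /card_gt1P[b [c []]].
rewrite !in_setD1 => /andP[ba bi] /andP[ca ci] bc.
rewrite eq_sym in ba; rewrite eq_sym in ca.
have := subset_leq_card (_ : [set v in E i | v \in (<[a]> + <[b]>)%VS] :|:
   [set v in E i | v \in (<[a]> + <[c]>)%VS] \subset S i).
rewrite subUset !offS // => /(_ isT).
rewrite cardsU disjoint_setI0 ?cards0.
  have := single_card cf i; have := cs_line_off ai bi ba; have := cs_line_off ai ci ca.
  lia.
rewrite -setI_eq0; apply/eqP/setP => x; rewrite !inE; apply/negP.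
case/andP => /andP[/and3P[xi /eqP hx ncx] xb] /andP[_ xc].
have xa : a != x.
  by apply: contraNneq ncx => <-; move: ai; rewrite inE => /andP[].
have ha := cblock_h cf ai; have hb := cblock_h cf bi; have hc := cblock_h cf ci.
have eb := aff_line_eq ha hb hx ba xa xb.
have ec := aff_line_eq ha hc hx ca xa xc.
have cU : c \in (<[a]> + <[b]>)%VS by rewrite eb -ec memvE addvSr.
have := arc_line cf ai bi ba ci cU; rewrite eq_sym (negPf ca) eq_sym.
by rewrite (negPf bc).
Qed.

(** If two directions occur, their lines meet in a point [a] of C. Any further line differs in
    direction from one of the two, so it meets that one in a point of C; this is [a], since distinct
    planes share at most one point of C. All lines then pass through [a], against
    [big_not_concurrent]. *)
Lemma big_same_dir i j k : j \in L i -> k \in L i ->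
  (pl i :&: pl j :&: Sinf = pl i :&: pl k :&: Sinf)%VS.
Proof.
move=> jL kL; case: (eqVneq j k) => [->//|jk]; apply/eqP/negPn/negP => ne.
have [a [ca ai aj ak]] := big_common_cs jL kL jk ne.
have uniq l b : l \in L i -> a \in pl l -> b \in cs -> b \in pl i -> b \in pl l -> b = a.
  move=> lL al cb bi bl; apply/eqP/negPn/negP => ba; move: (big_neq lL).
  by rewrite (cf_inj cf cb ca ba bl al bi ai) eqxx.
apply: (big_not_concurrent (i := i) (a := a)); first by rewrite in_cblock ca ai.
move=> l lL; case: (eqVneq l j) => [->//|lj]; case: (eqVneq l k) => [->//|lk].
case: (eqVneq (pl i :&: pl l :&: Sinf)%VS (pl i :&: pl j :&: Sinf)%VS) => [e|nj].
  have nk : (pl i :&: pl l :&: Sinf)%VS != (pl i :&: pl k :&: Sinf)%VS by rewrite e.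
  have [b [cb bi bl bk]] := big_common_cs lL kL lk nk.
  by rewrite -(uniq k b).
have [b [cb bi bl bj]] := big_common_cs lL jL lj nj.
by rewrite -(uniq j b).
Qed.

Lemma direction i : exists m : V,
  [/\ m != 0, h m = 0, m \in pl i & forall j, j \in L i -> m \in pl j].
Proof.
have q7 := cf_q cf.
have /card_gt0P[j jL] : (0 < #|L i|)%N by have := big_card cf i; lia.
set D := (pl i :&: pl j :&: Sinf)%VS.
have D0 : D != 0%VS.
  rewrite -dimv_eq0 (dim_capS hS) ?(big_aff jL) //.
  by have [-> _] := bigP cf jL.
exists (vpick D); have := memv_pick D; rewrite {2}/D !memv_cap => /andP[/andP[mi mj] mS].
split=> //; first by rewrite vpick0.
  by apply/eqP; rewrite -hS.
move=> k kL; have := memv_pick D; rewrite {2}/D (big_same_dir jL kL).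
by rewrite !memv_cap => /andP[/andP[]].
Qed.

(** On the line through an isolated point in the common direction all points off C are isolated: a
    neighbour through one of them would contain the line. Two such lines would leave q^2 - 2q affine
    points for at least q - 1 disjoint neighbour lines of q points each. At most two points of the
    line are in C, and at least one is, because there are at most q - 1 isolated points. *)
Lemma single_line i x : x \in S i -> exists W : {vspace V},
  [/\ \dim W = 2%N, (W <= pl i)%VS, (forall v, v \in S i -> v \in W),
      (exists2 a, a \in cs & a \in W) & (q.-2 <= #|S i|)%N].
Proof.
move=> xS; have q7 := cf_q cf.
have [m [m0 hm mi mL]] := direction i.
have SE v : v \in S i -> [/\ v \in pl i, h v = 1 & v \notin cs].
  by rewrite !inE => /andP[/and3P[-> /eqP -> ->]].
pose W (y : V) : {vspace V} := (<[y]> + <[m]>)%VS.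
have yW y : y \in W y by rewrite memvE addvSl.
have mW y : m \in W y by rewrite memvE addvSr.
have dW y : h y = 1 -> \dim (W y) = 2%N by move=> hy; rewrite (dim_line2 hy).
have Wi y : y \in pl i -> (W y <= pl i)%VS by rewrite subv_add -!memvE mi => ->.
have WS y : h y = 1 -> ~~ (W y <= Sinf)%VS.
  by move=> hy; apply/subvPn; exists y; rewrite // hS hy oner_eq0.
have Wtr y v : h y = 1 -> h v = 1 -> v \in W y -> W v = W y.
  by move=> hy hv vW; apply/esym/(dim2_span _ vW _ hv m0 hm); rewrite ?dW.
have noW v y j : v \in S i -> j \in L i -> h y = 1 -> y \in W v -> y \notin pl j.
  move=> vS jL hy yv; have [vi hv ncv] := SE _ vS; apply/negP => yj.
  move: (vS); rewrite inE => /andP[_ /forallP/(_ j)]; rewrite jL /=; case/negP.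
  have : (W y <= pl j)%VS by rewrite subv_add -!memvE yj mL.
  by rewrite (Wtr v y) // => /subvP; apply.
have [xi hx ncx] := SE _ xS.
have EW : [set v in aff h (W x) | v \notin cs] \subset S i.
  apply/subsetP => v; rewrite !inE => /andP[/andP[vW /eqP hv] ncv].
  rewrite (subvP (Wi x xi)) // hv eqxx ncv /=; apply/forallP => j; apply/implyP => jL.
  exact: noW xS jL hv vW.
have := subset_leq_card EW; have := aff_split cf (WS x hx).
have := line_arc_card cf (dW x hx) (Wi x xi); rewrite dW // expn1 => c2 cs1 cs2.
exists (W x); split=> //; first exact: dW.
- exact: Wi.
- move=> v vS; apply/negPn/negP => vW; have [vi hv ncv] := SE _ vS.
  set X := (aff h (pl i) :\: aff h (W x)) :\: aff h (W v).
  have disj y j k : y \in X -> j \in L i -> k \in L i ->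
      y \in aff h (pl i :&: pl j) -> y \in aff h (pl i :&: pl k) -> j = k.
    move=> yX jL kL.
    rewrite !inE !memv_cap => /andP[/andP[yi yj] /eqP hy] /andP[/andP[_ yk] _].
    apply/eqP/negPn/negP => jk; have [z zG] := big_pt jL.
    have := big_disj cf jL kL jk zG; case/negP.
    move: (zG); rewrite inE => /and4P[zi zj /eqP hz _].
    have : z \in (pl i :&: pl j)%VS by rewrite memv_cap zi.
    have [dj _] := bigP cf jL.
    rewrite (dim2_span dj _ _ hy m0 hm) ?memv_cap ?yi ?yj ?mi ?mL //.
    by apply/subvP; rewrite subv_add -!memvE yk mL.
  have := double_count_le disj.
  rewrite (eq_bigr (fun=> q)); last first.
    move=> j jL; rewrite (setIidPl _).
      by have [dj _] := bigP cf jL; rewrite (card_aff hS (big_aff jL)) dj expn1.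
    apply/subsetP => y; rewrite !inE memv_cap => /andP[/andP[yi yj] /eqP hy].
    rewrite hy eqxx yi !andbT; apply/andP; split; apply/negP => yW'.
      by have := noW v y j vS jL hy yW'; rewrite yj.
    by have := noW x y j xS jL hy yW'; rewrite yj.
  rewrite sum_nat_const /X !cardsD.
  have affi : #|aff h (pl i)| = (q * q)%N by rewrite (card_aff hS (cf_aff cf i)) (cf_dim cf) mulnn.
  have affW y : y \in pl i -> h y = 1 -> #|aff h (W y)| = q.
    by move=> yi hy; rewrite (card_aff hS (WS y hy)) dW // expn1.
  rewrite [#|_ :&: aff h (W x)|](_ : _ = q); last first.
    rewrite (setIidPr _) ?affW //; apply/subsetP => y; rewrite !inE => /andP[/(subvP (Wi x xi)) -> ->//].
  rewrite [#|_ :&: aff h (W v)|](_ : _ = q); last first.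
    rewrite (setIidPr _) ?affW //; apply/subsetP => y; rewrite !inE => /andP[yW2 hy].
    rewrite (subvP (Wi v vi) _ yW2) hy !andbT; apply: contraNN vW => yx.
    by rewrite -(Wtr x y) ?(eqP hy) // (Wtr v y) ?(eqP hy).
  by rewrite affi; move: q7 (big_card cf i); clear; nia.
- have : (0 < #|[set a in cs | a \in W x]|)%N by have := single_card cf i; lia.
  by case/card_gt0P => a; rewrite inE => /andP[ca aW]; exists a.
- lia.
Qed.

End Geometry.

(** * Absence of isolated points; the nodes *)

Section Geometry.
Variables (F : finFieldType) (h : {scalar 'rV[F]_5}) (Sinf : {vspace 'rV[F]_5})
  (I : finType) (pl : I -> {vspace 'rV[F]_5}) (cs : {set 'rV[F]_5}).
Hypothesis cf : configuration h Sinf pl cs.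
Local Notation V := 'rV[F]_5.
Local Notation q := (fcard F).
Local Notation B := (cblock pl cs).
Local Notation par := (parallel B).
Local Notation G := (meetpt h pl cs).
Local Notation E := (offpt h pl cs).
Local Notation S := (isolated_points h pl cs).
Local Notation sg := (isolated_parallels h pl cs).
Implicit Types (i j k l : I) (a b v w x y : V).

Let hS := cf_h cf.
Let parC := par_card (q_gt1 cf) (cblock_sub pl cs) (cblock_card cf) (cf_card cf) (cblock_join cf) (cblock_inj cf).
Let parT := par_trans (q_gt1 cf) (cblock_sub pl cs) (cblock_card cf) (cf_card cf) (cblock_join cf) (cblock_inj cf).
Let parI := par_irr (q_gt1 cf) (cblock_card cf).

Lemma par_neq i j : par i j -> i != j.
Proof. by apply: contraTneq => ->; apply: parI. Qed.

Lemma par_cs i j a : par i j -> a \in cs -> a \in pl i -> a \notin pl j.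
Proof.
move=> ij ca ai; have /parP/(_ (_ : a \in B i)) := ij.
by rewrite !in_cblock ca ai /= => /(_ isT).
Qed.

Lemma G_common i j v : v \in G i j ->
  [/\ v \in pl i, v \in pl j, h v = 1 & v \notin cs].
Proof. by rewrite inE => /and4P[-> -> /eqP -> ->]. Qed.

(* The isolated points of a plane lie on one line. The lines of the isolated
   parallels of [i] meet pairwise in distinct points, hence lie in one plane,
   which contains more than four points of [cs]; so it is a third plane of the
   configuration through one of those points. *)
Lemma no_single i : S i = set0.
Proof.
(* Here q >= 7 makes q - 2 exceed the four points allowed by (A1). *)
apply/eqP/negPn/negP => Si; have q7 := cf_q cf; have q2 : (4 < q.-2)%N by lia.
have HW j : exists W : {vspace V}, S j != set0 ->
  [/\ \dim W = 2%N, (W <= pl j)%VS, (forall v, v \in S j -> v \in W),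
      (exists2 a, a \in cs & a \in W) & (q.-2 <= #|S j|)%N].
  case: (boolP (S j == set0)) => [_|/set0Pn[x /(single_line cf)[W HW]]].
    by exists 0%VS.
  by exists W.
have {HW}[W HW] := fin_all_exists HW.
have sgS j k : k \in sg j -> S k != set0.
  rewrite sg_sym => /(sg_single cf)[v vS _]; apply/set0Pn; by exists v.
have sgp j k : k \in sg j -> par k j by rewrite inE => /andP[].
have pt j k : k \in sg j -> exists v, [/\ v \in G j k, v \in W j & v \in W k].
  move=> kj; have [v vS vG] := sg_single cf kj.
  move: (kj); rewrite sg_sym => jk; have [w wS wG] := sg_single cf jk.
  have [_ _ Wj _ _] := HW j (sgS _ _ jk); have [_ _ Wk _ _] := HW k (sgS _ _ kj).
  exists v; split=> //; first exact: Wj.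
  suff -> : v = w by apply: Wk.
  move: kj vG wG; rewrite inE [G k j]meetptC => /andP[_ /cards1P[z ->]].
  by rewrite !inE => /eqP -> /eqP ->.
(* Of the q - 1 parallels of [j], at least q - 2 are isolated. *)
have few j : S j != set0 -> (#|[set k | par k j] :\: sg j| <= 1)%N.
  move=> Sj; have [_ _ _ _] := HW j Sj; rewrite -(sg_card cf) cardsD parC (setIidPr _); first by lia.
  by apply/subsetP => k; rewrite [in X in _ -> X]inE; apply: sgp.
have [di Wi _ [ai cai aiW] cSi] := HW i Si.
have cJ : (q.-2 <= #|sg i|)%N by rewrite (sg_card cf).
have /card_gt0P[j1 J1] : (0 < #|sg i|)%N by lia.
have [j2 [J2 j21]] : exists j2, j2 \in sg i /\ j2 \in sg j1.
  have : (0 < #|(sg i :\ j1) :&: sg j1|)%N.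
    have : (#|(sg i :\ j1) :\: sg j1| <= 1)%N.
      apply: leq_trans (few j1 (sgS _ _ J1)); apply: subset_leq_card.
      apply: setSD; apply/subsetP => k; rewrite in_setD1 [in X in _ -> X]inE => /andP[kj kJ].
      by apply: parT kj; [apply: sgp kJ | rewrite par_sym sgp].
    by have := cardsID (sg j1) (sg i :\ j1); have := cardsD1 j1 (sg i); rewrite J1; lia.
  by case/card_gt0P => j2; rewrite in_setI in_setD1 => /andP[/andP[_ ?] ?]; exists j2.
have [d1 W1 _ [a1 ca1 a1W] _] := HW j1 (sgS _ _ J1).
have [d2 W2 _ _ _] := HW j2 (sgS _ _ J2).
pose P := (W i + W j1)%VS.
have dP : \dim P = 3%N.
  have := dimv_sum_cap (W i) (W j1); rewrite -/P di d1.
  have [v [vG vi v1]] := pt _ _ J1; have [_ _ hv _] := G_common vG.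
  have : (0 < \dim (W i :&: W j1))%N.
    rewrite lt0n dimv_eq0; apply: contraNneq (h1_neq0 hv) => e0.
    by rewrite -memv0 -e0 memv_cap vi.
  have : (\dim (W i :&: W j1) < 2)%N.
    rewrite ltnNge; apply/negP => d2'.
    have e1 : (W i :&: W j1 = W i)%VS by apply/eqP; rewrite eqEdim capvSl di.
    have e2 : (W i :&: W j1 = W j1)%VS by apply/eqP; rewrite eqEdim capvSr d1.
    have : a1 \in pl i by rewrite (subvP Wi) // -e1 e2.
    by apply/negP; apply: (par_cs (sgp _ _ J1)) => //; apply: subvP a1W.
  have aux (d e : nat) : (e < 2 -> 0 < e -> d + e = 2 + 2 -> d = 3)%N by clear; lia.
  exact: aux.
have two_pts k x y : \dim (W k) = 2%N -> h x = 1 -> h y = 1 -> x != y -> x \in W k ->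
    y \in W k -> x \in P -> y \in P -> (W k <= P)%VS.
  move=> dk hx hy xy xk yk xP yP; rewrite (dim2_aff2 (h := h) dk _ _ xy) ?inE ?xk ?yk ?hx ?hy ?eqxx //.
  by rewrite subv_add -!memvE xP.
have WiP : (W i <= P)%VS by apply: addvSl.
have W1P : (W j1 <= P)%VS by apply: addvSr.
(* [W k] meets [W i] and [W l] in two points of [P]. They differ, since a common one would lie on
   the three planes [i], [k] and [l]. *)
have third k l : k \in sg i -> l \in sg i -> k \in sg l -> (W l <= P)%VS -> (W k <= P)%VS.
  move=> ki li kl WlP; have [dk _ _ _ _] := HW k (sgS _ _ ki).
  have [x [xG xi xk]] := pt _ _ ki; have [y [yG yl yk]] := pt _ _ kl.
  have [xpi xpk hx ncx] := G_common xG; have [ypl ypk hy _] := G_common yG.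
  apply: (two_pts k x y) => //; [|exact: subvP xi|exact: subvP yl].
  apply/eqP => xy; rewrite -xy in ypl.
  have li' := par_neq (sgp _ _ li); rewrite eq_sym in li'.
  have := three_planes cf hx ncx xpi ypl xpk li'.
  by rewrite (negPf (par_neq (sgp _ _ ki))) (negPf (par_neq (sgp _ _ kl))).
have W2P := third _ _ J2 J1 j21 W1P.
(* If [k] were isolated from neither [j1] nor [j2], that is had neither as an isolated parallel, it
   would have two exceptional parallels, against [few]. *)
have all_in k : k \in sg i -> (W k <= P)%VS.
  move=> ki; case: (eqVneq k j1) => [->//|k1]; case: (eqVneq k j2) => [->//|k2].
  case: (boolP (k \in sg j1)) => [kj|nk1]; first exact: third kj W1P.
  case: (boolP (k \in sg j2)) => [kj|nk2]; first exact: third kj W2P.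
  have := few k (sgS _ _ ki); rewrite leqNgt => /negP; case; apply/card_gt1P.
  exists j1; exists j2.
  have nj1 : j1 \notin sg k by rewrite sg_sym.
  have nj2 : j2 \notin sg k by rewrite sg_sym.
  rewrite !in_setD nj1 nj2 /=.
  have pk j : j \in sg i -> k != j -> j \in [set k0 | par k0 k].
    move=> ji kj; rewrite inE; apply: parT; first exact: sgp ji; last by rewrite eq_sym.
    by rewrite par_sym sgp.
  by rewrite !pk //; split => //; rewrite eq_sym; apply: par_neq; apply: sgp.
have [r Pr] : exists r, P = pl r.
  apply: (cf_big cf dP).
  have Ha k : exists a, k \in sg i -> [/\ a \in cs, a \in W k & a \in pl k].
    case: (boolP (k \in sg i)) => [ki|_]; last by exists 0.
    have [_ Wk _ [a ca aW] _] := HW k (sgS _ _ ki); exists a; split=> //.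
    exact: subvP aW.
  have {Ha}[a Ha] := fin_all_exists Ha.
  have injA : {in sg i &, injective a}.
    move=> k l ki li akl; apply/eqP/negPn/negP => kl.
    have [ca ak apk] := Ha k ki; have [_ _ apl] := Ha l li.
    have pkl : par k l by apply: parT kl; [apply: sgp ki | rewrite par_sym sgp].
    by have := par_cs pkl ca apk; rewrite akl apl.
  have : (4 < #|a @: sg i|)%N by rewrite card_in_imset //; apply: leq_trans q2 cJ.
  move/leq_trans; apply; apply: subset_leq_card; apply/subsetP => _ /imsetP[k ki ->].
  by have [ca ak _] := Ha k ki; rewrite inE ca (subvP (all_in k ki)).
have [x [xG xi x1]] := pt _ _ J1; have [xpi xp1 hx ncx] := G_common xG.
have xr : x \in pl r by rewrite -Pr (subvP WiP).
have ij : i != j1 by rewrite eq_sym par_neq ?sgp.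
case/orP: (three_planes cf hx ncx xpi xp1 xr ij) => /eqP er.
  have := par_cs (sgp _ _ J1) ca1 (subvP W1 _ a1W).
  by rewrite -er -Pr (subvP W1P).
have : par i j1 by rewrite par_sym sgp.
move/par_cs => /(_ ai cai (subvP Wi _ aiW)).
by rewrite -er -Pr (subvP WiP).
Qed.

Lemma direction_cover i : exists m : V, [/\ m != 0, h m = 0, m \in pl i &
  forall x, x \in E i -> exists j, [/\ j != i, x \in pl j & m \in pl j]].
Proof.
have [m [m0 hm mi mL]] := direction cf i; exists m; split=> // x xE.
have := in_set0 x; rewrite -(no_single i) inE xE /= => /negbT.
rewrite negb_forall => /existsP[j]; rewrite negb_imply negbK => /andP[jL xj].
by exists j; rewrite (big_neq jL) xj (mL j jL).
Qed.

(* Every point of [pl i] off [cs] lies on a line through the node [n i] common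
   with another plane of the configuration: [<[n i]>] is the infinite point of the
   conic of [pl i]. *)
Lemma directions : exists n : I -> V, forall i,
  [/\ n i != 0, h (n i) = 0, n i \in pl i &
   forall x, x \in E i -> exists j, [/\ j != i, x \in pl j & n i \in pl j]].
Proof. exact: fin_all_exists direction_cover. Qed.

Variable n : I -> V.
Hypothesis Hn : forall i,
  [/\ n i != 0, h (n i) = 0, n i \in pl i &
   forall x, x \in E i -> exists j, [/\ j != i, x \in pl j & n i \in pl j]].

(** A secant through the node has a point off C. The second plane through that point contains the
    node, hence the whole secant, against (A2). So a line of [pl i] through the node carries at most
    one point of C. *)
Lemma n_tangent i a t : a \in B i -> a + t *: n i \in cs -> t = 0.
Proof.
move=> ai cb; have [n0 hn ni Hx] := Hn i; have q7 := cf_q cf.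
apply/eqP/negPn/negP => t0; set b := a + _ in cb.
have ab : a != b by rewrite /b -subr_eq0 opprD addrA subrr sub0r oppr_eq0 scaler_eq0 negb_or t0.
have bi : b \in B i.
  by move: ai; rewrite !in_cblock cb => /andP[_ ai] /=; rewrite memvD // memvZ.
have : (0 < #|[set v in E i | v \in (<[a]> + <[b]>)%VS]|)%N.
  by apply: leq_trans (cs_line_off cf ai bi ab); lia.
case/card_gt0P => x; rewrite inE => /andP[xE xab].
have [j [ji xj nj]] := Hx x xE.
have [ha hb] := (cblock_h cf ai, cblock_h cf bi).
have hx : h x = 1 by move: xE; rewrite inE => /and3P[_ /eqP].
have Un : (<[a]> + <[b]> = <[x]> + <[n i]>)%VS.
  apply: (dim2_span (h := h)) => //; first exact: dim_aff2 ha hb ab.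
  have -> : n i = t^-1 *: (b - a) by rewrite /b addrC addKr scalerA mulVf // scale1r.
  by rewrite memvZ // memvB ?memvE ?addvSr ?addvSl.
have : (<[a]> + <[b]> <= pl j)%VS by rewrite Un subv_add -!memvE xj.
rewrite subv_add -!memvE => /andP[aj bj]; case/eqP: ji.
apply: (cblock_inj cf ab) => //; move: ai bi; rewrite !in_cblock ?aj ?bj ?andbT.
  by move/andP=> [].
by move=> _ /andP[].
Qed.

Lemma n_line_E i a t : a \in B i -> t != 0 -> a + t *: n i \in E i.
Proof.
move=> ai t0; have [n0 hn ni _] := Hn i; rewrite inE linearD linearZ /= hn mulr0 addr0.
rewrite (cblock_h cf ai) eqxx /=; move: (ai); rewrite in_cblock => /andP[_ api].
by rewrite memvD ?memvZ //=; apply: contra_neqN t0; apply: n_tangent.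
Qed.

(** The lines joining the q points of [B i] to the node are distinct by [n_tangent]; their q^2
    affine points are all those of [pl i]. *)
Lemma n_cover i x : x \in pl i -> h x = 1 -> exists2 a, a \in B i & exists t, x = a + t *: n i.
Proof.
move=> xi hx; have [n0 hn ni _] := Hn i.
pose f (p : V * F) := p.1 + p.2 *: n i.
have sub a t : a \in B i -> a + t *: n i \in aff h (pl i).
  move=> ai; rewrite inE linearD linearZ /= hn mulr0 addr0 (cblock_h cf ai) eqxx andbT.
  by move: ai; rewrite in_cblock => /andP[_ api]; rewrite memvD ?memvZ.
have inj : {in setX (B i) [set: F] &, injective f}.
  move=> [a t] [b u]; rewrite !in_setX /= => /andP[ai _] /andP[bi _] e; rewrite /f /= in e.
  have eb : a + (t - u) *: n i = b by rewrite scalerBl addrA e addrK.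
  have tu : t - u = 0 by apply: (n_tangent ai); rewrite eb; move: bi; rewrite in_cblock => /andP[].
  by rewrite tu scale0r addr0 in eb; rewrite eb; congr (_, _); apply/eqP; rewrite -subr_eq0 tu.
have e : f @: setX (B i) [set: F] = aff h (pl i).
  apply/eqP; rewrite eqEcard; apply/andP; split.
    by apply/subsetP => _ /imsetP[[a t] /setXP[/= ai _] ->]; apply: sub.
  rewrite card_in_imset // cardsX (cblock_card cf) cardsT (card_aff hS (cf_aff cf i)) (cf_dim cf).
  by rewrite -mulnn.
have : x \in aff h (pl i) by rewrite inE xi hx eqxx.
by rewrite -e => /imsetP[[a t] /setXP[/= ai _] ->]; exists a => //; exists t.
Qed.

(** The second plane through [x] is unique by (A3), so it is the one containing the node. It
    contains the line from [x] to the node, and with it the point of C that this line carries by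
    [n_cover]. *)
Lemma n_meet i j x : j != i -> x \in G i j ->
  n i \in pl j /\ exists a, [/\ a \in B i, a \in B j & exists t, x = a + t *: n i].
Proof.
move=> ji xG; have [xi xj hx ncx] := G_common xG; have [n0 hn ni Hx] := Hn i.
have xE : x \in E i by rewrite inE xi hx eqxx ncx.
have [k [ki xk nk]] := Hx x xE.
have ij : i != j by rewrite eq_sym.
have := three_planes cf hx ncx xi xj xk ij; rewrite (negPf ki) /= => /eqP kj; subst k.
split=> //; have [a ai [t xt]] := n_cover xi hx; exists a; split=> //; last by exists t.
move: (ai); rewrite !in_cblock => /andP[-> _] /=.
by rewrite -[a](addrK (t *: n i)) -xt memvB // memvZ.
Qed.

(** Each node lies in the other plane too, so both are the infinite point of the common line. *)
Lemma n_meet_eq i j x : j != i -> x \in G i j -> (<[n i]> = <[n j]>)%VS.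
Proof.
move=> ji xG; have ij : i != j by rewrite eq_sym.
have xG' : x \in G j i by rewrite meetptC.
have [nj _] := n_meet ji xG; have [ni _] := n_meet ij xG'.
have [xi xj hx ncx] := G_common xG.
have [n0 hn nii _] := Hn i; have [m0 hm njj _] := Hn j.
have d2 : \dim (pl i :&: pl j) = 2%N.
  apply/eqP; rewrite eqn_leq (dim_cap_le cf ij) -{1}(dim_line2 hx n0 hn).
  by apply: dimvS; rewrite subv_add !subv_cap -!memvE xi xj nii nj.
have d1 : \dim (pl i :&: pl j :&: Sinf) = 1%N.
  by rewrite (dim_capS hS) ?d2 //; apply/subvPn; exists x; rewrite ?memv_cap ?xi // hS hx oner_eq0.
have e m : m != 0 -> h m = 0 -> m \in pl i -> m \in pl j -> (<[m]> = pl i :&: pl j :&: Sinf)%VS.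
  move=> m'0 hm' mi mj; apply/eqP; rewrite eqEdim d1 dim_vline m'0 -memvE !memv_cap mi mj hS hm'.
  by rewrite eqxx.
by rewrite (e (n i)) // (e (n j)).
Qed.

(** The second plane through the point [a + n i], which is off C, contains the node and therefore
    [a]. *)
Lemma n_partner i a : a \in B i -> exists j, [/\ j != i, a \in B j & a + n i \in G i j].
Proof.
move=> ai; have [n0 hn ni Hx] := Hn i.
have xE := n_line_E ai (oner_neq0 F); rewrite scale1r in xE.
have [j [ji xj nj]] := Hx _ xE; exists j; split=> //.
  move: ai; rewrite !in_cblock => /andP[-> _] /=.
  by rewrite -[a](addrK (n i)) memvB.
by move: xE; rewrite !inE xj => /and3P[-> -> ->].
Qed.

End Geometry.

(** * Nodes of parallel planes *)

Section Geometry.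
Variables (F : finFieldType) (h : {scalar 'rV[F]_5}) (Sinf : {vspace 'rV[F]_5})
  (I : finType) (pl : I -> {vspace 'rV[F]_5}) (cs : {set 'rV[F]_5}).
Hypothesis cf : configuration h Sinf pl cs.
Local Notation V := 'rV[F]_5.
Local Notation q := (fcard F).
Local Notation B := (cblock pl cs).
Local Notation par := (parallel B).
Local Notation G := (meetpt h pl cs).
Local Notation E := (offpt h pl cs).
Implicit Types (i j k l : I) (a b v w x y : V).

Let hS := cf_h cf.
Let parT := par_trans (q_gt1 cf) (cblock_sub pl cs) (cblock_card cf) (cf_card cf) (cblock_join cf) (cblock_inj cf).

Variable n : I -> V.
Hypothesis Hn : forall i,
  [/\ n i != 0, h (n i) = 0, n i \in pl i &
   forall x, x \in E i -> exists j, [/\ j != i, x \in pl j & n i \in pl j]].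

Lemma n_mem i j : (<[n i]> = <[n j]>)%VS -> n i \in pl j.
Proof.
move=> e; have [_ _ nj _] := Hn j.
have : n i \in <[n j]>%VS by rewrite -e memv_line.
by case/vlineP => k ->; rewrite memvZ.
Qed.

Lemma meet1 i j : j != i -> #|B j :&: B i| = ~~ par j i.
Proof.
move=> ji; case: (boolP (par j i)) => [|/parN[a aj ai]] /=.
  by rewrite /parallel -setI_eq0 => /eqP->; rewrite cards0.
apply/eqP/cards1P; exists a; apply/setP => b; rewrite !inE.
apply/idP/eqP => [|->]; last by move: aj ai; rewrite !inE => -> ->.
rewrite -!in_cblock => /andP[bj bi]; apply/eqP; apply: contraNT ji => ba.
by apply/eqP; apply: (cblock_inj cf ba).
Qed.

(** Every plane through [a] with this node contains [a + n j], a point off C, and only two planes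
    do. *)
Lemma n_through i0 j a : (<[n j]> = <[n i0]>)%VS -> a \in B j ->
  exists2 k, k != j & [set l in [set l | <[n l]>%VS == <[n i0]>%VS] | a \in B l] = [set j; k].
Proof.
move=> ej aj; have [k [kj ak xG]] := n_partner cf Hn aj; exists k => //.
have ek := n_meet_eq cf Hn kj xG.
have [xj xk hx ncx] := G_common xG.
apply/setP => l; rewrite !inE -in_cblock; apply/idP/idP => [/andP[/eqP el al]|].
  rewrite eq_sym in kj; apply: (three_planes cf hx ncx xj xk _ kj).
  have nl : n j \in pl l by apply: n_mem; rewrite ej el.
  by move: al; rewrite in_cblock => /andP[_ al]; rewrite memvD.
by case/orP => /eqP ->; rewrite ?ej ?aj ?ak -?ek ?ej eqxx.
Qed.

(* Parity: the planes with node [<[n i0]>] pass twice or not at all through each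
   point of [cs]; a plane parallel to [i0] with another node would meet exactly
   the [q] planes, an odd number, that meet [i0]. *)
Lemma par_n i i0 : par i i0 -> (<[n i]> = <[n i0]>)%VS.
Proof.
move=> pi0; apply/eqP/negPn/negP => ne.
pose N := [set l | <[n l]>%VS == <[n i0]>%VS].
have iN : i \notin N by rewrite inE.
have E1 : ~~ odd (\sum_(j in N) #|B j :&: B i|).
  rewrite double_count_sum; apply: (big_ind (fun m => ~~ odd m)) => // [m m'|a ai].
    by rewrite oddD => /negPf-> /negPf->.
  case: (set_0Vmem [set l in N | a \in B l]) => [->|[l]]; first by rewrite cards0.
  rewrite !inE -in_cblock => /andP[/eqP el al].
  by have [k kl ->] := n_through el al; rewrite cards2 eq_sym kl.
have E2 : (\sum_(j in N :\ i0) #|B j :&: B i0| = 1 * #|B i0|)%N.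
  apply: double_count => a ai; have [k ki Nk] := n_through (erefl _) ai.
  apply/eqP/cards1P; exists k; apply/setP => l; rewrite !inE.
  move/setP/(_ l): Nk; rewrite !inE -!in_cblock -andbA => ->.
  by case: (eqVneq l i0) => //= ->; rewrite eq_sym (negPf ki).
move: E1; suff -> : (\sum_(j in N) #|B j :&: B i| = \sum_(j in N :\ i0) #|B j :&: B i0|)%N.
  by rewrite E2 mul1n (cblock_card cf) (cf_odd cf).
have i0N : i0 \in N by rewrite inE.
rewrite (big_setD1 i0) //= [#|B i0 :&: B i|](_ : _ = 0%N) ?add0n; last first.
  rewrite meet1; last by rewrite eq_sym (par_neq cf).
  by rewrite par_sym pi0.
apply: eq_bigr => j; rewrite in_setD1 => /andP[ji0 jN].
have ji : j != i by apply: contraNneq iN => <-.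
rewrite !meet1 //; congr (nat_of_bool (~~ _)); apply/idP/idP => pj; apply: parT pj _ _ => //.
by rewrite par_sym.
Qed.

Definition eqpar i j := (i == j) || par i j.

Lemma ep_refl i : eqpar i i. Proof. by rewrite /eqpar eqxx. Qed.
Lemma ep_sym i j : eqpar i j = eqpar j i. Proof. by rewrite /eqpar eq_sym par_sym. Qed.
Lemma ep_trans i j k : eqpar i j -> eqpar j k -> eqpar i k.
Proof.
rewrite /eqpar => /orP[/eqP->//|ij] /orP[/eqP<-|jk]; first by rewrite ij orbT.
by case: eqVneq => //= ik; apply: parT ij jk ik.
Qed.
Lemma ep_n i j : eqpar i j -> (<[n i]> = <[n j]>)%VS.
Proof. by case/orP => [/eqP->//|/par_n]. Qed.
Lemma ep_common i j a : eqpar i j -> a \in B i -> a \in B j -> i = j.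
Proof. by case/orP => [/eqP//|/parP H ai aj]; move: (H a ai); rewrite aj. Qed.
Lemma ep_through a i : a \in cs -> exists2 j, eqpar j i & a \in B j.
Proof.
move=> ca; have [j /andP[aj H]] := class_through (q_gt1 cf) (cblock_sub pl cs) (cblock_card cf) (cf_card cf)
   (cblock_join cf) (cblock_inj cf) i ca.
by exists j.
Qed.
Lemma ep_meet i j : ~~ eqpar i j -> exists2 a, a \in B i & a \in B j.
Proof. by rewrite negb_or => /andP[_ /parN]. Qed.

(** The node is not on the line [ab], by [n_tangent]. *)
Lemma plane_span i a b : a \in B i -> b \in B i -> a != b ->
  pl i = (<[a]> + <[b]> + <[n i]>)%VS.
Proof.
move=> ai bi ab; have [n0 hn ni _] := Hn i.
have [ha hb] := (cblock_h cf ai, cblock_h cf bi).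
apply/esym/eqP; rewrite eqEdim (cf_dim cf) !subv_add -!memvE ni andbT.
have [ca api] : a \in cs /\ a \in pl i by apply/andP; rewrite -in_cblock.
have [cb bpi] : b \in cs /\ b \in pl i by apply/andP; rewrite -in_cblock.
rewrite api bpi /= dimv_disjoint_sum.
  by rewrite (dim_aff2 ha hb ab) dim_vline n0.
apply/eqP; rewrite -subv0; apply/subvP => v; rewrite memv_cap memv0 => /andP[].
case/memv_addP => _ /vlineP[k ->] [_ /vlineP[l ->] ->] /vlineP[t e].
have := congr1 h e; rewrite linearD !linearZ /= ha hb hn mulr0 !mulr1 => kl.
have kE : k = - l by apply/eqP; rewrite -addr_eq0 kl.
case: (eqVneq l 0) => [l0|l0]; first by rewrite kE l0 oppr0 !scale0r addr0.
have eb : b = a + (l^-1 * t) *: n i.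
  apply: (scalerI l0); rewrite scalerDr scalerA mulrA divff // mul1r -e kE.
  by rewrite scaleNr addrA subrr add0r.
have t0 : l^-1 * t = 0 by apply: (n_tangent cf Hn ai); rewrite -eb.
by case/eqP: ab; rewrite eb t0 scale0r addr0.
Qed.

(** Projected from the node, the trace of the plane covers the line [ab]: it is a graph over that
    line. *)
Lemma plane_graph i a b s : a \in B i -> b \in B i ->
  exists2 c, c \in B i & exists w : F, c = (1 - s) *: a + s *: b + w *: n i.
Proof.
move=> ai bi; have [ha hb] := (cblock_h cf ai, cblock_h cf bi).
have [_ api] : a \in cs /\ a \in pl i by apply/andP; rewrite -in_cblock.
have [_ bpi] : b \in cs /\ b \in pl i by apply/andP; rewrite -in_cblock.
have yi : (1 - s) *: a + s *: b \in pl i by rewrite memvD ?memvZ.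
have hy : h ((1 - s) *: a + s *: b) = 1.
  by rewrite linearD !linearZ /= ha hb !mulr1 subrK.
have [c ci [t e]] := n_cover cf Hn yi hy; exists c => //; exists (- t).
by rewrite e scaleNr addrK.
Qed.

Lemma plane_coord i a b c : a \in B i -> b \in B i -> a != b -> c \in B i ->
  exists s w : F, c = (1 - s) *: a + s *: b + w *: n i.
Proof.
move=> ai bi ab ci; have [ha hb] := (cblock_h cf ai, cblock_h cf bi).
have [n0 hn ni _] := Hn i.
have : c \in pl i by move: ci; rewrite in_cblock => /andP[].
rewrite (plane_span ai bi ab).
case/memv_addP => _ /memv_addP[_ /vlineP[k ->] [_ /vlineP[l ->] ->]] [_ /vlineP[t ->] e].
exists l; exists t; rewrite e; congr (_ *: _ + _ + _).
have := congr1 h e; rewrite !linearD !linearZ /= (cblock_h cf ci) ha hb hn mulr0 addr0 !mulr1 => ->.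
by rewrite addrK.
Qed.

(** Suppose that the sum [U] has dimension at most 4. Each plane in the class of the partner [j0]
    meets [i0] and [i1] in two points of C and contains their node, so it lies in [U]; these planes
    cover C. A third plane [r] through [o] is spanned by points of C, so it also lies in [U] and
    shares an affine line with [pl i0]. By [n_meet] it contains the node, and then [o + n i0] is on
    three planes. *)
Lemma span_par i0 i1 : par i1 i0 -> (pl i0 + pl i1 = fullv)%VS.
Proof.
move=> p10; set U := (_ + _)%VS; have q7 := cf_q cf.
apply/eqP/negPn/negP => Uf.
have dU : (\dim U <= 4)%N.
  rewrite leqNgt; apply: contraNN Uf => d5; rewrite eqEdim subvf /= dimvf /dim /=.
  exact: d5.
have /card_gt0P[o oi] : (0 < #|B i0|)%N by rewrite (cblock_card cf); clear -q7; lia.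
have [j0 [j0i oj xG]] := n_partner cf Hn oi.
have nep : ~~ eqpar i0 j0.
  by apply: contra j0i => e; rewrite (ep_common e oi oj).
have nj0 := n_meet_eq cf Hn j0i xG.
have csU a : a \in cs -> a \in U.
  move=> /(ep_through j0)[j ej aj].
  have [b bi bj] : exists2 b, b \in B i0 & b \in B j.
    by apply: ep_meet; apply: contra nep => e; apply: ep_trans e _.
  have [c ci cj] : exists2 c, c \in B i1 & c \in B j.
    apply: ep_meet; apply: contra nep => e; apply: ep_trans (ep_trans _ e) ej.
    by rewrite ep_sym /eqpar p10 orbT.
  have bc : b != c by apply/eqP => e; move: (parP p10 ci); rewrite -e bi.
  move: aj; rewrite in_cblock (plane_span bj cj bc) => /andP[_].
  apply: subvP; rewrite !subv_add -!memvE -andbA.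
  apply/and3P; split.
  - by apply: subvP (addvSl _ _) _ _; move: bi; rewrite in_cblock => /andP[].
  - by apply: subvP (addvSr _ _) _ _; move: ci; rewrite in_cblock => /andP[].
  - by apply: subvP (addvSl _ _) _ _; apply: n_mem; rewrite nj0 (ep_n ej).
have co : o \in cs by move: oi; rewrite in_cblock => /andP[].
have : (0 < #|[set k | o \in B k] :\: [set i0; j0]|)%N.
  have := cardsD [set k | o \in B k] [set i0; j0].
  rewrite (pencil_card (q_gt1 cf) (cblock_sub pl cs) (cblock_card cf) (cf_card cf) (cblock_join cf) (cblock_inj cf) co).
  have := subset_leq_card (subsetIr [set k | o \in B k] [set i0; j0]).
  by rewrite cards2; case: (_ != _) => /=; clear -q7; lia.
case/card_gt0P => r; rewrite !inE negb_or -in_cblock => /andP[/andP[ri rj] ko].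
have rU : (pl r <= U)%VS.
  have : (2 < #|B r|)%N by rewrite (cblock_card cf); clear -q7; lia.
  case/card_gt2P => a [b [c [[ar br cr] [ab bc ca]]]].
  have [[ca' apr] [cb bpr] [cc cpr]] : [/\ a \in cs /\ a \in pl r, b \in cs /\ b \in pl r & c \in cs /\ c \in pl r].
    by move: ar br cr; rewrite !in_cblock => /andP[? ?] /andP[? ?] /andP[? ?].
  have ncab : c \notin (<[a]> + <[b]>)%VS.
    by apply: (cf_arc cf ca' cb cc apr bpr cpr); rewrite // eq_sym.
  have c0 : c != 0 by apply: contraNneq ncab => ->; apply: mem0v.
  have -> : pl r = (<[a]> + <[b]> + <[c]>)%VS.
    apply/esym/eqP; rewrite eqEdim !subv_add -!memvE apr bpr cpr (cf_dim cf) dimv_disjoint_sum.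
      by rewrite (dim_aff2 (cblock_h cf ar) (cblock_h cf br) ab) dim_vline c0.
    apply/eqP; rewrite -subv0; apply/subvP => v; rewrite memv_cap memv0 => /andP[vU /vlineP[t vt]].
    case: (eqVneq t 0) => [t0|t0]; first by rewrite vt t0 scale0r.
    by case/negP: ncab; rewrite -[c](scalerK t0) -vt memvZ.
  by rewrite !subv_add -!memvE !csU.
have d2 : (2 <= \dim (pl i0 :&: pl r))%N.
  have := dimv_sum_cap (pl i0) (pl r); rewrite !(cf_dim cf).
  have : (pl i0 + pl r <= U)%VS by rewrite subv_add rU addvSl.
  by move/dimvS; clear -dU; lia.
have opi : o \in pl i0 by move: oi; rewrite in_cblock => /andP[].
have opr : o \in pl r by move: ko; rewrite in_cblock => /andP[].
have ir : i0 != r by rewrite eq_sym.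
have aff0 : ~~ (pl i0 :&: pl r <= Sinf)%VS.
  by apply/subvPn; exists o; rewrite ?memv_cap ?opi // hS (cf_cs cf co) oner_eq0.
have /card_gt0P[x xGr] : (0 < #|G i0 r|)%N.
  rewrite GE; have := aff_split cf aff0; have := cap_cs_card cf ir.
  have := leq_pexp2l (n1 := 1) (n2 := (\dim (pl i0 :&: pl r)).-1) (ltnW (q_gt1 cf)).
  rewrite expn1; by case: (\dim _) d2 => [|[|d]] //= _ /(_ isT); clear -q7; lia.
have [nr _] := n_meet cf Hn ri xGr.
have [_ xj hx ncx] := G_common xG.
have [xi _ _ _] := G_common xG.
have xr : o + n i0 \in pl r by rewrite memvD.
have i0j : i0 != j0 by rewrite eq_sym.
by have := three_planes cf hx ncx xi xj xr i0j; rewrite (negPf ri) (negPf rj).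
Qed.

End Geometry.

(** * Coordinates *)

Section Comb5.
Variables (F : fieldType) (e0 e1 e2 e3 e4 : 'rV[F]_5).
Local Notation V := 'rV[F]_5.

Definition comb5 (c0 c1 c2 c3 c4 : F) : V :=
  c0 *: e0 + c1 *: e1 + c2 *: e2 + c3 *: e3 + c4 *: e4.

Definition basis5 : Prop := basis_of fullv [:: e0; e1; e2; e3; e4].

Lemma comb5D c0 c1 c2 c3 c4 d0 d1 d2 d3 d4 :
  comb5 c0 c1 c2 c3 c4 + comb5 d0 d1 d2 d3 d4 =
  comb5 (c0 + d0) (c1 + d1) (c2 + d2) (c3 + d3) (c4 + d4).
Proof. by apply/rowP => i; rewrite !mxE; ring. Qed.

Lemma comb5Z k c0 c1 c2 c3 c4 :
  k *: comb5 c0 c1 c2 c3 c4 = comb5 (k * c0) (k * c1) (k * c2) (k * c3) (k * c4).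
Proof. by apply/rowP => i; rewrite !mxE; ring. Qed.

Lemma basis5I : (forall v, exists c0 c1 c2 c3 c4, v = comb5 c0 c1 c2 c3 c4) -> basis5.
Proof.
move=> H; rewrite /basis5 basisEdim dimvf /dim /= andbT; apply/subvP => v _.
have [c0 [c1 [c2 [c3 [c4 ->]]]]] := H v.
by rewrite !memvD ?memvZ ?memv_span // !inE eqxx ?orbT.
Qed.

Lemma basis5_span : basis5 -> forall v, exists c0 c1 c2 c3 c4, v = comb5 c0 c1 c2 c3 c4.
Proof.
move=> He v; pose X := [tuple e0; e1; e2; e3; e4].
have : v \in fullv by apply: memvf.
have /span_basis <- : basis_of fullv X by [].
move/coord_span; rewrite !big_ord_recl big_ord0 addr0 /= => ->.
by do 5![eexists]; rewrite /comb5 !addrA.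
Qed.

Lemma basis5_inj c0 c1 c2 c3 c4 d0 d1 d2 d3 d4 : basis5 ->
  comb5 c0 c1 c2 c3 c4 = comb5 d0 d1 d2 d3 d4 ->
  [/\ c0 = d0, c1 = d1, c2 = d2, c3 = d3 & c4 = d4].
Proof.
move=> /basis_free He E; pose X := [tuple e0; e1; e2; e3; e4].
have {}He : free X by [].
pose k (i : 'I_5) := nth 0 [:: c0 - d0; c1 - d1; c2 - d2; c3 - d3; c4 - d4] i.
have Hk : \sum_(i < 5) k i *: X`_i = 0.
  rewrite !big_ord_recl big_ord0 addr0 /= !addrA; apply/eqP.
  have <- : comb5 c0 c1 c2 c3 c4 - comb5 d0 d1 d2 d3 d4 = 0 by rewrite E subrr.
  by apply/eqP/rowP => i; rewrite !mxE /k /=; ring.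
move/freeP: He => /(_ k Hk) K.
have := K (Ordinal (isT : 0 < 5)%N); have := K (Ordinal (isT : 1 < 5)%N).
have := K (Ordinal (isT : 2 < 5)%N); have := K (Ordinal (isT : 3 < 5)%N).
have := K (Ordinal (isT : 4 < 5)%N); rewrite /k /=.
by do 5![move/eqP; rewrite subr_eq0 => /eqP ->].
Qed.

Lemma comb5_e01 u w : (1 - u) *: e0 + u *: e1 + w *: e4 = comb5 (1 - u) u 0 0 w.
Proof. by apply/rowP => i; rewrite !mxE; ring. Qed.
Lemma comb5_e23 u w : (1 - u) *: e2 + u *: e3 + w *: e4 = comb5 0 0 (1 - u) u w.
Proof. by apply/rowP => i; rewrite !mxE; ring. Qed.
Lemma comb5_e02 u w : (1 - u) *: e0 + u *: e2 + w *: e4 = comb5 (1 - u) 0 u 0 w.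
Proof. by apply/rowP => i; rewrite !mxE; ring. Qed.
Lemma comb5_e13 u w : (1 - u) *: e1 + u *: e3 + w *: e4 = comb5 0 (1 - u) 0 u w.
Proof. by apply/rowP => i; rewrite !mxE; ring. Qed.
Lemma comb5_0 : comb5 1 0 0 0 0 = e0.
Proof. by apply/rowP => i; rewrite !mxE; ring. Qed.
Lemma comb5_2 : comb5 0 0 1 0 0 = e2.
Proof. by apply/rowP => i; rewrite !mxE; ring. Qed.

Lemma comb5_col x x' u w w' v :
  (1 - u) *: comb5 (1 - x) x 0 0 w + u *: comb5 0 0 (1 - x') x' w' + v *: e4 =
  comb5 ((1 - u) * (1 - x)) ((1 - u) * x) (u * (1 - x')) (u * x') ((1 - u) * w + u * w' + v).
Proof. by apply/rowP => i; rewrite !mxE; ring. Qed.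

Lemma comb5_row y y' u w w' v :
  (1 - u) *: comb5 (1 - y) 0 y 0 w + u *: comb5 0 (1 - y') 0 y' w' + v *: e4 =
  comb5 ((1 - u) * (1 - y)) (u * (1 - y')) ((1 - u) * y) (u * y') ((1 - u) * w + u * w' + v).
Proof. by apply/rowP => i; rewrite !mxE; ring. Qed.

Lemma comb5_e4 c0 c1 c2 c3 w w' :
  comb5 c0 c1 c2 c3 w + (w' - w) *: e4 = comb5 c0 c1 c2 c3 w'.
Proof. by apply/rowP => k; rewrite !mxE; ring. Qed.
End Comb5.

(** Passage from the four corners of the grid to the monomials 1, x, y, xy. *)
Lemma comb5_change (F : fieldType) (e0 e1 e2 e3 e4 : 'rV[F]_5) c0 c1 c2 c3 c4 :
  comb5 e0 e1 e2 e3 e4 c0 c1 c2 c3 c4 =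
  comb5 e0 (e1 - e0) (e2 - e0) (e3 - e1 - e2 + e0) e4
    (c0 + c1 + c2 + c3) (c1 + c3) (c2 + c3) c3 c4.
Proof. by apply/rowP => k; rewrite !mxE; ring. Qed.

(* The incidences of a generator (x, x') of one family and a generator (y, y')
   of the other, met at parameters u and t. *)
Lemma generators_meet (F : fieldType) (x x' y y' u t : F) :
  (1 - u) * (1 - x) = (1 - t) * (1 - y) -> (1 - u) * x = t * (1 - y') ->
  u * (1 - x') = (1 - t) * y -> u * x' = t * y' ->
  [/\ t = x + u * (x' - x), x' - x != 0 -> y' = x' / (x' - x) -> (x == 0) || (x' == 0) &
    x' = x -> x != 0 -> x != 1 -> y' = y].
Proof.
move=> h0 h1 h2 h3.
have tE : t = x + u * (x' - x).
  transitivity (t * (1 - y') + t * y'); first by ring.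
  by rewrite -h1 -h3; ring.
split=> // [k0 yE|xx x0 x1].
  have : x * y' = 0.
    have -> : x * y' = t * y' - u * (x' - x) * y' by rewrite tE; ring.
    by rewrite -h3 yE; field.
  move/eqP; rewrite mulf_eq0 => /orP[->//|]; rewrite yE mulf_eq0 invr_eq0 (negPf k0) orbF.
  by move=> ->; rewrite orbT.
have tx : t = x by rewrite tE xx subrr mulr0 addr0.
have uy' : u = y' by apply: (mulIf x0); rewrite -{1}xx h3 tx mulrC.
have x1' : 1 - x != 0 by rewrite subr_eq0 eq_sym.
by rewrite -uy'; apply: (mulIf x1'); rewrite -{1}xx h2 tx mulrC.
Qed.

Lemma exists_neq01 (F : finFieldType) : (2 < fcard F)%N -> exists2 x : F, x != 0 & x != 1.
Proof.
pose A : {set F} := [set 0; 1] => q2.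
have /card_gt0P[x] : (0 < #|~: A|)%N.
  have e : (#|A| + #|~: A| = fcard F)%N := cardsC A.
  by move: e q2; rewrite cards2; case: (_ != _); lia.
by rewrite !inE negb_or => /andP[? ?]; exists x.
Qed.

Section Grid.
Variables (F : finFieldType) (h : {scalar 'rV[F]_5}) (Sinf : {vspace 'rV[F]_5})
  (I : finType) (pl : I -> {vspace 'rV[F]_5}) (cs : {set 'rV[F]_5}).
Hypothesis cf : configuration h Sinf pl cs.
Local Notation V := 'rV[F]_5.
Local Notation B := (cblock pl cs).
Local Notation par := (parallel B).
Local Notation E := (offpt h pl cs).
Local Notation ep := (eqpar pl cs).
Implicit Types (i j k l : I).

Variable n : I -> V.
Hypothesis Hn : forall i,
  [/\ n i != 0, h (n i) = 0, n i \in pl i &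
   forall x, x \in E i -> exists j, [/\ j != i, x \in pl j & n i \in pl j]].

Lemma node_graph i i0 a b s : (<[n i]> = <[n i0]>)%VS -> a \in B i -> b \in B i ->
  exists2 c, c \in B i & exists w : F, c = (1 - s) *: a + s *: b + w *: n i0.
Proof.
move=> e ai bi; have [c ci [w Ec]] := plane_graph cf Hn s ai bi.
have : n i \in <[n i0]>%VS by rewrite -e memv_line.
by case/vlineP => k Ek; exists c => //; exists (w * k); rewrite Ec Ek scalerA.
Qed.

Lemma node_coord i i0 a b c : (<[n i]> = <[n i0]>)%VS -> a \in B i -> b \in B i ->
  a != b -> c \in B i -> exists s w : F, c = (1 - s) *: a + s *: b + w *: n i0.
Proof.
move=> e ai bi ab ci; have [s [w ->]] := plane_coord cf Hn ai bi ab ci.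
have : n i \in <[n i0]>%VS by rewrite -e memv_line.
by case/vlineP => k Ek; exists s; exists (w * k); rewrite Ek scalerA.
Qed.

Lemma node_tangent i i0 a t : (<[n i]> = <[n i0]>)%VS -> a \in B i ->
  a + t *: n i0 \in cs -> t = 0.
Proof.
move=> e ai H; have : n i0 \in <[n i]>%VS by rewrite e memv_line.
have [n0 _ _ _] := Hn i0; case/vlineP => k Ek; rewrite Ek scalerA in H.
have /eqP := n_tangent cf Hn ai H; rewrite mulf_eq0 => /orP[/eqP//|/eqP k0].
by move: n0; rewrite Ek k0 scale0r eqxx.
Qed.

(** Partners at [o] have the same node and are not parallel, so two planes of each of their classes
    cross in four points of C. Together with the node these span F^5, because the parallel planes
    [i0] and [i1] do, by [span_par]. *)
Lemma grid_frame : exists i0 j0 i1 j1 : I, exists o p r s : V,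
  [/\ [/\ par i1 i0, par j1 j0, ~~ ep i0 j0 & (<[n j0]> = <[n i0]>)%VS],
      [/\ o \in B i0, o \in B j0, p \in B i1 & p \in B j0],
      [/\ r \in B i0, r \in B j1, s \in B i1 & s \in B j1] &
      basis5 o p r s (n i0)].
Proof.
have q7 := cf_q cf.
have /card_gt0P[o co] : (0 < #|cs|)%N by rewrite (cf_card cf); nia.
have /card_gt0P[i0] : (0 < #|[set i | o \in B i]|)%N.
  by rewrite (pencil_card (q_gt1 cf) (cblock_sub pl cs) (cblock_card cf) (cf_card cf) (cblock_join cf) (cblock_inj cf) co).
rewrite [in X in X -> _]inE => oi.
have [j0 [j0i oj xG]] := n_partner cf Hn oi.
have nj0 := n_meet_eq cf Hn j0i xG.
have nep : ~~ ep i0 j0 by apply: contra j0i => e; rewrite (ep_common e oi oj).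
have parex i : exists j, par j i.
  have /card_gt0P[j] : (0 < #|[set j | par j i]|)%N.
    rewrite (par_card (q_gt1 cf) (cblock_sub pl cs) (cblock_card cf) (cf_card cf) (cblock_join cf) (cblock_inj cf)).
    by clear -q7; lia.
  by rewrite inE; exists j.
have [i1 pi] := parex i0; have [j1 pj] := parex j0.
have ei : ep i1 i0 by rewrite /eqpar pi orbT.
have ej : ep j1 j0 by rewrite /eqpar pj orbT.
have nep1 : ~~ ep i1 j0 by apply: contra nep => e; apply: (ep_trans cf) e; rewrite ep_sym.
have nep2 : ~~ ep i0 j1 by apply: contra nep => e; apply: (ep_trans cf) ej.
have nep3 : ~~ ep i1 j1 by apply: contra nep1 => e; apply: (ep_trans cf) ej.
have [p pi1 pj0] := ep_meet nep1; have [r ri0 rj1] := ep_meet nep2.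
have [s si1 sj1] := ep_meet nep3.
have or : o != r by apply/eqP => e; move: (parP pj rj1); rewrite -e oj.
have ps : p != s by apply/eqP => e; move: (parP pj sj1); rewrite -e pj0.
exists i0, j0, i1, j1, o, p, r, s; split => //.
apply: basis5I => v.
have : v \in (pl i0 + pl i1)%VS by rewrite (span_par cf Hn pi) memvf.
have : n i1 \in <[n i0]>%VS by rewrite -(ep_n cf Hn ei) memv_line.
case/vlineP => k Ek.
rewrite (plane_span cf Hn oi ri0 or) (plane_span cf Hn pi1 si1 ps).
case/memv_addP => _ /memv_addP[_ /memv_addP[_ /vlineP[c0 ->] [_ /vlineP[c2 ->] ->]] [_ /vlineP[c4 ->] ->]].
case=> _ /memv_addP[_ /memv_addP[_ /vlineP[c1 ->] [_ /vlineP[c3 ->] ->]] [_ /vlineP[c5 ->] ->]] ->.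
exists c0, c1, c2, c3, (c4 + c5 * k); rewrite Ek.
by apply/rowP => i; rewrite !mxE; ring.
Qed.

(* The planes of the two classes of [i0] and [j0] become, modulo their common
   node, the two families of generators of a hyperbolic paraboloid z = xy. *)
Lemma grid : exists e0 e1 e2 e3 e4 : V,
  [/\ basis5 e0 e1 e2 e3 e4, h e0 = 1,
      [/\ h e1 = 0, h e2 = 0, h e3 = 0 & h e4 = 0],
      (forall x y : F, exists w : F, comb5 e0 e1 e2 e3 e4 1 x y (x * y) w \in cs) &
      (forall a, a \in cs -> exists x y w : F, a = comb5 e0 e1 e2 e3 e4 1 x y (x * y) w)
      /\ (forall x y w w', comb5 e0 e1 e2 e3 e4 1 x y (x * y) w \in cs ->
         comb5 e0 e1 e2 e3 e4 1 x y (x * y) w' \in cs -> w = w')].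
Proof.
have [i0 [j0 [i1 [j1 [o [p [r [s [[pi pj nep nj0] [oi0 oj0 pi1 pj0] [ri0 rj1 si1 sj1] bas]]]]]]]]] := grid_frame.
pose N := n i0; have q7 := cf_q cf.
pose cb := comb5 o p r s N.
have cbI c0 c1 c2 c3 c4 d0 d1 d2 d3 d4 : cb c0 c1 c2 c3 c4 = cb d0 d1 d2 d3 d4 ->
  [/\ c0 = d0, c1 = d1, c2 = d2, c3 = d3 & c4 = d4] := basis5_inj bas.
have ei1 : ep i1 i0 by rewrite /eqpar pi orbT.
have ej1 : ep j1 j0 by rewrite /eqpar pj orbT.
have ei0 := ep_refl pl cs i0; have ej0 := ep_refl pl cs j0.
have nP i : ep i i0 -> (<[n i]> = <[n i0]>)%VS by move=> /(ep_n cf Hn).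
have nQ j : ep j j0 -> (<[n j]> = <[n i0]>)%VS by move=> /(ep_n cf Hn) ->.
have PQ i j : ep i i0 -> ep j j0 -> exists2 a, a \in B i & a \in B j.
  move=> ei ej; apply: ep_meet; apply: contra nep => e.
  by apply: (ep_trans cf) ej; apply: (ep_trans cf) e; rewrite ep_sym.
have op : o != p by apply/eqP => e; move: (parP pi pi1); rewrite -e oi0.
have rs : r != s by apply/eqP => e; move: (parP pi si1); rewrite -e ri0.
have or : o != r by apply/eqP => e; move: (parP pj rj1); rewrite -e oj0.
have ps : p != s by apply/eqP => e; move: (parP pj sj1); rewrite -e pj0.
have csB i a : a \in B i -> a \in cs by rewrite in_cblock => /andP[].
(* Modulo the node, [i] meets [j0] at parameter x of the line [op] and [j1] at parameter x' of the
   line [rs]. Likewise [rowP] records the parameters y on [or] and y' on [ps]. The two parameters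
   turn out to be equal. *)
pose colP i x x' := [/\ ep i i0, exists w, cb (1 - x) x 0 0 w \in B i /\ cb (1 - x) x 0 0 w \in B j0,
    exists w, cb 0 0 (1 - x') x' w \in B i /\ cb 0 0 (1 - x') x' w \in B j1 &
    forall c, c \in B i -> exists u w, c = cb ((1 - u) * (1 - x)) ((1 - u) * x) (u * (1 - x')) (u * x') w].
pose rowP j y y' := ep j j0 /\
    forall c, c \in B j -> exists t w, c = cb ((1 - t) * (1 - y)) (t * (1 - y')) ((1 - t) * y) (t * y') w.
have col i a x w : ep i i0 -> a \in B i -> a \in B j0 -> a = cb (1 - x) x 0 0 w ->
    exists x', colP i x x'.
  move=> ei ai aj Ea; have [b bi bj] := PQ _ _ ei ej1.
  have [x' [w' Eb]] := node_coord (nQ _ ej1) rj1 sj1 rs bj.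
  have ab : a != b by apply/eqP => e; move: (parP pj bj); rewrite -e aj.
  rewrite (comb5_e23 o p r s N) -/cb in Eb; exists x'; split=> //.
  - by exists w; rewrite -Ea.
  - by exists w'; rewrite -Eb.
  move=> c ci; have [u [w'' ->]] := node_coord (nP _ ei) ai bi ab ci.
  by exists u, ((1 - u) * w + u * w' + w''); rewrite Ea Eb comb5_col.
have row j a b y y' w w' : ep j j0 -> a \in B j -> a \in B i0 -> b \in B j -> b \in B i1 ->
    a = cb (1 - y) 0 y 0 w -> b = cb 0 (1 - y') 0 y' w' -> rowP j y y'.
  move=> ej aj ai bj bi Ea Eb; split=> //.
  have ab : a != b by apply/eqP => e; move: (parP pi bi); rewrite -e ai.
  move=> c ci; have [u [w'' ->]] := node_coord (nQ _ ej) aj bj ab ci.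
  by exists u, ((1 - u) * w + u * w' + w''); rewrite Ea Eb comb5_row.
have colex x : exists i x', colP i x x'.
  have [c ci [w Ec]] := node_graph x (nQ _ ej0) oj0 pj0.
  have [i ei ci'] := ep_through cf i0 (csB _ _ ci).
  rewrite (comb5_e01 o p r s N) -/cb in Ec; have [x' H] := col _ _ _ _ ei ci' ci Ec.
  by exists i, x'.
have colat i : ep i i0 -> exists x x', colP i x x'.
  move=> ei; have [a ai aj] := PQ _ _ ei ej0.
  have [x [w Ea]] := node_coord (nQ _ ej0) oj0 pj0 op aj.
  by rewrite (comb5_e01 o p r s N) -/cb in Ea; exists x; apply: col Ea.
have rowat j : ep j j0 -> exists y y', rowP j y y'.
  move=> ej; have [a ai aj] := PQ _ _ ei0 ej; have [b bi bj] := PQ _ _ ei1 ej.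
  have [y [w Ea]] := node_coord (erefl _) oi0 ri0 or ai.
  have [y' [w' Eb]] := node_coord (nP _ ei1) pi1 si1 ps bi.
  by rewrite (comb5_e02 o p r s N) -/cb in Ea; rewrite (comb5_e13 o p r s N) -/cb in Eb; exists y, y'; apply: row Ea Eb.
have rowex y' : exists j y, rowP j y y'.
  have [b bi [w' Eb]] := node_graph y' (nP _ ei1) pi1 si1.
  have [j ej bj] := ep_through cf j0 (csB _ _ bi).
  have [a ai aj] := PQ _ _ ei0 ej; have [y [w Ea]] := node_coord (erefl _) oi0 ri0 or ai.
  by rewrite (comb5_e02 o p r s N) -/cb in Ea; rewrite (comb5_e13 o p r s N) -/cb in Eb; exists j, y; apply: row Ea Eb.
have rowex0 y : exists j y', rowP j y y'.
  have [a ai [w Ea]] := node_graph y (erefl _) oi0 ri0.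
  have [j ej aj] := ep_through cf j0 (csB _ _ ai).
  have [b bi bj] := PQ _ _ ei1 ej; have [y' [w' Eb]] := node_coord (nP _ ei1) pi1 si1 ps bi.
  by rewrite (comb5_e02 o p r s N) -/cb in Ea; rewrite (comb5_e13 o p r s N) -/cb in Eb; exists j, y'; apply: row Ea Eb.
have Bcol i c0 c1 c2 c3 w w' : ep i i0 -> cb c0 c1 c2 c3 w \in B i -> cb c0 c1 c2 c3 w' \in cs -> w' = w.
  move=> ei ai ci; apply/eqP; rewrite -subr_eq0; apply/eqP/(node_tangent (nP _ ei) ai).
  by rewrite comb5_e4.
have cb1 : cb 1 0 0 0 0 = o by apply: comb5_0.
have cb2 : cb 0 0 1 0 0 = r by apply: comb5_2.
(* Either parameter being 0 forces [i] to be [i0], which passes through both [o] and [r]. *)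
have zero i x x' : colP i x x' -> (x == 0) = (x' == 0).
  case=> ei [w [ai aj]] [w' [bi bj]] _; apply/eqP/eqP => x0.
    rewrite x0 subr0 in ai; have w0 : 0 = w by apply: (Bcol _ _ _ _ _ _ _ ei ai); rewrite cb1 (csB _ _ oi0).
    rewrite -w0 cb1 in ai; have ii := ep_common ei ai oi0.
    rewrite ii in bi; have e : cb 0 0 (1 - x') x' w' = r.
      apply/eqP/negPn/negP => ne; have ij := cblock_inj cf ne bi ri0 bj rj1.
      by case/negP: nep; rewrite ij.
    by rewrite -cb2 in e; case: (cbI _ _ _ _ _ _ _ _ _ _ e).
  rewrite x0 subr0 in bi; have w0 : 0 = w' by apply: (Bcol _ _ _ _ _ _ _ ei bi); rewrite cb2 (csB _ _ ri0).
  rewrite -w0 cb2 in bi; have ii := ep_common ei bi ri0.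
  rewrite ii in ai; have e : cb (1 - x) x 0 0 w = o.
    apply/eqP/negPn/negP => ne; have ij := cblock_inj cf ne ai oi0 aj oj0.
    by case/negP: nep; rewrite ij ep_refl.
  by rewrite -cb1 in e; case: (cbI _ _ _ _ _ _ _ _ _ _ e).
have meet i j x x' y y' : colP i x x' -> rowP j y y' -> exists c u t w, [/\ c \in B i, c \in B j,
    c = cb ((1 - t) * (1 - y)) (t * (1 - y')) ((1 - t) * y) (t * y') w &
    [/\ t = x + u * (x' - x), x' - x != 0 -> y' = x' / (x' - x) -> (x == 0) || (x' == 0) &
    x' = x -> x != 0 -> x != 1 -> y' = y]].
  case=> ei _ _ Hi [ej Hj]; have [c ci cj] := PQ _ _ ei ej.
  have [u [w Eu]] := Hi c ci; have [t [v Et]] := Hj c cj.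
  exists c, u, t, v; split=> //; rewrite Eu in Et; have [h0 h1 h2 h3 _] := cbI _ _ _ _ _ _ _ _ _ _ Et.
  exact: generators_meet.
have key1 i x x' : colP i x x' -> x' = x.
  move=> H; apply/eqP; rewrite -subr_eq0; apply/negPn/negP => k0.
  (* For this y' the linear equation for the meeting parameter degenerates: the row would meet the
     column at infinity. Since they do meet in a point of C, x or x' is 0, and by [zero] both
     are. *)
  have [j [y Hj]] := rowex (x' / (x' - x)).
  have [c [u [t [w [_ _ _ [_ H2 _]]]]]] := meet _ _ _ _ _ _ H Hj.
  have := H2 k0 (erefl _); rewrite (zero _ _ _ H) orbb => x'0.
  by move: k0; have := x'0; rewrite -(zero _ _ _ H) (eqP x'0) => /eqP->; rewrite subrr eqxx.
(* A column over a parameter other than 0 and 1 is what [generators_meet] needs in order to give y'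
   = y. *)
have [x2 x20 x21] : exists2 x : F, x != 0 & x != 1.
  by apply: exists_neq01; clear -q7; lia.
have key2 j y y' : rowP j y y' -> y' = y.
  move=> H; have [i [x' Hi]] := colex x2; have xx := key1 _ _ _ Hi.
  by have [c [u [t [w [_ _ _ [_ _ H3]]]]]] := meet _ _ _ _ _ _ Hi H; apply: H3.
have final i j x x' y y' : colP i x x' -> rowP j y y' -> exists c w, [/\ c \in B i, c \in B j &
    c = cb ((1 - x) * (1 - y)) (x * (1 - y)) ((1 - x) * y) (x * y) w].
  move=> Hi Hj; have [c [u [t [w [ci cj Ec [tE _ _]]]]]] := meet _ _ _ _ _ _ Hi Hj.
  exists c, w; split=> //; rewrite Ec (key2 _ _ _ Hj) tE (key1 _ _ _ Hi).
  by rewrite subrr mulr0 addr0.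
pose e := comb5 o (p - o) (r - o) (s - p - r + o) N.
have eE x y w : cb ((1 - x) * (1 - y)) (x * (1 - y)) ((1 - x) * y) (x * y) w = e 1 x y (x * y) w.
  rewrite /cb comb5_change -/e; move: e => e'.
  have e1 : (1 - x) * (1 - y) + x * (1 - y) + (1 - x) * y + x * y = 1 by clear; ring.
  have e2 : x * (1 - y) + x * y = x by clear; ring.
  have e3 : (1 - x) * y + x * y = y by clear; ring.
  by rewrite e1 e2 e3.
have hB i a : a \in B i -> h a = 1 by move/csB/(cf_cs cf).
have [_ hN _ _] := Hn i0.
exists o, (p - o), (r - o), (s - p - r + o), N; split.
- apply: basis5I => v; have [c0 [c1 [c2 [c3 [c4 ->]]]]] := basis5_span bas v.
  by rewrite comb5_change; do 5!eexists.
- exact: hB oi0.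
- rewrite !linearD !linearN /= (hB _ _ oi0) (hB _ _ pi1) (hB _ _ ri0) (hB _ _ si1).
  by rewrite !subrr sub0r addNr.
- move=> x y; have [i [x' Hi]] := colex x; have [j [y' Hj]] := rowex0 y.
  have [c [w [ci _ Ec]]] := final _ _ _ _ _ _ Hi Hj; exists w.
  by rewrite -/(e _ _ _ _ _) -eE -Ec (csB _ _ ci).
split.
- move=> a ca; have [i ei ai] := ep_through cf i0 ca; have [j ej aj] := ep_through cf j0 ca.
  have [x [x' Hi]] := colat i ei; have [y [y' Hj]] := rowat j ej.
  have [c [w [ci cj Ec]]] := final _ _ _ _ _ _ Hi Hj; exists x, y, w.
  rewrite -/(e _ _ _ _ _) -eE -Ec; apply/eqP/negPn/negP => ac.
  have ij := cblock_inj cf ac ai ci aj cj.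
  case/negP: nep; apply: (ep_trans cf) ej; rewrite -ij ep_sym; exact: ei.
move=> x y w w'; rewrite -!/(e _ _ _ _ _) -!eE => H H'.
have [i ei Hi] := ep_through cf i0 H.
by rewrite (Bcol _ _ _ _ _ _ _ ei Hi H').
Qed.

End Grid.

(** * Normal form *)

Section QuadraticFunctions.
Variable F : finFieldType.
Hypothesis (q7 : (7 <= fcard F)%N) (q_odd : odd (fcard F)).

Lemma natr_card : (fcard F)%:R = 0 :> F.
Proof.
have := expg_cardG (in_setT (1 : F)); rewrite FinRing.zmodXgE cardsT.
by move=> e; exact: e.
Qed.

Lemma two_neq0 : 2%:R != 0 :> F.
Proof.
apply/eqP => t0; have := natr_card; rewrite -[fcard F]odd_double_half q_odd.
by rewrite natrD -muln2 natrM t0 mulr0 addr0 => /eqP; rewrite oner_eq0.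
Qed.

Lemma quartic_zero (k0 k1 k2 k3 k4 : F) :
  (forall u, k0 + k1 * u + k2 * u ^+ 2 + k3 * u ^+ 3 + k4 * u ^+ 4 = 0) ->
  [/\ k0 = 0, k1 = 0, k2 = 0, k3 = 0 & k4 = 0].
Proof.
move=> H; pose p := Poly [:: k0; k1; k2; k3; k4].
have sp : (size p <= 5)%N by apply: leq_trans (size_Poly _) _.
have p0 : p = 0.
  apply: (@roots_geq_poly_eq0 _ p (enum F)).
  - apply/allP => u _; rewrite /root horner_Poly /= ; apply/eqP; rewrite -[RHS](H u); ring.
  - exact: enum_uniq.
  - by rewrite -cardE; apply: leq_trans sp _; apply: leq_trans _ q7.
have pk i : nth 0 [:: k0; k1; k2; k3; k4] i = 0 by rewrite -coef_Poly -/p p0 coef0.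
by split; [have := pk 0%N | have := pk 1%N | have := pk 2%N| have := pk 3%N| have := pk 4%N].
Qed.

(** In the coordinates u = x + y, v = y - x of [quadratic_on_lines], the lines v = u and v = - u are
    x = 0 and y = 0, and nothing is assumed on lines with x or y constant. *)
Lemma exists_slope : exists2 m : F, m != 0 & (m != 1) && (m != -1).
Proof.
pose A : {set F} := 0 |: [set 1; -1].
have /card_gt0P[x] : (0 < #|~: A|)%N.
  have e : (#|A| + #|~: A| = fcard F)%N := cardsC A.
  have : (#|A| <= 3)%N.
    rewrite /A cardsU1 cards2; by case: (_ \notin _); case: (_ != _).
  by move: e q7; clear; lia.
by rewrite !inE !negb_or => /andP[? ?]; exists x.
Qed.

Definition quadratic (p : F -> F) := exists c0 c1 c2, forall t, p t = c0 + c1 * t + c2 * t ^+ 2.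

Lemma quadratic_affine (p : F -> F) a b : quadratic p -> quadratic (fun t => p (a * t + b)).
Proof.
case=> c0 [c1 [c2 H]].
exists (c0 + c1 * b + c2 * b ^+ 2), (c1 * a + 2%:R * c2 * a * b), (c2 * a ^+ 2) => t.
by rewrite H; ring.
Qed.

Lemma eq_quadratic (p p' : F -> F) : p =1 p' -> quadratic p -> quadratic p'.
Proof. by move=> e [c0 [c1 [c2 H]]]; exists c0, c1, c2 => t; rewrite -e. Qed.

Lemma quadratic_interp (p : F -> F) : quadratic p -> forall v,
  p v = p 0 + v * (p 1 - p (- 1)) / 2%:R + v ^+ 2 * (p 1 + p (- 1) - 2%:R * p 0) / 2%:R.
Proof. by case=> c0 [c1 [c2 H]] v; rewrite !H; field; apply: two_neq0. Qed.

(* In the coordinates u = x + y, v = y - x the function is biquadratic; the lines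
   v = m u and v = - m u then kill its terms of degree 3 and 4. *)
Lemma quadratic_on_lines (f : F -> F -> F) :
  (forall a b, a != 0 -> quadratic (fun x => f x (a * x + b))) ->
  exists p0 p1 p2 p11 p12 p22, forall x y,
    f x y = p0 + p1 * x + p2 * y + p11 * x ^+ 2 + p12 * (x * y) + p22 * y ^+ 2.
Proof.
move=> Hf; have t0 := two_neq0.
pose g u v := f ((u - v) / 2%:R) ((u + v) / 2%:R).
have gu v : quadratic (g^~ v).
  have := quadratic_affine (2%:R^-1) (- v / 2%:R) (Hf 1 v (oner_neq0 _)).
  by apply: eq_quadratic => u; rewrite /g; congr f; field.
have gv u : quadratic (g u).
  have m1 : (-1 : F) != 0 by rewrite oppr_eq0 oner_neq0.
  have := quadratic_affine (- 2%:R^-1) (u / 2%:R) (Hf (-1) u m1).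
  by apply: eq_quadratic => v; rewrite /g; congr f; field.
have [a0 [a1 [a2 Ha]]] := gu 0; have [b0 [b1 [b2 Hb]]] := gu 1.
have [d0 [d1 [d2 Hd]]] := gu (-1).
pose c01 := (b0 - d0) / 2%:R; pose c11 := (b1 - d1) / 2%:R; pose c21 := (b2 - d2) / 2%:R.
pose c02 := (b0 + d0 - 2%:R * a0) / 2%:R; pose c12 := (b1 + d1 - 2%:R * a1) / 2%:R.
pose c22 := (b2 + d2 - 2%:R * a2) / 2%:R.
have gE u v : g u v = a0 + a1 * u + a2 * u ^+ 2 + v * (c01 + c11 * u + c21 * u ^+ 2)
     + v ^+ 2 * (c02 + c12 * u + c22 * u ^+ 2).
  rewrite (quadratic_interp (gv u)) Ha Hb Hd /c01 /c11 /c21 /c02 /c12 /c22.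
  by field.
have line m : m != 1 -> m != -1 -> c22 * m ^+ 2 = 0 /\ c21 * m + c12 * m ^+ 2 = 0.
  move=> m1 m1'; have n1 : 1 - m != 0 by rewrite subr_eq0 eq_sym.
  have n2 : 1 + m != 0 by rewrite addrC addr_eq0.
  have a0' : (1 + m) / (1 - m) != 0 by rewrite mulf_neq0 ?invr_eq0.
  have [k0 [k1 [k2 Hk]]] := quadratic_affine ((1 - m) / 2%:R) 0 (Hf _ 0 a0').
  have gm u : g u (m * u) = k0 + k1 * u + k2 * u ^+ 2.
    by rewrite -Hk /g; congr f; field; rewrite ?n1 ?t0.
  have [_ _ _ -> ->] : [/\ a0 - k0 = 0, a1 + m * c01 - k1 = 0,
     a2 + m * c11 + m ^+ 2 * c02 - k2 = 0, c21 * m + c12 * m ^+ 2 = 0 & c22 * m ^+ 2 = 0].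
    apply: quartic_zero => u.
    transitivity (g u (m * u) - (k0 + k1 * u + k2 * u ^+ 2)); last by rewrite gm subrr.
    by rewrite gE; ring.
  by [].
have [m m0 /andP[m1 m1']] := exists_slope.
have [e1 e2] := line m m1 m1'.
have [_ e3] : c22 * (- m) ^+ 2 = 0 /\ c21 * (- m) + c12 * (- m) ^+ 2 = 0.
  by apply: line; rewrite ?eqr_oppLR ?opprK // eqr_opp.
have z22 : c22 = 0 by move/eqP: e1; rewrite mulf_eq0 expf_eq0 (negPf m0) orbF => /eqP.
have z12 : c12 = 0.
  have : 2%:R * (c12 * m ^+ 2) = 0 by rewrite -[RHS]addr0 -{1}e2 -e3; ring.
  by move=> /eqP; rewrite mulf_eq0 (negPf t0) orFb mulf_eq0 expf_eq0 (negPf m0) orbF => /eqP.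
have z21 : c21 = 0.
  by move/eqP: e2; rewrite z12 mul0r addr0 mulf_eq0 (negPf m0) orbF => /eqP.
exists a0, (a1 - c01), (a1 + c01), (a2 - c11 + c02), (2%:R * a2 - 2%:R * c02), (a2 + c11 + c02) => x y.
transitivity (g (x + y) (y - x)); first by rewrite /g; congr f; field.
by rewrite gE z22 z12 z21; ring.
Qed.
End QuadraticFunctions.

(** Restricted to [U], the m functionals live in a dual space of dimension less than m. *)
Lemma exists_functional (F : fieldType) n m (U : {vspace 'rV[F]_n})
    (phi : 'I_m -> {scalar 'rV[F]_n}) : (\dim U < m)%N ->
  exists c : 'rV[F]_m, c != 0 /\ forall v, v \in U -> \sum_(k < m) c 0 k * phi k v = 0.
Proof.
move=> dU; pose M := \matrix_(k < m, l < \dim U) phi k (vbasis U)`_l.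
have K0 : kermx M != 0.
  by rewrite -mxrank_eq0 mxrank_ker subn_eq0 -ltnNge; apply: leq_ltn_trans (rank_leq_col _) _.
exists (nz_row (kermx M)); rewrite nz_row_eq0 K0; split=> // v vU.
have cM : nz_row (kermx M) *m M = 0 by apply/sub_kermxP; apply: nz_row_sub.
rewrite (coord_vbasis vU) (eq_bigr (fun k => \sum_l coord (vbasis U) l v *
   (nz_row (kermx M) 0 k * M k l))); last first.
  move=> k _; rewrite linear_sum mulr_sumr; apply: eq_bigr => l _.
  by rewrite linearZ /= mxE mulrCA.
rewrite exchange_big big1 // => l _; rewrite -mulr_sumr.
have := congr1 (fun N : 'rV_(\dim U) => N 0 l) cM; rewrite mxE [RHS]mxE => ->.
by rewrite mulr0.
Qed.

(** The four coordinates other than the [i]-th are dependent on a space of dimension 3. The choice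
    of the omitted coordinate decides which unknown the resulting equation eliminates. *)
Lemma basis5_functional (F : fieldType) (e0 e1 e2 e3 e4 : 'rV[F]_5)
    (U : {vspace 'rV[F]_5}) (i : 'I_5) :
  basis5 e0 e1 e2 e3 e4 -> \dim U = 3%N ->
  exists d : 'I_5 -> F, [/\ exists j, d j != 0, d i = 0 &
    forall c0 c1 c2 c3 c4, comb5 e0 e1 e2 e3 e4 c0 c1 c2 c3 c4 \in U ->
      d (inord 0) * c0 + d (inord 1) * c1 + d (inord 2) * c2 + d (inord 3) * c3
       + d (inord 4) * c4 = 0].
Proof.
move=> bas dU; pose X := [tuple e0; e1; e2; e3; e4].
have fX : free X by apply: basis_free bas.
have [|c [c0 Hc]] := @exists_functional F 5 4 U (fun k => coord X (lift i k) : {scalar _}).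
  by rewrite dU.
pose d j := if unlift i j is Some k then c 0 k else 0.
have dl k : d (lift i k) = c 0 k by rewrite /d liftK.
have di : d i = 0 by rewrite /d unlift_none.
exists d; split=> //.
  have [k ck] : exists k, c 0 k != 0.
    apply/existsP; apply: contraNT c0; rewrite negb_exists => /forallP H.
    by apply/eqP/rowP => k; rewrite mxE; apply/eqP; move: (H k); rewrite negbK.
  by exists (lift i k); rewrite dl.
move=> c0' c1 c2 c3 c4 /Hc E.
pose a (j : 'I_5) := nth 0 [:: c0'; c1; c2; c3; c4] j.
have cE : comb5 e0 e1 e2 e3 e4 c0' c1 c2 c3 c4 = \sum_(j < 5) a j *: X`_j.
  by rewrite !big_ord_recl big_ord0 addr0 /= !addrA.
have aE j : a j = coord X j (comb5 e0 e1 e2 e3 e4 c0' c1 c2 c3 c4).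
  by rewrite cE coord_sum_free.
have : \sum_(j < 5) d j * a j = 0.
  rewrite (bigD1 i) //= di mul0r add0r -[RHS]E; apply/esym.
  rewrite (reindex_onto (lift i) (fun j => odflt ord0 (unlift i j))) /=; last first.
    by move=> j; case: unliftP => [k ->|->] //=; rewrite ?eqxx // liftK.
  rewrite [RHS](eq_bigl predT); last first.
    by move=> k; rewrite eq_sym neq_lift liftK eqxx.
  by apply: eq_bigr => k _; rewrite dl aE.
have inordE m (H : (m < 5)%N) : inord m = Ordinal H by apply/val_inj; rewrite /= inordK.
rewrite !big_ord_recl big_ord0 addr0 !addrA => <-.
rewrite (inordE 0%N isT) (inordE 1%N isT) (inordE 2%N isT) (inordE 3%N isT) (inordE 4%N isT).
by congr (d _ * _ + d _ * _ + d _ * _ + d _ * _ + d _ * _); apply/val_inj.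
Qed.

Section Combinations.
Variables (F : fieldType) (e0 e1 e2 e3 e4 : 'rV[F]_5).
Local Notation cb := (comb5 e0 e1 e2 e3 e4).

Lemma comb5_vertical k x l m : k *: cb 1 x 0 0 0 + l *: cb 0 0 1 x 0 + m *: cb 0 0 0 0 1 =
  cb k (k * x) l (l * x) m.
Proof. by apply/rowP => r; rewrite !mxE; ring. Qed.

Lemma comb5_horizontal k y l m : k *: cb 1 0 y 0 0 + l *: cb 0 1 0 y 0 + m *: cb 0 0 0 0 1 =
  cb k l (k * y) (l * y) m.
Proof. by apply/rowP => r; rewrite !mxE; ring. Qed.

Lemma comb5_00 : cb 0 0 0 0 0 = 0.
Proof. by rewrite /comb5 !scale0r !addr0. Qed.

End Combinations.

(** * The function [f] along the C-planes *)

Section Normal.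
Variables (F : finFieldType) (h : {scalar 'rV[F]_5}) (Sinf : {vspace 'rV[F]_5})
  (I : finType) (pl : I -> {vspace 'rV[F]_5}) (cs : {set 'rV[F]_5}).
Hypothesis cf : configuration h Sinf pl cs.
Local Notation V := 'rV[F]_5.
Local Notation B := (cblock pl cs).
Variables (e0 e1 e2 e3 e4 : V).
Hypothesis bas : basis5 e0 e1 e2 e3 e4.
Variable f : F -> F -> F.
Local Notation cb := (comb5 e0 e1 e2 e3 e4).
Local Notation P x y := (comb5 e0 e1 e2 e3 e4 1 x y (x * y) (f x y)).
Hypothesis Pcs : forall x y, P x y \in cs.
Hypothesis csP : forall a, a \in cs -> exists x y, a = P x y.

Let cbI c0 c1 c2 c3 c4 d0 d1 d2 d3 d4 : cb c0 c1 c2 c3 c4 = cb d0 d1 d2 d3 d4 ->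
  [/\ c0 = d0, c1 = d1, c2 = d2, c3 = d3 & c4 = d4].
Proof. exact: basis5_inj bas. Qed.

Lemma P_inj x y x' y' : P x y = P x' y' -> x = x' /\ y = y'.
Proof. by case/cbI. Qed.

(** The form in which (A1) produces C-planes: q distinct points of C in one plane are more than
    four. *)
Lemma plane_of_points (U : {vspace V}) (g : F -> V) : \dim U = 3%N -> injective g ->
  (forall t, g t \in cs) -> (forall t, g t \in U) -> exists i, U = pl i.
Proof.
move=> dU gI gcs gU; apply: (cf_big cf dU).
apply: leq_trans (_ : 4 < #|g @: [set: F]|)%N _.
  by rewrite card_imset // cardsT; apply: leq_trans (cf_q cf).
apply: subset_leq_card; apply/subsetP => _ /imsetP[t _ ->].
by rewrite inE gcs gU.
Qed.

Lemma mem_span3 (u v w z : V) : reflect (exists k l m : F, z = k *: u + l *: v + m *: w)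
  (z \in (<[u]> + <[v]> + <[w]>)%VS).
Proof.
apply: (iffP idP) => [|[k [l [m ->]]]]; last by rewrite !memv_add ?memvZ ?memv_line.
case/memv_addP => _ /memv_addP[_ /vlineP[k ->] [_ /vlineP[l ->] ->]] [_ /vlineP[m ->] ->].
by exists k, l, m.
Qed.

Lemma dim_span3 (u v w : V) : (forall k l m, k *: u + l *: v + m *: w = 0 ->
  [/\ k = 0, l = 0 & m = 0]) -> \dim (<[u]> + <[v]> + <[w]>) = 3%N.
Proof.
move=> H; suff : free [:: u; v; w] by rewrite /free !span_cons span_nil addv0 addvA => /eqP.
apply/(@freeP _ _ 3 [tuple u; v; w]) => k.
rewrite !big_ord_recl big_ord0 addr0 /= addrA => /H[k0 k1 k2].
by case=> [[|[|[|]]]] //= p; [move: k0|move: k1|move: k2]; congr (k _ = 0); apply/val_inj.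
Qed.

(** For fixed x the point [P x y] is u + y v + f(x, y) w, in a plane that does not depend on y,
    whatever [f] is. *)
Lemma vertical x : exists i, (forall y, P x y \in pl i) /\
  forall x' y', P x' y' \in pl i -> x' = x.
Proof.
pose u := cb 1 x 0 0 0; pose v := cb 0 0 1 x 0; pose w := cb 0 0 0 0 1.
have uvw := comb5_vertical e0 e1 e2 e3 e4.
have [|y y'||y|i Ei] := @plane_of_points (<[u]> + <[v]> + <[w]>)%VS (fun y => P x y).
- apply: dim_span3 => k l m; rewrite uvw => E.
  have : cb k (k * x) l (l * x) m = cb 0 0 0 0 0.
    by rewrite E comb5_00.
  by case/cbI => -> _ -> _ ->.
- by case/P_inj.
- exact: Pcs.
- by apply/mem_span3; exists 1, y, (f x y); rewrite uvw !mul1r [y * x]mulrC.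
exists i; rewrite -Ei; split=> [y|x' y' /mem_span3[k [l [m]]]].
  by apply/mem_span3; exists 1, y, (f x y); rewrite uvw !mul1r [y * x]mulrC.
by rewrite uvw => /cbI[<- -> _ _ _]; rewrite mul1r.
Qed.

Lemma horizontal y : exists i, (forall x, P x y \in pl i) /\
  forall x' y', P x' y' \in pl i -> y' = y.
Proof.
pose u := cb 1 0 y 0 0; pose v := cb 0 1 0 y 0; pose w := cb 0 0 0 0 1.
have uvw := comb5_horizontal e0 e1 e2 e3 e4.
have [|x x'||x|i Ei] := @plane_of_points (<[u]> + <[v]> + <[w]>)%VS (fun x => P x y).
- apply: dim_span3 => k l m; rewrite uvw => E.
  have : cb k l (k * y) (l * y) m = cb 0 0 0 0 0.
    by rewrite E comb5_00.
  by case/cbI => -> -> _ _ ->.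
- by case/P_inj.
- by move=> t; apply: (Pcs t y).
- by apply/mem_span3; exists 1, x, (f x y); rewrite uvw !mul1r ?mulr1.
exists i; rewrite -Ei; split=> [x|x' y' /mem_span3[k [l [m]]]].
  by apply/mem_span3; exists 1, x, (f x y); rewrite uvw !mul1r ?mulr1.
by rewrite uvw => /cbI[<- _ -> _ _]; rewrite mul1r.
Qed.

Lemma P_neq x y x' y' : (x != x') || (y != y') -> P x y != P x' y'.
Proof.
by apply: contraTneq => /P_inj[-> ->]; rewrite !eqxx.
Qed.

Lemma two_points_plane i x y x' y' k : (x != x') || (y != y') -> P x y \in pl i -> P x' y' \in pl i ->
  P x y \in pl k -> P x' y' \in pl k -> i = k.
Proof.
move=> ne pi pi' pk pk'.
exact: (cf_inj cf (Pcs x y) (Pcs x' y') (P_neq ne)).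
Qed.

(** The plane through [P 0 b] and [P 1 (a + b)] is neither vertical nor horizontal, so its points of
    C lie over the graph of an injective function [g]. An equation of the plane without the last
    coordinate shows that [g] is affine; one without the coordinate y then makes [f] a quadratic
    polynomial along it. *)
Lemma line_quadratic a b : a != 0 -> quadratic (fun x => f x (a * x + b)).
Proof.
move=> a0; have q7 := cf_q cf.
have ne01 : (0 != 1 :> F) || (b != a + b) by rewrite eq_sym oner_neq0.
have [i /andP[i0 i1]] := cf_join cf (Pcs 0 b) (Pcs 1 (a + b)) (P_neq ne01).
have gex x : exists y, P x y \in pl i.
  pose A : {set V} := B i.
  have [g Hg] : exists g : V -> F, forall a, a \in B i -> exists y, a = P (g a) y.
    have H v : exists x : F, v \in B i -> exists y, v = P x y.
      case: (boolP (v \in B i)) => [|_]; last by exists 0.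
      by rewrite in_cblock => /andP[/csP[x' [y' ->]] _]; exists x' => _; exists y'.
    by have [g Hg] := fin_all_exists H; exists g.
  have gI : {in B i &, injective g}.
    move=> v v' vi vi' e; have [y Ev] := Hg v vi; have [y' Ev'] := Hg v' vi'.
    rewrite -e in Ev'.
    case: (eqVneq y y') => [yy|ny]; first by rewrite Ev Ev' yy.
    have [k [Hk Hk']] := vertical (g v).
    have ne : (g v != g v) || (y != y') by rewrite ny orbT.
    have [_ vpi] : v \in cs /\ v \in pl i by apply/andP; rewrite -in_cblock.
    have [_ vpi'] : v' \in cs /\ v' \in pl i by apply/andP; rewrite -in_cblock.
    rewrite Ev in vpi; rewrite Ev' in vpi'.
    have ik := two_points_plane ne vpi vpi' (Hk y) (Hk y').
    rewrite ik in i0 i1; have := Hk' _ _ i0; rewrite -(Hk' _ _ i1) => /eqP.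
    by rewrite eq_sym oner_eq0.
  have : x \in g @: B i.
    suff -> : g @: B i = [set: F] by [].
    apply/eqP; rewrite eqEcard subsetT card_in_imset // cardsT (cblock_card cf).
    exact: leqnn.
  case/imsetP => v vi ->; have [y Ey] := Hg v vi; exists y; rewrite -Ey.
  by move: vi; rewrite in_cblock => /andP[].
have {gex}[g Hg] := fin_all_exists gex.
have gI x x' : g x = g x' -> x = x'.
  move=> e; apply/eqP/negPn/negP => nx; have [k [Hk Hk']] := horizontal (g x).
  have ne : (x != x') || (g x != g x) by rewrite nx.
  have H := Hg x'; rewrite -e in H.
  have ik := two_points_plane ne (Hg x) H (Hk x) (Hk x').
  rewrite ik in i0 i1; have := Hk' _ _ i0; rewrite -(Hk' _ _ i1) => /eqP.
  by rewrite eq_sym -subr_eq0 addrK (negPf a0).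
have uniq x y : P x y \in pl i -> y = g x.
  move=> Hy; apply/eqP/negPn/negP => ny; have [k [Hk Hk']] := vertical x.
  have ne : (x != x) || (y != g x) by rewrite ny orbT.
  have ik := two_points_plane ne Hy (Hg x) (Hk _) (Hk _).
  rewrite ik in i0 i1; have := Hk' _ _ i0; rewrite -(Hk' _ _ i1) => /eqP.
  by rewrite eq_sym oner_eq0.
have g0 : g 0 = b by rewrite -(uniq _ _ i0).
have g1 : g 1 = a + b by rewrite -(uniq _ _ i1).
have gE x : g x = a * x + b.
  have [d [[j dj] d4 Hd]] := basis5_functional (inord 4) bas (cf_dim cf i).
  have E x' : d (inord 0) + d (inord 1) * x' + d (inord 2) * g x' + d (inord 3) * (x' * g x') = 0.
    by have := Hd _ _ _ _ _ (Hg x'); rewrite d4 mul0r addr0 mulr1.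
  move: (E 0) (E 1) (E x); rewrite g0 g1.
  set d0 := d (inord 0); set d1 := d (inord 1); set d2 := d (inord 2); set d3 := d (inord 3).
  rewrite !mul0r !mulr0 !addr0 !mulr1 mul1r => E0 E1 Ex.
  case: (eqVneq d3 0) => [z3|n3].
    rewrite z3 mul0r addr0 in E1; rewrite z3 mul0r addr0 in Ex.
    have n2 : d2 != 0.
      apply: contraNneq dj => z2; rewrite z2 !mul0r !addr0 in E0 E1.
      have : j = inord j by rewrite inord_val.
      rewrite E0 add0r in E1.
      case: j => [[|[|[|[|[|]]]]]] // p ->; apply/eqP => //.
    apply: (mulfI n2).
    have -> : d2 * g x = - (d0 + d1 * x) by apply/eqP; rewrite -addr_eq0 addrC Ex.
    have e0' : d0 = - (d2 * b) by apply/eqP; rewrite -addr_eq0 E0.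
    have -> : d1 = - (d2 * a) by rewrite -[d1]subr0 -E1 e0'; ring.
    by rewrite e0'; ring.
  (* Since [g] is defined at [x0] too, where its coefficient vanishes, the equation is d3 (x - x0)
     (y + d1 / d3) = 0. Then [g] is constant off [x0], against injectivity. *)
  pose x0 := - d2 / d3.
  have Ez : d0 + d1 * x0 = 0.
    by rewrite -[RHS](E x0) -/d0 -/d1 -/d2 -/d3 /x0; field.
  have gk x' : x' != x0 -> g x' = - d1 / d3.
    move=> nx; have n1 : x' - x0 != 0 by rewrite subr_eq0.
    apply: (mulfI n3); apply: (mulIf n1).
    transitivity (- d1 * (x' - x0) - (d0 + d1 * x0) + (d0 + d1 * x' + d2 * g x' + d3 * (x' * g x'))).
      by rewrite /x0; field.
    by rewrite (E x') Ez subr0 addr0; field.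
  have n0 : x0 + 1 != x0 by rewrite -subr_eq0 addrC addKr oner_neq0.
  have n1 : x0 - 1 != x0 by rewrite -subr_eq0 addrC addKr oppr_eq0 oner_neq0.
  have /gI/addrI/eqP : g (x0 + 1) = g (x0 - 1) by rewrite !gk.
  by rewrite -subr_eq0 opprK -mulr2n (negPf (two_neq0 (cf_odd cf))).
have [d [[j dj] d2 Hd]] := basis5_functional (inord 2) bas (cf_dim cf i).
have E x : d (inord 0) + d (inord 1) * x + d (inord 3) * (x * (a * x + b)) + d (inord 4) * f x (a * x + b) = 0.
  by have := Hd _ _ _ _ _ (Hg x); rewrite gE d2 mul0r addr0 mulr1.
have n4 : d (inord 4) != 0.
  apply: contraNneq dj => z4.
  have [k0 k1 k2 _ _] : [/\ d (inord 0) = 0, d (inord 1) + d (inord 3) * b = 0,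
      d (inord 3) * a = 0, (0 : F) = 0 & (0 : F) = 0].
    apply: (quartic_zero q7) => u; rewrite -[RHS](E u) z4; ring.
  have k3 : d (inord 3) = 0 by move/eqP: k2; rewrite mulf_eq0 (negPf a0) orbF => /eqP.
  rewrite k3 mul0r addr0 in k1.
  have -> : j = inord j by rewrite inord_val.
  case: j => [[|[|[|[|[|]]]]]] // p; apply/eqP => //.
exists (- d (inord 0) / d (inord 4)), (- (d (inord 1) + d (inord 3) * b) / d (inord 4)),
   (- (d (inord 3) * a) / d (inord 4)) => x.
apply: (mulfI n4).
transitivity (- (d (inord 0) + d (inord 1) * x + d (inord 3) * (x * (a * x + b)))).
  by apply/eqP; rewrite -addr_eq0 addrC E.
by field.
Qed.

End Normal.

Section QuadCombinations.
Variables (F : fieldType) (e0 e1 e2 e3 e4 : 'rV[F]_5) (al be : F).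
Local Notation cb := (comb5 e0 e1 e2 e3 e4).
(** Along a direction (d1, d2), [qtan] and [qinf] are the coefficients of t and t^2 in
    [qpt (x + t * d1) (y + t * d2)], by [qpt_span]. *)
Definition qpt (x y : F) := cb 1 x y (x * y) (al * x ^+ 2 + be * y ^+ 2).
Definition qtan (x y d1 d2 : F) :=
  cb 0 d1 d2 (x * d2 + y * d1) (2%:R * al * x * d1 + 2%:R * be * y * d2).
Definition qinf (d1 d2 : F) := cb 0 0 0 (d1 * d2) (al * d1 ^+ 2 + be * d2 ^+ 2).

Lemma qpt_span x y d1 d2 t :
  1 *: qpt x y + t *: qtan x y d1 d2 + t ^+ 2 *: qinf d1 d2 = qpt (x + t * d1) (y + t * d2).
Proof. by apply/rowP => r; rewrite !mxE; ring. Qed.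

Lemma qpt_span_to x y x' y' :
  1 *: qpt x y + 1 *: qtan x y (x' - x) (y' - y) + 1 *: qinf (x' - x) (y' - y) = qpt x' y'.
Proof. by apply/rowP => r; rewrite !mxE; ring. Qed.

Lemma qpt_span0 k : 1 *: qpt 0 0 + 1 *: qtan 0 0 k 1 + 1 *: qinf k 1 = qpt k 1.
Proof. by apply/rowP => r; rewrite !mxE; ring. Qed.

Lemma qinf_ramified k : be = k ^+ 2 * al ->
  1 *: qpt 0 0 + 0 *: qtan 0 0 k 1 + 1 *: qinf k 1 = cb 1 0 0 k (2%:R * al * k ^+ 2).
Proof. by move=> E; rewrite /qpt /qtan /qinf E; apply/rowP => r; rewrite !mxE; ring. Qed.

Lemma qspanE x y d1 d2 k l m :
  k *: qpt x y + l *: qtan x y d1 d2 + m *: qinf d1 d2 =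
  cb k (k * x + l * d1) (k * y + l * d2)
    (k * (x * y) + l * (x * d2 + y * d1) + m * (d1 * d2))
    (k * (al * x ^+ 2 + be * y ^+ 2) + l * (2%:R * al * x * d1 + 2%:R * be * y * d2)
      + m * (al * d1 ^+ 2 + be * d2 ^+ 2)).
Proof. by apply/rowP => r; rewrite !mxE; ring. Qed.

Lemma comb5_shear p0 p1 p2 p12 x y :
  comb5 (e0 + p0 *: e4) (e1 + p1 *: e4) (e2 + p2 *: e4) (e3 + p12 *: e4) e4
    1 x y (x * y) (al * x ^+ 2 + be * y ^+ 2) =
  cb 1 x y (x * y) (p0 + p1 * x + p2 * y + al * x ^+ 2 + p12 * (x * y) + be * y ^+ 2).
Proof. by apply/rowP => r; rewrite !mxE; ring. Qed.

Lemma comb5_unshear p0 p1 p2 p12 c0 c1 c2 c3 c4 :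
  cb c0 c1 c2 c3 c4 =
  comb5 (e0 + p0 *: e4) (e1 + p1 *: e4) (e2 + p2 *: e4) (e3 + p12 *: e4) e4
    c0 c1 c2 c3 (c4 - p0 * c0 - p1 * c1 - p2 * c2 - p12 * c3).
Proof. by apply/rowP => r; rewrite !mxE; ring. Qed.

End QuadCombinations.

(* If be = k^2 al, the direction (k, 1) is the only one above its node. *)
Lemma ramified_direction (F : fieldType) (al k x y d1 d2 l m : F) :
  al != 0 -> k != 0 -> 2%:R != 0 :> F -> x + l * d1 = 0 -> y + l * d2 = 0 ->
  x * y + l * (x * d2 + y * d1) + m * (d1 * d2) = k ->
  al * x ^+ 2 + k ^+ 2 * al * y ^+ 2 + l * (2%:R * al * x * d1 + 2%:R * (k ^+ 2 * al) * y * d2)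
      + m * (al * d1 ^+ 2 + k ^+ 2 * al * d2 ^+ 2) = 2%:R * al * k ^+ 2 ->
  d1 = k * d2 /\ d2 != 0.
Proof.
move=> al0 k0 t0 Ex Ey.
have -> : x = - (l * d1) by apply/eqP; rewrite -addr_eq0 Ex.
have -> : y = - (l * d2) by apply/eqP; rewrite -addr_eq0 Ey.
set s := m - l ^+ 2 => E1 E2.
have {}E1 : s * (d1 * d2) = k by rewrite -E1 /s; ring.
have {}E2 : s * (d1 ^+ 2 + k ^+ 2 * d2 ^+ 2) = 2%:R * k ^+ 2.
  apply: (mulfI al0); transitivity (2%:R * al * k ^+ 2); last by ring.
  by rewrite -E2 /s; ring.
have s0 : s != 0 by apply: contraNneq k0 => z; rewrite -E1 z mul0r.
have d20 : d2 != 0 by apply: contraNneq k0 => z; rewrite -E1 z !mulr0.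
split=> //; apply/eqP; rewrite -subr_eq0 -sqrf_eq0.
have : s * (d1 - k * d2) ^+ 2 = 0.
  transitivity (s * (d1 ^+ 2 + k ^+ 2 * d2 ^+ 2) - 2%:R * k * (s * (d1 * d2))); first by ring.
  by rewrite E2 E1; ring.
by move/eqP; rewrite mulf_eq0 (negPf s0).
Qed.

(** * C-planes of the quadratic graph *)

Section Planes.
Variables (F : finFieldType) (h : {scalar 'rV[F]_5}) (Sinf : {vspace 'rV[F]_5})
  (I : finType) (pl : I -> {vspace 'rV[F]_5}) (cs : {set 'rV[F]_5}).
Hypothesis cf : configuration h Sinf pl cs.
Local Notation V := 'rV[F]_5.
Variables (e0 e1 e2 e3 e4 : V) (al be : F).
Hypothesis bas : basis5 e0 e1 e2 e3 e4.
Hypotheses (h0 : h e0 = 1) (h1 : h e1 = 0) (h2 : h e2 = 0) (h3 : h e3 = 0) (h4 : h e4 = 0).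
Local Notation cb := (comb5 e0 e1 e2 e3 e4).
Local Notation P := (qpt e0 e1 e2 e3 e4 al be).
Local Notation T := (qtan e0 e1 e2 e3 e4 al be).
Local Notation N := (qinf e0 e1 e2 e3 e4 al be).
Hypothesis Pcs : forall x y, P x y \in cs.
Hypothesis csP : forall a, a \in cs -> exists x y, a = P x y.

Let cbI c0 c1 c2 c3 c4 d0 d1 d2 d3 d4 : cb c0 c1 c2 c3 c4 = cb d0 d1 d2 d3 d4 ->
  [/\ c0 = d0, c1 = d1, c2 = d2, c3 = d3 & c4 = d4].
Proof. exact: basis5_inj bas. Qed.

Lemma h_comb5 c0 c1 c2 c3 c4 : h (cb c0 c1 c2 c3 c4) = c0.
Proof.
rewrite /comb5 !linearD !linearZ /= h0 h1 h2 h3 h4.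
by rewrite !mulr0 !addr0 mulr1.
Qed.

Lemma qpt_inj x y x' y' : P x y = P x' y' -> x = x' /\ y = y'.
Proof. by case/cbI. Qed.

Let not_collinear3 (u v w : V) : u \in cs -> v \in cs -> w \in cs ->
  u != v -> u != w -> v != w -> u + v = 2%:R *: w -> False.
Proof.
move=> cu cv cw uv uw vw E.
have t0 := two_neq0 (cf_odd cf).
have [i /andP[ui vi]] := cf_join cf cu cv uv.
have wuv : w \in (<[u]> + <[v]>)%VS.
  have -> : w = 2%:R^-1 *: (u + v) by rewrite E scalerA mulVf // scale1r.
  by rewrite memvZ // memv_add ?memv_line.
have wi : w \in pl i by move: wuv; apply/subvP; rewrite subv_add -!memvE ui.
by have := cf_arc cf cu cv cw ui vi wi uv uw vw; rewrite wuv.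
Qed.

Let one_neqN1 : (1 : F) != -1.
Proof. by rewrite -subr_eq0 opprK -mulr2n (two_neq0 (cf_odd cf)). Qed.

(** Otherwise [P 0 0] would be the midpoint of [P 1 0] and [P (-1) 0]: three collinear points of
    C. *)
Lemma al_neq0 : al != 0.
Proof.
apply/eqP => z.
apply: (not_collinear3 (Pcs 1 0) (Pcs (-1) 0) (Pcs 0 0)).
- by apply/eqP => /qpt_inj[/eqP]; rewrite (negPf one_neqN1).
- by apply/eqP => /qpt_inj[/eqP]; rewrite oner_eq0.
- by apply/eqP => /qpt_inj[/eqP]; rewrite oppr_eq0 oner_eq0.
by rewrite /qpt z; apply/rowP => r; rewrite !mxE; ring.
Qed.

Lemma be_neq0 : be != 0.
Proof.
apply/eqP => z.
apply: (not_collinear3 (Pcs 0 1) (Pcs 0 (-1)) (Pcs 0 0)).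
- by apply/eqP => /qpt_inj[_ /eqP]; rewrite (negPf one_neqN1).
- by apply/eqP => /qpt_inj[_ /eqP]; rewrite oner_eq0.
- by apply/eqP => /qpt_inj[_ /eqP]; rewrite oppr_eq0 oner_eq0.
by rewrite /qpt z; apply/rowP => r; rewrite !mxE; ring.
Qed.

(** The span contains the q points [P (x + t * d1) (y + t * d2)]. It is a plane because [N d1 d2]
    vanishes only for d1 = d2 = 0, as al and be are nonzero. *)
Lemma plane_param x y d1 d2 : (d1 != 0) || (d2 != 0) ->
  exists i, pl i = (<[P x y]> + <[T x y d1 d2]> + <[N d1 d2]>)%VS.
Proof.
move=> d0.
have [|t t'|t|t|i ->] := @plane_of_points F h Sinf I pl cs cf
    (<[P x y]> + <[T x y d1 d2]> + <[N d1 d2]>)%VS (fun t => P (x + t * d1) (y + t * d2)).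
- apply: dim_span3 => k l m; rewrite qspanE -[X in _ = X](comb5_00 e0 e1 e2 e3 e4).
  case/cbI => k0; rewrite k0 !mul0r !add0r => E1 E2 E3 E4.
  have l0 : l = 0.
    move/eqP: E1; move/eqP: E2; rewrite !mulf_eq0; case: eqP => //= _ /eqP z2 /eqP z1.
    by move: d0; rewrite z1 z2 eqxx.
  split=> //; rewrite l0 !mul0r !add0r in E3 E4.
  apply/eqP/negPn/negP => m0; move/eqP: E3; rewrite !mulf_eq0 (negPf m0) /=.
  move/eqP: E4; rewrite mulf_eq0 (negPf m0) /= => /eqP E4 /orP[/eqP z|/eqP z].
    move/eqP: E4; rewrite z expr0n /= mulr0 add0r mulf_eq0 (negPf be_neq0) /= sqrf_eq0.
    by move: d0; rewrite z eqxx /= => /negPf->.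
  move/eqP: E4; rewrite z expr0n /= mulr0 addr0 mulf_eq0 (negPf al_neq0) /= sqrf_eq0.
  by move: d0; rewrite z eqxx orbF => /negPf->.
- case/qpt_inj => /addrI E1 /addrI E2; case/orP: d0 => d0; exact: (mulIf d0).
- exact: Pcs.
- by apply/mem_span3; exists 1, t, (t ^+ 2); rewrite qpt_span.
by exists i.
Qed.

Lemma plane_param_of i : exists x y d1 d2, ((d1 != 0) || (d2 != 0)) /\
  pl i = (<[P x y]> + <[T x y d1 d2]> + <[N d1 d2]>)%VS.
Proof.
have : (1 < #|cblock pl cs i|)%N by rewrite (cblock_card cf); apply: q_gt1 cf.
case/card_gt1P => a [b [ai bi ab]].
have [ca api] : a \in cs /\ a \in pl i by apply/andP; rewrite -in_cblock.
have [cb' bpi] : b \in cs /\ b \in pl i by apply/andP; rewrite -in_cblock.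
have [x [y Ea]] := csP ca; have [x' [y' Eb]] := csP cb'.
have d0 : (x' - x != 0) || (y' - y != 0).
  apply: contraNT ab; rewrite negb_or !negbK !subr_eq0 => /andP[/eqP xx /eqP yy].
  by rewrite Ea Eb xx yy.
exists x, y, (x' - x), (y' - y); split=> //.
have [j Ej] := plane_param x y d0; rewrite -Ej; congr pl.
apply: (cf_inj cf ca cb' ab) => //; rewrite Ej ?Eb; last first.
  by apply/mem_span3; exists 1, 1, 1; rewrite qpt_span_to.
by rewrite {1}Ea; apply/mem_span3; exists 1, 0, 0; rewrite !scale0r !addr0 scale1r.
Qed.

(** If be = k^2 al, the point [X] = [P 0 0] + [N k 1] is off C, and by [ramified_direction] every
    C-plane through it has direction (k, 1) and passes through [P 0 0]. So [i] is the only such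
    plane, whereas (A3) requires a second one. *)
Lemma be_nonsquare k : be != k ^+ 2 * al.
Proof.
apply/eqP => bE; have k0 : k != 0.
  by apply: contraTneq be_neq0 => z; rewrite bE z expr0n mul0r eqxx.
have t0 := two_neq0 (cf_odd cf).
pose X := cb 1 0 0 k (2%:R * al * k ^+ 2).
have hX : h X = 1 by rewrite h_comb5.
have nX : X \notin cs.
  apply/negP => /csP[x [y /cbI[_ <- <- /eqP]]]; by rewrite mul0r (negPf k0).
have d0 : (k != 0) || ((1 : F) != 0) by rewrite k0.
have [i Ei] := plane_param 0 0 d0.
have Xi : X \in pl i.
  by rewrite Ei; apply/mem_span3; exists 1, 0, 1; rewrite (qinf_ramified _ _ _ _ _ bE).
have [j ji Hj] := other_plane cf hX nX Xi.
have Xj : X \in pl j by rewrite Hj eqxx orbT.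
have [x [y [d1 [d2 [d0' Ej]]]]] := plane_param_of j.
move: Xj; rewrite Ej => /mem_span3[k1 [l [m]]]; rewrite qspanE /X => /cbI[<-].
rewrite !mul1r => /esym Ex /esym Ey /esym E3 /esym E4; rewrite bE in E4.
have [dk d20] := ramified_direction al_neq0 k0 t0 Ex Ey E3 E4.
have Ptj t : P (x + t * d1) (y + t * d2) \in pl j.
  by rewrite Ej; apply/mem_span3; exists 1, t, (t ^+ 2); rewrite qpt_span.
have P0j : P 0 0 \in pl j by have := Ptj l; rewrite Ex Ey.
have Pkj : P k 1 \in pl j.
  have := Ptj (l + d2^-1); rewrite !mulrDl !addrA Ex Ey !add0r dk mulVf //.
  by rewrite mulrCA mulVf // mulr1.
have P0i : P 0 0 \in pl i.
  by rewrite Ei; apply/mem_span3; exists 1, 0, 0; rewrite !scale0r !addr0 scale1r.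
have Pki : P k 1 \in pl i.
  by rewrite Ei; apply/mem_span3; exists 1, 1, 1; rewrite qpt_span0.
case/eqP: ji; apply: (cf_inj cf (Pcs 0 0) (Pcs k 1)) => //.
by apply/eqP => /qpt_inj[_ /eqP]; rewrite eq_sym oner_eq0.
Qed.
End Planes.

Section NormalForm.
Variables (F : finFieldType) (h : {scalar 'rV[F]_5}) (Sinf : {vspace 'rV[F]_5})
  (I : finType) (pl : I -> {vspace 'rV[F]_5}) (cs : {set 'rV[F]_5}).
Hypothesis cf : configuration h Sinf pl cs.

Theorem normal_form : exists (e0 e1 e2 e3 e4 : 'rV[F]_5) (al be : F),
  [/\ basis5 e0 e1 e2 e3 e4, h e0 = 1,
      [/\ h e1 = 0, h e2 = 0, h e3 = 0 & h e4 = 0],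
      al != 0 /\ (forall k, be != k ^+ 2 * al) &
      (forall x y, qpt e0 e1 e2 e3 e4 al be x y \in cs) /\
      forall a, a \in cs -> exists x y, a = qpt e0 e1 e2 e3 e4 al be x y].
Proof.
have [n Hn] := directions cf.
have [e0 [e1 [e2 [e3 [e4 [bas h0 [h1 h2 h3 h4] ex [all uniq]]]]]]] := grid cf Hn.
have [f Hf] : exists f : F -> F -> F, forall x y, comb5 e0 e1 e2 e3 e4 1 x y (x * y) (f x y) \in cs.
  have [g Hg] := fin_all_exists (fun p : F * F => ex p.1 p.2).
  by exists (fun x y => g (x, y)) => x y; apply: (Hg (x, y)).
have fP a : a \in cs -> exists x y, a = comb5 e0 e1 e2 e3 e4 1 x y (x * y) (f x y).
  move=> ca; have [x [y [w E]]] := all a ca; exists x, y; rewrite E.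
  by congr comb5; apply: (uniq x y) => //; rewrite -E.
have [p0 [p1 [p2 [al [p12 [be fE]]]]]] := quadratic_on_lines (cf_q cf) (cf_odd cf)
   (fun a b a0 => line_quadratic cf bas Hf fP b a0).
pose e0' := e0 + p0 *: e4; pose e1' := e1 + p1 *: e4; pose e2' := e2 + p2 *: e4.
pose e3' := e3 + p12 *: e4.
have bas' : basis5 e0' e1' e2' e3' e4.
  apply: basis5I => v; have [c0 [c1 [c2 [c3 [c4 ->]]]]] := basis5_span bas v.
  by rewrite (comb5_unshear _ _ _ _ _ p0 p1 p2 p12); do 5!eexists.
have qE x y : qpt e0' e1' e2' e3' e4 al be x y = comb5 e0 e1 e2 e3 e4 1 x y (x * y) (f x y).
  by rewrite /qpt comb5_shear fE.
have Pcs x y : qpt e0' e1' e2' e3' e4 al be x y \in cs by rewrite qE.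
have csP a : a \in cs -> exists x y, a = qpt e0' e1' e2' e3' e4 al be x y.
  by move=> /fP[x [y ->]]; exists x, y; rewrite qE.
have h0' : h e0' = 1 by rewrite /e0' linearD linearZ /= h4 mulr0 addr0.
have h1' : h e1' = 0 by rewrite /e1' linearD linearZ /= h4 mulr0 addr0.
have h2' : h e2' = 0 by rewrite /e2' linearD linearZ /= h4 mulr0 addr0.
have h3' : h e3' = 0 by rewrite /e3' linearD linearZ /= h4 mulr0 addr0.
exists e0', e1', e2', e3', e4, al, be; split=> //; split.
  exact: (al_neq0 cf bas' Pcs).
exact: (be_nonsquare cf bas' h0' h1' h2' h3' h4 Pcs csP).
Qed.
End NormalForm.

From mathcomp Require Import boolp.

(** * Quadratic extension *)

Lemma expf_card_exp (F : finFieldType) n (x : F) : x ^+ (#|F| ^ n) = x.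
Proof. by elim: n => [|n IH]; rewrite ?expr1 // expnS exprM expf_card. Qed.

Lemma finField_generator (F : finFieldType) :
  exists a : F, (forall x, x != 0 -> exists k, x = a ^+ k) /\
    (forall m, a ^+ m = 1 -> (#|F|.-1 %| m)%N).
Proof.
have /cyclicP[u Eu] := field_unit_group_cyclic [set: {unit F}].
exists (val u); split=> [x x0|m um].
  have ux : x \is a GRing.unit by rewrite unitfE.
  have : FinRing.unit F ux \in <[u]>%g by rewrite -Eu inE.
  by case/cycleP => k /(congr1 val); rewrite FinRing.val_unitX /= => ->; exists k.
rewrite -card_finField_unit Eu -orderE order_dvdn; apply/eqP/val_inj.
by rewrite FinRing.val_unitX um.
Qed.

Section Embedding.
Variables (k : fieldType) (F K : finFieldType).
Variables (f : {rmorphism k -> F}) (g : {rmorphism k -> K}).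

(* [b] is a root of the minimal polynomial of [a] over k. *)
Lemma exists_conjugate n (a : F) : #|K| = (#|F| ^ n)%N ->
  exists b : K, forall r : {poly k}, (map_poly f r).[a] = 0 -> (map_poly g r).[b] = 0.
Proof.
(* [P] vanishes at [a] because the order of K is a power of that of F, and it splits over K. The
   minimal polynomial [m] of [a] divides it, so it has a root in K. *)
move=> cK; pose P : {poly k} := 'X^#|K| - 'X.
have Pa : (map_poly f P).[a] = 0.
  by rewrite rmorphB /= map_polyXn map_polyX !hornerE cK expf_card_exp subrr.
have P0 : P != 0.
  apply/eqP => /(congr1 (fun r : {poly k} => r`_#|K|)).
  rewrite coefB coefXn eqxx coefX coef0 eqn_leq leqNgt (finNzRing_gt1 K) /= subr0.
  by move/eqP; rewrite oner_eq0.
pose ann s := `[< exists r : {poly k}, [/\ r != 0, (map_poly f r).[a] = 0 & size r = s] >].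
have exs : exists s, ann s by exists (size P); apply/asboolP; exists P.
case: (ex_minnP exs) => s /asboolP[m [m0 ma sm]] mins.
have minm (r : {poly k}) : (map_poly f r).[a] = 0 -> m %| r.
  move=> ra; rewrite /dvdp; apply/negPn/negP => r0.
  have : (s <= size (r %% m)%R)%N.
    apply: mins; apply/asboolP; exists (r %% m); split=> //.
    have := divp_eq r m => /(congr1 (fun r => (map_poly f r).[a])).
    by rewrite rmorphD rmorphM /= hornerD hornerM ma mulr0 add0r ra.
  by rewrite -sm leqNgt ltn_modp m0.
have sm1 : size (map_poly g m) != 1%N.
  rewrite size_map_poly; apply/eqP => /eqP/size_poly1P[c c0 mc].
  by move: ma; rewrite mc map_polyC hornerC => /eqP; rewrite fmorph_eq0 (negPf c0).
have : map_poly g m %| \prod_(x <- enum K) ('X - x%:P).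
  have -> : \prod_(x <- enum K) ('X - x%:P) = map_poly g P.
    rewrite big_enum /= rmorphB /= map_polyXn map_polyX finField_genPoly.
    by apply: eq_bigl => x.
  by rewrite dvdp_map minm.
case/dvdp_prod_XsubC => msk; set l := mask _ _.
case: l => [|b l] Em.
  by move: sm1; rewrite (eqp_size Em) big_nil size_poly1.
exists b => r /minm/dvdpP[r' ->]; rewrite rmorphM hornerM /=.
have : root (map_poly g m) b by rewrite (eqp_root Em) root_prod_XsubC inE eqxx.
by move/rootP => ->; rewrite mulr0.
Qed.

(** F = k[a] for a generator [a] of its unit group, and r(a) -> r(b) is well defined by the choice
    of the conjugate [b]. *)
Lemma embedding_over n : #|K| = (#|F| ^ n)%N ->
  exists iota : {rmorphism F -> K}, True.
Proof.
move=> cK; have [a [Ha _]] := finField_generator F.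
have [b Hb] := exists_conjugate a cK.
have surj x : exists r : {poly k}, (map_poly f r).[a] = x.
  case: (eqVneq x 0) => [->|/Ha[j ->]]; first by exists 0; rewrite rmorph0 horner0.
  by exists ('X^j); rewrite map_polyXn hornerXn.
have [s Hs] := fin_all_exists surj.
pose i x := (map_poly g (s x)).[b].
have key x (r : {poly k}) : (map_poly f r).[a] = x -> i x = (map_poly g r).[b].
  move=> rx; apply/eqP; rewrite /i -subr_eq0 -hornerN -hornerD -rmorphN -rmorphD /=.
  by rewrite Hb // rmorphB /= hornerD hornerN rx Hs subrr.
have ia : zmod_morphism i.
  move=> x y; rewrite (key _ (s x - s y)); first by rewrite rmorphB /= hornerD hornerN.
  by rewrite rmorphB /= hornerD hornerN !Hs.
have im : monoid_morphism i.
  split; first by rewrite (key 1 1) rmorph1 hornerC.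
  move=> x y; rewrite (key _ (s x * s y)); first by rewrite rmorphM /= hornerM.
  by rewrite rmorphM /= hornerM !Hs.
pose A := GRing.isZmodMorphism.Build F K i ia.
pose M := GRing.isMonoidMorphism.Build F K i im.
by exists (HB.pack i A M : {rmorphism F -> K}).
Qed.
End Embedding.

(** K is given by its order alone, which determines its characteristic; the embedding is built over
    the common prime field. *)
Lemma finField_embedding (F K : finFieldType) n : (0 < n)%N -> #|K| = (#|F| ^ n)%N ->
  exists iota : {rmorphism F -> K}, True.
Proof.
move=> n0 cK; have [p pr chF] := finPcharP F.
have cF : #|F| = (p ^ logn p #|F|)%N := card_pprimeChar chF.
have chK : p \in [pchar K].
  by apply: (@card_finPcharP _ _ (logn p #|F| * n)) => //; rewrite cK cF expnM pfactorK.
have [f _] : exists f : {rmorphism 'F_p -> F}, True.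
  by exists (GRing.in_alg (pPrimeCharType chF) : {rmorphism _ -> _}).
have [g _] : exists g : {rmorphism 'F_p -> K}, True.
  by exists (GRing.in_alg (pPrimeCharType chK) : {rmorphism _ -> _}).
exact (@embedding_over _ F K f g n cK).
Qed.

(** Write iota x = a^j with a generator [a] of the units of K. From x^(q - 1) = 1 it follows that j
    is a multiple of (q^2 - 1) / (q - 1) = q + 1, which is even. *)
Lemma finField_sqrt (F K : finFieldType) (iota : {rmorphism F -> K}) (x : F) :
  odd #|F| -> #|K| = (#|F| ^ 2)%N -> exists y : K, y ^+ 2 = iota x.
Proof.
move=> qo cK; case: (eqVneq x 0) => [->|x0]; first by exists 0; rewrite rmorph0 expr0n.
have [a [Ha Hord]] := finField_generator K.
have [j Ej] : exists j, iota x = a ^+ j by apply: Ha; rewrite fmorph_eq0.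
have q1 : (1 < #|F|)%N := finNzRing_gt1 F.
have /Hord : a ^+ (j * #|F|.-1) = 1.
  rewrite exprM -Ej -rmorphXn /=; suff -> : x ^+ #|F|.-1 = 1 by rewrite rmorph1.
  by apply: (mulIf x0); rewrite -exprSr prednK ?expf_card ?mul1r // ltnW.
have -> : (#|K|.-1 = #|F|.+1 * #|F|.-1)%N by rewrite cK; move: q1; clear; nia.
rewrite dvdn_pmul2r; last by move: q1; clear; lia.
case/dvdnP => l El; exists (a ^+ (l * (#|F|.+1)./2)).
rewrite -exprM Ej El; congr (_ ^+ _); rewrite -mulnA; congr (_ * _)%N.
by rewrite muln2; have := odd_double_half #|F|.+1; rewrite /= qo add0n.
Qed.

(* Coordinates identifying F^5 with F x K x K, where K has degree 2 over F: the
   points of [cs] become the vectors (1, X, X^2). *)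
Record complex_frame (F K : finFieldType) (h : {scalar 'rV[F]_5})
    (cs : {set 'rV[F]_5}) (iota : {rmorphism F -> K}) (kap : K)
    (vec : F -> K -> K -> 'rV[F]_5) : Prop := ComplexFrame {
  fr_add : forall a b X Y X' Y', vec a X Y + vec b X' Y' = vec (a + b) (X + X') (Y + Y');
  fr_scale : forall c a X Y, c *: vec a X Y = vec (c * a) (iota c * X) (iota c * Y);
  fr_span : forall v, exists a X Y, v = vec a X Y;
  fr_inj : forall a b X Y X' Y', vec a X Y = vec b X' Y' -> [/\ a = b, X = X' & Y = Y'];
  fr_h : forall a X Y, h (vec a X Y) = a;
  fr_cs : forall X, vec 1 X (X ^+ 2) \in cs;
  fr_csP : forall v, v \in cs -> exists X, v = vec 1 X (X ^+ 2);
  fr_deg : forall X, exists x y, X = iota x + kap * iota y;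
  fr_free : forall x y, iota x + kap * iota y = 0 -> x = 0 /\ y = 0
}.

Theorem complex_form (F K : finFieldType) (h : {scalar 'rV[F]_5})
    (Sinf : {vspace 'rV[F]_5}) (I : finType) (pl : I -> {vspace 'rV[F]_5})
    (cs : {set 'rV[F]_5}) :
  configuration h Sinf pl cs -> #|K| = (#|F| ^ 2)%N ->
  exists (iota : {rmorphism F -> K}) kap vec, complex_frame h cs iota kap vec.
Proof.
move=> cf cK.
have [e0 [e1 [e2 [e3 [e4 [al [be [bas h0 [h1 h2 h3 h4] [al0 nonsq] [Pcs csP]]]]]]]]] := normal_form cf.
have [iota _] := finField_embedding (isT : (0 < 2)%N) cK.
have [kap kE] := finField_sqrt iota (be / al) (cf_odd cf) cK.
have t0 := two_neq0 (cf_odd cf).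
have fre x y : iota x + kap * iota y = 0 -> x = 0 /\ y = 0.
  case: (eqVneq y 0) => [->|y0 E].
    by rewrite rmorph0 mulr0 addr0 => /eqP; rewrite fmorph_eq0 => /eqP.
  have iy0 : iota y != 0 by rewrite fmorph_eq0.
  have kk : kap = iota (- x / y).
    apply: (mulIf iy0); rewrite -rmorphM divfK // rmorphN.
    by apply/eqP; rewrite -addr_eq0 addrC E.
  have /eqP := nonsq (- x / y); case.
  apply: (mulIf (invr_neq0 al0)); apply: (fmorph_inj iota).
  by rewrite -kE kk -rmorphXn mulfK.
have finj x y x' y' : iota x + kap * iota y = iota x' + kap * iota y' -> x = x' /\ y = y'.
  move=> E; have /fre[/eqP] : iota (x - x') + kap * iota (y - y') = 0.
    transitivity (iota x + kap * iota y - (iota x' + kap * iota y')).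
      by rewrite !rmorphB; ring.
    by rewrite E subrr.
  by rewrite subr_eq0 => /eqP-> /eqP; rewrite subr_eq0 => /eqP->.
have deg X : exists p : F * F, X = iota p.1 + kap * iota p.2.
  pose m (p : F * F) := iota p.1 + kap * iota p.2.
  have mI : injective m by move=> [x y] [x' y'] /finj[/= -> ->].
  have : X \in m @: [set: F * F].
    suff -> : m @: [set: F * F] = [set: K] by rewrite inE.
    by apply/eqP; rewrite eqEcard subsetT card_imset //= !cardsT card_prod cK mulnn.
  by case/imsetP => p _ ->; exists p.
have [j Hj] := fin_all_exists deg.
have jE X x y : X = iota x + kap * iota y -> j X = (x, y).
  by rewrite {1}(Hj X) => /finj; case: (j X) => u v /= [-> ->].
have jD X Y : j (X + Y) = ((j X).1 + (j Y).1, (j X).2 + (j Y).2).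
  by apply: jE; rewrite {1}(Hj X) {1}(Hj Y) !rmorphD; ring.
have jZ c X : j (iota c * X) = (c * (j X).1, c * (j X).2).
  by apply: jE; rewrite {1}(Hj X) !rmorphM; ring.
pose vec a X Y := comb5 e0 e1 e2 e3 e4 a (j X).1 (j X).2 ((j Y).2 / 2%:R) (al * (j Y).1).
have sq x y : j ((iota x + kap * iota y) ^+ 2) = (x ^+ 2 + (be / al) * y ^+ 2, 2%:R * (x * y)).
  apply: jE; rewrite rmorphD !rmorphXn rmorphM /= -kE !rmorphM rmorph_nat; ring.
have qE x y : qpt e0 e1 e2 e3 e4 al be x y =
    vec 1 (iota x + kap * iota y) ((iota x + kap * iota y) ^+ 2).
  rewrite /vec sq (jE _ x y) //= /qpt; congr comb5; by field.
exists iota, kap, vec; split.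
- by move=> a b X Y X' Y'; rewrite /vec comb5D !jD /=; congr comb5; field.
- by move=> c a X Y; rewrite /vec comb5Z !jZ /=; congr comb5; field.
- move=> v; have [c0 [c1 [c2 [c3 [c4 ->]]]]] := basis5_span bas v.
  exists c0, (iota c1 + kap * iota c2), (iota (c4 / al) + kap * iota (2%:R * c3)).
  by rewrite /vec !(jE _ _ _ (erefl _)) /=; congr comb5; field.
- move=> a b X Y X' Y' /(basis5_inj bas)[-> E1 E2 E3 E4].
  have E3' : (j Y).2 = (j Y').2 by apply: (mulIf (invr_neq0 t0)).
  have E4' : (j Y).1 = (j Y').1 by apply: (mulfI al0).
  by rewrite (Hj X) (Hj X') (Hj Y) (Hj Y') E1 E2 E3' E4'.
- by move=> a X Y; apply: h_comb5.
- by move=> X; rewrite (Hj X) -qE.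
- by move=> v /csP[x [y ->]]; exists (iota x + kap * iota y); rewrite qE.
- by move=> X; exists (j X).1, (j X).2.
- exact: fre.
Qed.

(** * Segre's theorem *)

Section Dual3.
Variables (K : fieldType) (u v w : 'rV[K]_3).

Lemma free3P : free [:: u; v; w] -> forall a b c,
  a *: u + b *: v + c *: w = 0 -> [/\ a = 0, b = 0 & c = 0].
Proof.
move=> fr a b c E; pose k (i : 'I_3) := nth 0 [:: a; b; c] i.
have fr' : free [tuple u; v; w] by [].
have K0 : forall i, k i = 0.
  move/freeP: fr'; apply.
  by rewrite !big_ord_recl big_ord0 /k /= addr0 addrA.
by split; [exact: (K0 (Ordinal (isT : 0 < 3)%N))
  | exact: (K0 (Ordinal (isT : 1 < 3)%N)) | exact: (K0 (Ordinal (isT : 2 < 3)%N))].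
Qed.

Lemma free3I : (forall a b c, a *: u + b *: v + c *: w = 0 -> [/\ a = 0, b = 0 & c = 0]) ->
  free [:: u; v; w].
Proof.
move=> H; apply/(@freeP _ _ 3 [tuple u; v; w]) => k.
rewrite !big_ord_recl big_ord0 addr0 /= addrA => /H[k0 k1 k2].
by case=> [[|[|[|]]]] //= p; [move: k0|move: k1|move: k2]; congr (k _ = 0); apply/val_inj.
Qed.

Lemma free3_basis : free [:: u; v; w] -> basis_of fullv [:: u; v; w].
Proof. by move=> fr; rewrite basisEfree fr subvf dimvf. Qed.

Lemma dual3 : free [:: u; v; w] -> exists f g h : {scalar 'rV[K]_3},
  [/\ forall z, z = f z *: u + g z *: v + h z *: w,
      [/\ f u = 1, g u = 0 & h u = 0], [/\ f v = 0, g v = 1 & h v = 0] &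
      [/\ f w = 0, g w = 0 & h w = 1]].
Proof.
move=> fr; have ba : basis_of fullv [tuple u; v; w] by apply: free3_basis.
have fr' : free [tuple u; v; w] by [].
pose c i := coord [tuple u; v; w] i : {scalar 'rV[K]_3}.
exists (c ord0), (c (lift ord0 ord0)), (c (lift ord0 (lift ord0 ord0))).
have ce (i j : 'I_3) : coord [tuple u; v; w] i [tuple u; v; w]`_j = (j == i)%:R.
  exact: coord_free.
have cu i : c i u = (ord0 == i)%:R by apply: (ce i ord0).
have cv i : c i v = (lift ord0 ord0 == i)%:R by apply: (ce i (lift ord0 ord0)).
have cw i : c i w = (lift ord0 (lift ord0 ord0) == i)%:R.
  by apply: (ce i (lift ord0 (lift ord0 ord0))).
split; rewrite ?cu ?cv ?cw // => z.
by rewrite {1}(coord_basis ba (memvf z)) !big_ord_recl big_ord0 addr0 addrA.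
Qed.
End Dual3.

(** * The lemma of tangents *)

Section Segre.
Variables (K : finFieldType) (T : finType) (v : T -> 'rV[K]_3).
Hypotheses (cardT : #|T| = #|K|.+1) (K_odd : odd #|K|).
Hypothesis arc : forall i j k, i != j -> i != k -> j != k -> free [:: v i; v j; v k].

(** Wilson's theorem: divide X^q - X = prod (X - x) by X and evaluate at 0. *)
Lemma prod_units : \prod_(x : K | x != 0) x = -1.
Proof.
have := finField_genPoly K; rewrite (bigD1 0) //= subr0.
have q0 : (0 < #|K|)%N := ltnW (finNzRing_gt1 K).
rewrite -(prednK q0) exprS -[X in _ - X]mulr1 -mulrBr => /(mulfI (negbT (polyX_eq0 K))).
move/(congr1 (fun p => p.[0])); rewrite !hornerE horner_prod expr0n.
have -> : (#|K|.-1 == 0)%N = false by have := finNzRing_gt1 K; case: #|K| => [|[]].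
rewrite sub0r => ->; rewrite [RHS](eq_bigr (fun i => -1 * i)); last first.
  by move=> i _; rewrite hornerXsubC sub0r mulN1r.
rewrite big_split /= prodr_const cardC1 -signr_odd.
have -> : odd #|K|.-1 = false by move: K_odd (finNzRing_gt1 K); case: #|K| => //= n /negPf.
by rewrite expr0 mul1r.
Qed.

Lemma exists_two (i : T) : exists j k : T, [/\ j != i, k != i & j != k].
Proof.
have : (1 < #|[set~ i]|)%N by rewrite cardsC1 cardT /=; apply: finNzRing_gt1.
by case/card_gt1P => j [k []]; rewrite !inE; exists j, k.
Qed.

Lemma arc_comb i j k a b c : i != j -> i != k -> j != k ->
  a *: v i + b *: v j + c *: v k = 0 -> [/\ a = 0, b = 0 & c = 0].
Proof. by move=> ij ik jk; apply: free3P (arc ij ik jk) a b c. Qed.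

Lemma dual_neq0 i j k (c x y : {scalar 'rV[K]_3}) l : i != j -> i != k -> j != k ->
  (forall z, z = c z *: v i + x z *: v j + y z *: v k) -> l != i -> l != k -> x (v l) != 0.
Proof.
move=> ij ik jk E li lk; apply/eqP => z.
have [il kl] : i != l /\ k != l by split; rewrite eq_sym.
have [] := @arc_comb i k l (c (v l)) (y (v l)) (-1) ik il kl.
  by rewrite {3}(E (v l)) z scale0r addr0 scaleN1r subrr.
by move=> _ _ /eqP; rewrite oppr_eq0 oner_eq0.
Qed.

(** The line x = 0 joins [v i] to [v k]. The q - 1 remaining points occupy at most q - 1 of the q
    lines y = t x through [v i], and a free value of t gives the tangent. *)
Lemma tangent i : exists f : {scalar 'rV[K]_3}, f (v i) = 0 /\ forall j, j != i -> f (v j) != 0.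
Proof.
have [j [k [ji ki jk]]] := exists_two i.
have ij : i != j by rewrite eq_sym. have ik : i != k by rewrite eq_sym.
have [c [x [y [E [ci xi yi] [cj xj yj] [ck xk yk]]]]] := dual3 (arc ij ik jk).
have x0 l : l != i -> l != k -> x (v l) != 0 := dual_neq0 ij ik jk E.
pose r l := y (v l) / x (v l); pose J := ~: [set i; k].
have [t Ht] : exists t, t \notin r @: J.
  apply/existsP; rewrite -negb_forall; apply/negP => /forallP H.
  have e : r @: J = [set: K] by apply/setP => t; rewrite H inE.
  have := leq_imset_card r J; rewrite e cardsT leqNgt => /negP; apply.
  have := cardsC [set i; k]; rewrite -/J cards2 ik cardT => e2.
  by rewrite -ltnS -[X in (_ < X)%N]e2 !addSn ltnS.
have a2 : scalar (fun z => y z - t * x z) by move=> a z z'; rewrite !linearD !linearZ /=; ring.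
pose A := GRing.isLinear.Build _ _ _ _ (fun z => y z - t * x z) a2.
pose f : {scalar 'rV[K]_3} := HB.pack (fun z => y z - t * x z) A.
exists f; rewrite /f /=; split; first by rewrite xi yi mulr0 subrr.
move=> l li; case: (eqVneq l k) => [->|lk]; first by rewrite xk yk mulr0 subr0 oner_eq0.
apply: contra Ht; rewrite subr_eq0 => /eqP e; apply/imsetP; exists l.
  by rewrite !inE negb_or li lk.
by rewrite /r e mulfK // x0.
Qed.

Variable f : T -> {scalar 'rV[K]_3}.
Hypothesis fP : forall i, f i (v i) = 0 /\ forall j, j != i -> f i (v j) != 0.

Let fii i : f i (v i) = 0. Proof. by case: (fP i). Qed.
Let fij i j : j != i -> f i (v j) != 0. Proof. by case: (fP i) => _; apply. Qed.

(** Apart from the lines to [v j] and [v k], the lines through [v i] are y = t x with t nonzero. The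
    q - 2 other points and the tangent realise each such t exactly once, and the product of all t is
    -1. *)
Lemma tangent_prod i j k (c x y : {scalar 'rV[K]_3}) : i != j -> i != k -> j != k ->
  (forall z, z = c z *: v i + x z *: v j + y z *: v k) ->
  (\prod_(l in ~: [set i; j; k]) (y (v l) / x (v l))) * (- f i (v j) / f i (v k)) = -1.
Proof.
move=> ij ik jk E; set J := ~: _; pose r l := y (v l) / x (v l).
have JP l : l \in J -> [/\ i != l, j != l & k != l].
  rewrite !inE !negb_or => /andP[/andP[? ?] ?]; split; by rewrite eq_sym.
have x0 l : l \in J -> x (v l) != 0.
  by case/JP => il jl kl; apply: (dual_neq0 ij ik jk E); rewrite eq_sym.
have y0 l : l \in J -> y (v l) != 0.
  case/JP => il jl kl; have kj : k != j by rewrite eq_sym.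
  have E' z : z = c z *: v i + y z *: v k + x z *: v j by rewrite addrAC -E.
  by apply: (dual_neq0 ik ij kj E'); rewrite eq_sym.
have rI : {in J &, injective r}.
  move=> l m Jl Jm e; apply/eqP/negPn/negP => lm.
  have [il _ _] := JP l Jl; have [im _ _] := JP m Jm.
  have ey : y (v l) * x (v m) = y (v m) * x (v l).
    rewrite -[y (v l)](divfK (x0 l Jl)) -/(r l) e /r -[in RHS](divfK (x0 m Jm) (y (v m))).
    by ring.
  have [] := @arc_comb i l m (c (v m) * x (v l) - c (v l) * x (v m)) (x (v m)) (- x (v l)) il im lm.
    rewrite (E (v l)) (E (v m)); apply/rowP => t.
    rewrite !mxE; apply/eqP; rewrite -subr_eq0; apply/eqP.
    transitivity ((y (v l) * x (v m) - y (v m) * x (v l)) * v k 0 t); last first.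
      by rewrite ey subrr mul0r.
    rewrite -!(E (v l)) -!(E (v m)); ring.
  by move=> _ /eqP; rewrite (negPf (x0 m Jm)).
set tau := - f i (v j) / f i (v k).
have fk : f i (v k) != 0 by apply: fij; rewrite eq_sym.
have fj : f i (v j) != 0 by apply: fij; rewrite eq_sym.
have tau0 : tau != 0 by rewrite mulf_neq0 ?oppr_eq0 ?invr_eq0.
have tauJ : tau \notin r @: J.
  apply/imsetP => [[l Jl e]]; have [il _ _] := JP l Jl.
  have : f i (v l) != 0 by apply: fij; rewrite eq_sym.
  rewrite {1}(E (v l)) !linearD !linearZ /= fii mulr0 add0r.
  have -> : y (v l) = tau * x (v l) by rewrite e /r divfK // x0.
  by rewrite /tau; apply/negP; rewrite negbK; apply/eqP; field.
have cJ : #|J| = #|K|.-2.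
  have := cardsC [set i; j; k]; rewrite -/J cardT /= => e.
  have e3 : #|[set i; j; k]| = 3%N.
    by rewrite setUC cardsU1 cards2 ij !inE !negb_or ![k == _]eq_sym ik jk.
  by rewrite e3 in e; case: #|K| e => [|[|n]] // [].
have eU : [set z : K | z != 0] = tau |: r @: J.
  apply/esym/eqP; rewrite eqEcard; apply/andP; split.
    apply/subsetP => z; rewrite !inE => /orP[/eqP->//|/imsetP[l Jl ->]].
    by rewrite mulf_neq0 ?invr_eq0 ?x0 ?y0.
  rewrite cardsU1 tauJ card_in_imset // cJ.
  have -> : #|[set z : K | z != 0]| = #|K|.-1.
    by rewrite -(cardC1 (0 : K)); apply: eq_card => z; rewrite !inE.
  by have := finNzRing_gt1 K; case: #|K| => [|[]].
rewrite -prod_units.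
have -> : \prod_(z : K | z != 0) z = \prod_(z in tau |: r @: J) z.
  by apply: eq_bigl => z; rewrite -eU inE.
by rewrite big_setU1 //= big_imset //= mulrC.
Qed.

(** Multiply [tangent_prod] at the three vertices: every further point contributes (y / x) (z / y)
    (x / z) = 1. *)
Lemma tangents_cyclic i j k : i != j -> i != k -> j != k ->
  f i (v j) * f j (v k) * f k (v i) = f i (v k) * f k (v j) * f j (v i).
Proof.
move=> ij ik jk.
have [ji ki kj] : [/\ j != i, k != i & k != j] by split; rewrite eq_sym.
have [x [y [z [E _ _ _]]]] := dual3 (arc ij ik jk).
have E2 w : w = y w *: v j + z w *: v k + x w *: v i.
  by rewrite {1}(E w); apply/rowP => t; rewrite !mxE; ring.
have E3 w : w = z w *: v k + x w *: v i + y w *: v j.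
  by rewrite {1}(E w); apply/rowP => t; rewrite !mxE; ring.
have := tangent_prod ij ik jk E; have := tangent_prod jk ji ki E2; have := tangent_prod ki kj ij E3.
have -> : [set k; i; j] = [set i; j; k] by apply/setP => l; rewrite !inE -orbA orbC.
have -> : [set j; k; i] = [set i; j; k] by apply/setP => l; rewrite !inE orbC orbA.
set J := ~: _ => H3 H2 H1.
have p1 : \prod_(l in J) (z (v l) / y (v l)) * \prod_(l in J) (x (v l) / z (v l)) *
   \prod_(l in J) (y (v l) / x (v l)) = 1.
  rewrite -!big_split big1 //= => l; rewrite !inE !negb_or => /andP[/andP[li lj] lk].
  have x0 : x (v l) != 0 by apply: (dual_neq0 ki kj ij E3).
  have y0 : y (v l) != 0 by apply: (dual_neq0 ij ik jk E).
  have z0 : z (v l) != 0 by apply: (dual_neq0 jk ji ki E2).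
  by field; rewrite x0 y0 z0.
have [nij nik] := (fij ji, fij ki); have [njk nji] := (fij kj, fij ij).
have [nki nkj] := (fij ik, fij jk).
move: H1 H2 H3 p1.
set A := \prod_(l in J) _; set B := \prod_(l in J) _; set C := \prod_(l in J) _ => H1 H2 H3 p1.
have e : A * B * C * ((- f i (v j) / f i (v k)) * (- f j (v k) / f j (v i)) * (- f k (v i) / f k (v j))) = -1.
  transitivity ((A * (- f i (v j) / f i (v k))) * (B * (- f j (v k) / f j (v i))) * (C * (- f k (v i) / f k (v j)))); first by ring.
  by rewrite H1 H2 H3; ring.
rewrite p1 mul1r in e.
apply/eqP; rewrite -subr_eq0; apply/eqP.
transitivity (- (f i (v k) * f k (v j) * f j (v i)) *
  ((- f i (v j) / f i (v k)) * (- f j (v k) / f j (v i)) * (- f k (v i) / f k (v j)) + 1)).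
  by field; rewrite nik nji nkj.
by rewrite e addNr mulr0.
Qed.

(** The q other points lie on distinct lines through [v i], none of them the tangent, so they
    exhaust the remaining q lines of the pencil; [r] is a parameter on these. *)
Lemma chord i w : f i w != 0 -> exists2 l, l != i & exists a b, v l = a *: v i + b *: w.
Proof.
have [j [k [ji ki jk]]] := exists_two i.
have ij : i != j by rewrite eq_sym. have ik : i != k by rewrite eq_sym.
have [c [x [y [E _ _ _]]]] := dual3 (arc ij ik jk).
have ker z : f i z = 0 -> x z = 0 -> z = c z *: v i.
  move=> fz xz; have : f i z = f i z by [].
  rewrite {2}(E z) !linearD !linearZ /= fii fz xz mulr0 mul0r !add0r => /esym/eqP.
  rewrite mulf_eq0 (negPf (fij ki)) orbF => /eqP yz.
  by rewrite {1}(E z) xz yz !scale0r !addr0.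
pose r l := x (v l) / f i (v l).
have rI : {in [set~ i] &, injective r}.
  move=> l m; rewrite !inE => li mi e; apply/eqP/negPn/negP => lm.
  have [il im] : i != l /\ i != m by split; rewrite eq_sym.
  pose z := f i (v m) *: v l - f i (v l) *: v m.
  have fz : f i z = 0 by rewrite /z linearB !linearZ /= mulrC subrr.
  have xz : x z = 0.
    have xl : x (v l) = x (v m) / f i (v m) * f i (v l) by rewrite -/(r m) -e divfK // fij.
    by rewrite /z linearB !linearZ /= xl; field; apply: fij.
  have [] := @arc_comb i l m (- c z) (f i (v m)) (- f i (v l)) il im lm.
    by rewrite -addrA [X in _ + X](_ : _ = z) ?scaleNr -?ker ?addNr // /z scaleNr.
  by move=> _ /eqP; rewrite (negPf (fij mi)).
move=> fw; have : x w / f i w \in r @: [set~ i].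
  suff -> : r @: [set~ i] = [set: K] by rewrite inE.
  by apply/eqP; rewrite eqEcard subsetT card_in_imset // cardsT cardsC1 cardT leqnn.
case/imsetP => l; rewrite !inE => li e; exists l => //.
pose s := f i (v l) / f i w.
have fs : f i (v l - s *: w) = 0 by rewrite linearB linearZ /= divfK // subrr.
have xs : x (v l - s *: w) = 0.
  have xw : x w = r l * f i w by rewrite -e divfK.
  rewrite linearB linearZ /= xw /s /r.
  by field; rewrite fw (fij li).
exists (c (v l - s *: w)), s; by rewrite -ker // subrK.
Qed.
End Segre.

(** * Ternary quadratic forms *)

Section Sym3.
Variable K : fieldType.
Local Notation i0 := (ord0 : 'I_3).
Local Notation i1 := (lift ord0 ord0 : 'I_3).
Local Notation i2 := (lift ord0 (lift ord0 ord0) : 'I_3).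

Definition sym3 (a00 a11 a22 a01 a02 a12 : K) : 'M[K]_3 :=
  \matrix_(i, j) nth 0 (nth [::] [:: [:: a00; a01; a02]; [:: a01; a11; a12]; [:: a02; a12; a22]] i) j.

Definition row3 (x0 x1 x2 : K) : 'rV[K]_3 := \row_j nth 0 [:: x0; x1; x2] j.

Lemma ord3P (P : 'I_3 -> Prop) : P i0 -> P i1 -> P i2 -> forall i, P i.
Proof.
move=> p0 p1 p2 [[|[|[|]]]] // H; [move: p0|move: p1|move: p2];
  by congr (P _); apply: val_inj.
Qed.

Lemma row3E (x : 'rV[K]_3) : x = row3 (x 0 i0) (x 0 i1) (x 0 i2).
Proof. by apply/rowP; apply: ord3P; rewrite mxE. Qed.

Lemma row3_neq0 x0 x1 x2 : (row3 x0 x1 x2 == 0) = [&& x0 == 0, x1 == 0 & x2 == 0].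
Proof.
apply/eqP/and3P => [/rowP E|[/eqP-> /eqP-> /eqP->]].
  by move: (E i0) (E i1) (E i2); rewrite !mxE /= => -> -> ->; rewrite eqxx.
by apply/rowP; apply: ord3P; rewrite !mxE.
Qed.

Lemma sum_row3 n x0 x1 x2 (e : 3.-tuple 'rV[K]_n) :
  \sum_(i < 3) row3 x0 x1 x2 0 i *: e`_i = x0 *: e`_0 + x1 *: e`_1 + x2 *: e`_2.
Proof. by rewrite !big_ord_recl big_ord0 addr0 !mxE /= addrA. Qed.

Lemma sym3_tr a00 a11 a22 a01 a02 a12 :
  (sym3 a00 a11 a22 a01 a02 a12)^T = sym3 a00 a11 a22 a01 a02 a12.
Proof. by apply/matrixP; apply: ord3P; apply: ord3P; rewrite !mxE. Qed.

Lemma sym3_form a00 a11 a22 a01 a02 a12 x0 x1 x2 (M := sym3 a00 a11 a22 a01 a02 a12)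
    (x := row3 x0 x1 x2) :
  x *m M *m x^T = (a00 * x0 ^+ 2 + a11 * x1 ^+ 2 + a22 * x2 ^+ 2 +
    2%:R * (a01 * x0 * x1 + a02 * x0 * x2 + a12 * x1 * x2))%:M.
Proof.
apply/matrixP => i j; rewrite !ord1 mxE /M /x !big_ord_recl big_ord0.
rewrite !mxE /= !big_ord_recl !big_ord0 !mxE /=; ring.
Qed.

Lemma scalar1_eq0 (c : K) : ((c%:M : 'M_1) = 0) <-> c = 0.
Proof.
split=> [/matrixP/(_ 0 0)|->]; first by rewrite !mxE eqxx mulr1n.
by apply/matrixP => i j; rewrite !mxE mul0rn.
Qed.

Lemma sym3_hollow_unit a b c : (2%:R : K) != 0 -> a != 0 -> b != 0 -> c != 0 ->
  sym3 0 0 0 a b c \in unitmx.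
Proof.
move=> t0 a0 b0 c0; pose d := 2%:R * a * b * c.
have d0 : d != 0 by rewrite !mulf_neq0.
(* The adjugate divided by the determinant 2abc. *)
pose N := sym3 (- c ^+ 2 / d) (- b ^+ 2 / d) (- a ^+ 2 / d) (b * c / d) (a * c / d) (a * b / d).
suff /mulmx1_unit[] : sym3 0 0 0 a b c *m N = 1%:M by [].
apply/matrixP; apply: ord3P; apply: ord3P;
  rewrite !mxE !big_ord_recl big_ord0 !mxE /= /d; field; by rewrite ?t0 ?a0 ?b0 ?c0.
Qed.

(** The Gram matrix of 2 (x1^2 - x0 x2), the form of a parabola completed by its infinite point. *)
Lemma sym3_parabola_unit : (2%:R : K) != 0 -> sym3 0 2%:R 0 0 (-1) 0 \in unitmx.
Proof.
move=> t0; pose N := sym3 0 2%:R^-1 0 0 (-1) (0 : K).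
suff /mulmx1_unit[] : sym3 0 2%:R 0 0 (-1) 0 *m N = 1%:M by [].
apply/matrixP; apply: ord3P; apply: ord3P;
  rewrite !mxE !big_ord_recl big_ord0 !mxE /=; by [ring|field].
Qed.

Lemma vline_eq n (u w : 'rV[K]_n) : u != 0 -> w != 0 -> u \in <[w]>%VS -> (<[u]> = <[w]>)%VS.
Proof.
move=> u0 w0 uw; apply/eqP; rewrite eqEdim -memvE uw !dim_vline u0 w0.
by [].
Qed.
End Sym3.

Section SegreTheorem.
Variables (K : finFieldType) (T : finType) (v : T -> 'rV[K]_3).
Hypotheses (cardT : #|T| = #|K|.+1) (K_odd : odd #|K|).
Hypothesis arc : forall i j k, i != j -> i != k -> j != k -> free [:: v i; v j; v k].

(* After rescaling the tangent forms, [f i (v j)] is symmetric in i and j; the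
   conic is then [\sum x_a x_b f a (v b)] for any three base points. *)
Theorem segre : exists (e : 3.-tuple 'rV[K]_3) (M : 'M[K]_3),
  [/\ basis_of fullv e, M^T = M, M \in unitmx &
      forall P, (exists i, P = <[v i]>%VS) <-> exists x : 'rV[K]_3,
        [/\ x != 0, x *m M *m x^T = 0 & P = <[\sum_(i < 3) x 0 i *: e`_i]>%VS]].
Proof.
have t0 : (2%:R : K) != 0 := two_neq0 K_odd.
have [f' Hf'] := fin_all_exists (tangent cardT arc).
have /card_gt0P[o _] : (0 < #|T|)%N by rewrite cardT.
have [j [k [jo ko jk]]] := exists_two cardT o.
have [oj ok kj] : [/\ o != j, o != k & k != j] by split; rewrite eq_sym.
(* These factors give g o (v i) = g i (v o); [tangents_cyclic] with [o] as third point extends the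
   symmetry to all pairs. *)
pose mu i := if i == o then 1 else f' o (v i) / f' i (v o).
have mu0 i : mu i != 0.
  rewrite /mu; case: (eqVneq i o) => [_|io]; first exact: oner_neq0.
  have [_ H1] := Hf' o; have [_ H2] := Hf' i.
  by rewrite mulf_neq0 ?invr_eq0 ?H1 ?H2 // eq_sym.
pose g i z := mu i * f' i z.
have g0 i : g i (v i) = 0 by rewrite /g (Hf' i).1 mulr0.
have gn i l : l != i -> g i (v l) != 0 by move=> li; rewrite mulf_neq0 ?mu0 // (Hf' i).2.
have gL i a b c (x y z : 'rV[K]_3) : g i (a *: x + b *: y + c *: z) = a * g i x + b * g i y + c * g i z.
  by rewrite /g !linearD !linearZ /=; ring.
have gS i l : g i (v l) = g l (v i).
  case: (eqVneq i l) => [->//|il]; rewrite /g /mu.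
  have [li] : l != i by rewrite eq_sym.
  case: (eqVneq i o) => [io|io]; case: (eqVneq l o) => [lo|lo].
  - by rewrite io lo.
  - by rewrite mul1r io divfK // (Hf' l).2 // eq_sym.
  - by rewrite mul1r lo divfK // (Hf' i).2 // eq_sym.
  have [oi ol] : o != i /\ o != l by split; rewrite eq_sym.
  have := tangents_cyclic cardT K_odd arc Hf' oi ol il.
  have n1 := (Hf' i).2 o oi; have n2 := (Hf' l).2 o ol.
  move=> e; apply: (mulfI n1); apply: (mulfI n2).
  transitivity (f' o (v i) * f' i (v l) * f' l (v o)); first by field; rewrite n1.
  by rewrite e; field; rewrite n2.
have fr := arc oj ok jk.
have [c [x [y [E _ _ _]]]] := dual3 fr.
pose a := g o (v j); pose b := g o (v k); pose d := g j (v k).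
have [a0 b0 d0] : [/\ a != 0, b != 0 & d != 0] by split; apply: gn.
pose q x0 x1 x2 := a * x0 * x1 + b * x0 * x2 + d * x1 * x2.
exists [tuple v o; v j; v k], (sym3 0 0 0 a b d).
split; [exact: free3_basis | exact: sym3_tr | exact: sym3_hollow_unit |].
(* Expanding g l (v l) = 0 in both arguments, the first by symmetry, gives 2 q(x0, x1, x2) = 0. *)
have qv l x0 x1 x2 : v l = x0 *: v o + x1 *: v j + x2 *: v k -> q x0 x1 x2 = 0.
  move=> Ev; have := g0 l; rewrite Ev gL (gS l o) (gS l j) (gS l k) Ev !gL !g0.
  rewrite (gS j o) (gS k o) (gS k j) -/a -/b -/d => H; apply: (mulfI t0).
  by rewrite mulr0 -[RHS]H /q; ring.
move=> P; split=> [[i ->]|[z]].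
  exists (row3 (c (v i)) (x (v i)) (y (v i))); rewrite sum_row3 /= -E; split=> //.
    rewrite row3_neq0; apply/negP => /and3P[/eqP c0 /eqP x0 /eqP y0].
    have vi0 : v i = 0 by rewrite (E (v i)) c0 x0 y0 !scale0r !addr0.
    have [l li] : exists l, l != i.
      by have [l [_ [li _ _]]] := exists_two cardT i; exists l.
    have il : i != l by rewrite eq_sym.
    by have := gn _ _ il; rewrite vi0 /g linear0 mulr0 eqxx.
  rewrite sym3_form; apply/scalar1_eq0; rewrite !mul0r !add0r.
  by rewrite -/(q _ _ _) (qv i) ?mulr0 // -E.
rewrite (row3E z) sum_row3 /= row3_neq0 sym3_form.
set z0 := z 0 _; set z1 := z 0 _; set z2 := z 0 _ => -[zn /scalar1_eq0].
rewrite !mul0r !add0r => /eqP; rewrite mulf_eq0 (negPf t0) /= => /eqP qz ->.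
set w := _ + _ *: v k.
have w0 : w != 0.
  apply: contra zn => /eqP /(free3P fr)[-> -> ->]; by rewrite eqxx.
have vn i : v i != 0.
  have [l [_ [li _ _]]] := exists_two cardT i.
  have il : i != l by rewrite eq_sym.
  by apply: contraNneq (gn _ _ il) => ->; rewrite /g linear0 mulr0.
have gw : g o w = a * z1 + b * z2 by rewrite /w gL g0 mulr0 add0r /a /b; ring.
(* On the tangent at [v o] the form vanishes only at [v o]. Off it, the chord from [v o] through w
   meets the arc again in s [v o] + t w, where the form takes the value t s g o w; hence s = 0. *)
case: (eqVneq (g o w) 0) => [gw0|gwn].
  exists o; apply: vline_eq => //; apply/vlineP; exists z0.
  rewrite gw in gw0.
  have z12 : z1 * z2 = 0.
    apply: (mulfI d0); rewrite mulr0 -[RHS]subr0 -{1}qz -(mulr0 z0) -gw0 /q; ring.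
  have [z10 z20] : z1 = 0 /\ z2 = 0.
    move/eqP: z12; rewrite mulf_eq0 => /orP[/eqP z10|/eqP z20].
      move/eqP: gw0; rewrite z10 mulr0 add0r mulf_eq0 (negPf b0) => /eqP z20; by rewrite z20.
    move/eqP: gw0; rewrite z20 mulr0 addr0 mulf_eq0 (negPf a0) => /eqP z10; by rewrite z10.
  by rewrite /w z10 z20 !scale0r !addr0.
have fw : f' o w != 0 by apply: contraNneq gwn => e; rewrite /g e mulr0.
have [l lo [s [t Ev]]] := chord cardT arc Hf' fw.
have H : q (s + t * z0) (t * z1) (t * z2) = 0.
  by apply: (qv l); rewrite Ev /w; apply/rowP => r; rewrite !mxE; ring.
have tn : t != 0.
  by apply: contraNneq (gn _ _ lo) => e; rewrite Ev e scale0r addr0 /g linearZ /= (Hf' o).1 !mulr0.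
have s0 : s = 0.
  have : t * s * (a * z1 + b * z2) = 0.
    rewrite -[RHS]H -[LHS]addr0 -(mulr0 (t ^+ 2)) -qz /q; ring.
  by rewrite -gw => /eqP; rewrite mulf_eq0 (negPf gwn) orbF mulf_eq0 (negPf tn) => /eqP.
exists l; apply/esym/vline_eq => //; apply/vlineP; exists t.
by rewrite Ev s0 scale0r add0r.
Qed.
End SegreTheorem.

From mathcomp Require Import finmap.
From mathcomp Require Import classical_sets functions.

(** * Spread and infinite points *)

Lemma hyperplane_functional (F : fieldType) n (U : {vspace 'rV[F]_n.+1}) : \dim U = n ->
  exists h : {scalar 'rV[F]_n.+1}, forall v, (v \in U) = (h v == 0).
Proof.
move=> dU; have [u _ uU] : exists2 u, u \in fullv & u \notin U.
  by apply/subvPn; apply/negP => /dimvS; rewrite dimvf /dim /= dU mul1n ltnn.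
pose X := [tuple of u :: vbasis U].
have fX : free X by rewrite free_cons (span_basis (vbasisP U)) uU (basis_free (vbasisP U)).
have bX : basis_of fullv X.
  by rewrite basisEfree fX subvf dimvf /dim /= size_tuple dU mul1n.
exists (coord X ord0 : {scalar _}) => v; apply/idP/eqP => [vU|h0].
  rewrite (coord_vbasis vU) linear_sum big1 // => i _; rewrite linearZ /=.
  have -> : (vbasis U)`_i = X`_(lift ord0 i) by [].
  by rewrite coord_free // mulr0.
rewrite (coord_basis bX (memvf v)) big_ord_recl h0 scale0r add0r.
apply: memv_suml => i _; apply: memvZ; apply: vbasis_mem; apply: mem_nth.
by rewrite size_tuple.
Qed.

Lemma card_fset_im (I : finType) (U : choiceType) (S : {set I}) (f : I -> U) (A : {fset U}) :
  {in S &, injective f} -> (forall x, (x \in A) <-> exists2 i, i \in S & x = f i) ->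
  #|` A|%fset = #|S|.
Proof.
move=> fI HA; have -> : #|` A|%fset = size [seq f i | i <- enum S].
  apply: perm_size; apply: uniq_perm; first exact: fset_uniq.
    by rewrite map_inj_in_uniq ?enum_uniq // => x y; rewrite !mem_enum; apply: fI.
  move=> x; apply/idP/mapP => [/HA[i Si ->]|[i]]; first by exists i; rewrite ?mem_enum.
  by rewrite mem_enum => Si ->; apply/HA; exists i.
by rewrite size_map -cardE.
Qed.

(** * From projective points to vectors *)

Section Configuration.
Variables (F : finFieldType) (Sinf : subspace F 4) (C CP : {fset subspace F 4}).
Hypotheses (q_odd : odd #|F|) (q_ge7 : (7 <= #|F|)%N)
    (card_C : #|` C|%fset = (#|F| ^ 2)%N)
    (C_affine : forall P, P \in C -> is_point P /\ affine Sinf P)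
    (CP_affine : forall pi, pi \in CP -> is_plane pi /\ affine Sinf pi)
    (A1 : axiom_A1 C CP) (A2 : axiom_A2 C CP) (A3 : axiom_A3 Sinf C CP).
Variable h : {scalar 'rV[F]_5}.
Hypothesis hS : forall v, (v \in Sinf) = (h v == 0).
Local Notation V := 'rV[F]_5.

Definition cvec : {set V} := [set v | (h v == 1) && (<[v]>%VS \in C)].
Definition cplane (i : CP) : {vspace V} := fsval i.

Lemma vline_h1_inj (u v : V) : h u = 1 -> h v = 1 -> (<[u]> = <[v]>)%VS -> u = v.
Proof.
move=> hu hv e; have : u \in <[v]>%VS by rewrite -e memv_line.
case/vlineP => k Ek; move: hu; rewrite Ek linearZ /= hv mulr1 => ->.
by rewrite scale1r.
Qed.

Lemma point_vec (P : subspace F 4) : is_point P -> affine Sinf P ->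
  exists2 v : V, h v = 1 & P = <[v]>%VS.
Proof.
move=> /eqP dP aP; have [v] := aff_exists hS aP; rewrite in_aff => /andP[vP /eqP hv].
exists v => //; apply/esym/eqP; rewrite eqEdim -memvE vP dP dim_vline.
by rewrite (h1_neq0 hv).
Qed.

Lemma C_vec P : P \in C -> exists2 v, v \in cvec & P = <[v]>%VS.
Proof.
move=> PC; have [pP aP] := C_affine PC; have [v hv Ev] := point_vec pP aP.
by exists v => //; rewrite inE hv eqxx -Ev.
Qed.

Lemma cvecP v : reflect (h v = 1 /\ <[v]>%VS \in C) (v \in cvec).
Proof. by rewrite inE; apply: (iffP andP) => -[/eqP]. Qed.

Lemma card_cvec_in (U : {vspace V}) :
  #|[set a in cvec | a \in U]| = #|` points_in C U|%fset.
Proof.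
symmetry; apply: (card_fset_im (f := fun v : V => <[v]>%VS)).
  move=> u v; rewrite inE => /andP[/cvecP[hu _] _]; rewrite inE => /andP[/cvecP[hv _] _].
  exact: vline_h1_inj.
move=> P; rewrite !inE /=; split=> [/andP[PC PU]|[v]].
  by have [v vC Ev] := C_vec PC; exists v => //; rewrite inE vC memvE -Ev.
by rewrite inE => /andP[/cvecP[_ vC] vU] ->; rewrite vC -memvE.
Qed.

Lemma configuration_of_axioms : configuration h Sinf cplane cvec.
Proof.
have [A1a A1b] := A1.
have vne (u v : V) : h u = 1 -> h v = 1 -> u != v -> <[u]>%VS != <[v]>%VS.
  by move=> hu hv; apply: contra_neq; apply: vline_h1_inj.
split=> //.
- by move=> [pi Hpi]; have [/eqP] := CP_affine Hpi.
- by move=> [pi Hpi]; have [_] := CP_affine Hpi.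
- by move=> a /cvecP[].
- have <- : #|` points_in C fullv|%fset = (fcard F ^ 2)%N.
    rewrite -card_C; congr #|` _|%fset; apply/fsetP => P.
    by rewrite !inE /= subvf andbT.
  by rewrite -card_cvec_in; apply: eq_card => v; rewrite [RHS]inE memvf andbT.
- by move=> [pi Hpi]; rewrite card_cvec_in; have [_ -> _ _] := A1a _ Hpi.
- move=> [pi Hpi] a b c /cvecP[ha aC] /cvecP[hb bC] /cvecP[hc cC] /= ai bi ci ab ac bc.
  have [_ _ _ H] := A1a _ Hpi.
  have inP x : <[x]>%VS \in C -> x \in pi -> <[x]>%VS \in points_in C pi.
    by move=> xC xi; rewrite !inE /= xC -memvE.
  have := H _ _ _ (inP a aC ai) (inP b bC bi) (inP c cC ci) (vne _ _ ha hb ab) (vne _ _ ha hc ac) (vne _ _ hb hc bc).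
  move=> nc; apply/negP => cab; apply: nc; exists (<[a]> + <[b]>)%VS; split.
  + by rewrite /is_line (dim_aff2 ha hb ab).
  + exact: addvSl.
  + exact: addvSr.
  + by rewrite -memvE.
- move=> U dU c4.
  have UC : U \in CP by apply: A1b; [rewrite /is_plane dU | rewrite -card_cvec_in].
  by exists [` UC]%fset.
- move=> a b /cvecP[ha aC] /cvecP[hb bC] ab.
  have [pi [[piC ai bi] _]] := A2 aC bC (vne _ _ ha hb ab).
  by exists [` piC]%fset; rewrite /cplane /= !memvE ai bi.
- move=> a b [pi Hpi] [pj Hpj] /cvecP[ha aC] /cvecP[hb bC] ab; rewrite /cplane /= => ai bi aj bj.
  have [p [_ H]] := A2 aC bC (vne _ _ ha hb ab).
  apply: val_inj => /=; rewrite -(H pi) ?(H pj) //; split; by rewrite -?memvE.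
- move=> v i hv nv vi.
  have pP : is_point <[v]>%VS by rewrite /is_point dim_vline (h1_neq0 hv).
  have aP : affine Sinf <[v]>%VS by rewrite /affine -memvE hS hv oner_eq0.
  have E : #|` planes_through CP <[v]>%VS|%fset = #|[set j | v \in cplane j]|.
    apply: (card_fset_im (f := cplane)); first by move=> x y _ _; apply: val_inj.
    move=> P; rewrite !inE /=; split=> [/andP[PC vP]|[j]].
      by exists [` PC]%fset => //; rewrite inE memvE.
    by rewrite inE memvE => vj ->; rewrite vj andbT; apply: fsvalP.
  case: (A3 pP aP) => [vC|z|//]; first by case/cvecP: nv.
    have : i \in [set j | v \in cplane j] by rewrite inE.
    have : #|[set j | v \in cplane j]| == 0%N by rewrite -E z.
    by rewrite cards_eq0 => /eqP->; rewrite inE.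
  by move=> e; rewrite -E e.
Qed.
End Configuration.

Lemma dim_span2 (F : fieldType) n (u v : 'rV[F]_n) :
  (forall k l, k *: u + l *: v = 0 -> k = 0 /\ l = 0) -> \dim (<[u]> + <[v]>) = 2%N.
Proof.
move=> H; suff : free [:: u; v] by rewrite /free !span_cons span_nil addv0 => /eqP.
apply/(@freeP _ _ 2 [tuple u; v]) => k.
rewrite !big_ord_recl big_ord0 addr0 /= => /H[k0 k1].
by case=> [[|[|]]] //= p; [move: k0|move: k1]; congr (k _ = 0); apply/val_inj.
Qed.

Lemma mem_span2 (F : fieldType) n (u v z : 'rV[F]_n) :
  reflect (exists k l, z = k *: u + l *: v) (z \in (<[u]> + <[v]>)%VS).
Proof.
apply: (iffP idP) => [|[k [l ->]]]; last by rewrite memv_add ?memvZ ?memv_line.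
by case/memv_addP => _ /vlineP[k ->] [_ /vlineP[l ->] ->]; exists k, l.
Qed.

Lemma point_gen (F : fieldType) n (P : subspace F n) : is_point P ->
  exists2 v, v != 0 & P = <[v]>%VS.
Proof.
move=> /eqP dP; have v0 : vpick P != 0 by rewrite vpick0 -dimv_eq0 dP.
exists (vpick P) => //; apply/esym/eqP; rewrite eqEdim -memvE memv_pick dP dim_vline.
by rewrite v0.
Qed.

Lemma line_of_points_inj (F : fieldType) n (T : set (subspace F n)) (l m : subspace F n) :
  line_of_points T l -> line_of_points T m -> l = m.
Proof.
have sub (l1 l2 : subspace F n) : line_of_points T l1 -> line_of_points T l2 -> (l1 <= l2)%VS.
  move=> [_ El] [_ Em]; apply/subvP => v vl; case: (eqVneq v 0) => [->|v0]; first exact: mem0v.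
  have : T <[v]>%VS by rewrite El /= /is_point dim_vline v0 -memvE.
  by rewrite Em /= => -[_]; rewrite -memvE.
by move=> Hl Hm; apply/eqP; rewrite eqEsubv !sub.
Qed.

(** * The configuration in F x K x K *)

Section Frame.
Variables (F K : finFieldType) (Sinf : subspace F 4) (C CP : {fset subspace F 4}).
Variables (h : {scalar 'rV[F]_5}) (iota : {rmorphism F -> K}) (kap : K)
  (vec : F -> K -> K -> 'rV[F]_5).
Hypotheses (q_odd : odd #|F|) (hS : forall v, (v \in Sinf) = (h v == 0))
  (C_affine : forall P, P \in C -> is_point P /\ affine Sinf P)
  (cf : configuration h Sinf (@cplane F CP) (cvec C h))
  (fr : complex_frame h (cvec C h) iota kap vec).
Local Notation V := 'rV[F]_5.

Let addE := fr_add fr.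
Let scaleE := fr_scale fr.
Let vecI := fr_inj fr.

Definition conic_vec (X : K) : V := vec 1 X (X ^+ 2).
Local Notation pt := conic_vec.
Definition tangent_vec (X D : K) : V := vec 0 D (2%:R * X * D).
Local Notation tg := tangent_vec.
Definition node_vec (D : K) : V := vec 0 0 (D ^+ 2).
Local Notation nd := node_vec.
(** The C-planes correspond to the affine F-lines X + F D of K: [Pl X D] contains the points of C
    over that line ([pt_in_Pl]), and every C-plane arises in this way ([CP_form]). *)
Definition conic_plane (X D : K) : subspace F 4 := (<[pt X]> + <[tg X D]> + <[nd D]>)%VS.
Local Notation Pl := conic_plane.

Lemma two_F : (2%:R : F) != 0. Proof. exact: two_neq0 q_odd. Qed.
Lemma two_K : (2%:R : K) != 0. Proof. by rewrite -(rmorph_nat iota) fmorph_eq0 two_F. Qed.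

Lemma iota_eq0 c : (iota c == 0) = (c == 0). Proof. exact: fmorph_eq0. Qed.

Lemma vec0 : vec 0 0 0 = 0.
Proof. by have := scaleE 0 0 0 0; rewrite scale0r !mulr0 => <-. Qed.

Lemma vec_eq0 a X Y : vec a X Y = 0 -> [/\ a = 0, X = 0 & Y = 0].
Proof. by rewrite -vec0 => /vecI. Qed.

Lemma vec_inf v : v \in Sinf -> exists X Y, v = vec 0 X Y.
Proof.
have [a [X [Y ->]]] := fr_span fr v; rewrite hS (fr_h fr) => /eqP->.
by exists X, Y.
Qed.

Lemma vec_in_inf a X Y : (vec a X Y \in Sinf) = (a == 0).
Proof. by rewrite hS (fr_h fr). Qed.

Lemma PlE k l m X D : k *: pt X + l *: tg X D + m *: nd D =
  vec k (iota k * X + iota l * D) (iota k * X ^+ 2 + iota l * (2%:R * X * D) + iota m * D ^+ 2).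
Proof. by rewrite !scaleE !addE !mulr0 !addr0 mulr1. Qed.

Lemma mem_Pl X D v : reflect (exists k l m, v =
  vec k (iota k * X + iota l * D) (iota k * X ^+ 2 + iota l * (2%:R * X * D) + iota m * D ^+ 2))
  (v \in Pl X D).
Proof.
apply: (iffP (mem_span3 _ _ _ _)) => -[k [l [m ->]]]; exists k, l, m; by rewrite PlE.
Qed.

Lemma Pl_free X D k l m : D != 0 -> k *: pt X + l *: tg X D + m *: nd D = 0 ->
  [/\ k = 0, l = 0 & m = 0].
Proof.
move=> D0; rewrite PlE => /vec_eq0[->]; rewrite rmorph0 !mul0r !add0r.
move/eqP; rewrite mulf_eq0 (negPf D0) orbF iota_eq0 => /eqP->.
rewrite rmorph0 mul0r add0r => /eqP; rewrite mulf_eq0 iota_eq0 sqrf_eq0 (negPf D0) orbF.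
by move/eqP.
Qed.

Lemma Pl_dim X D : D != 0 -> \dim (Pl X D) = 3%N.
Proof. by move=> D0; apply: dim_span3 => k l m; apply: Pl_free. Qed.

Lemma pt_inj X Y : pt X = pt Y -> X = Y.
Proof. by case/vecI. Qed.

Lemma pt_shift X D t : pt (X + iota t * D) = 1 *: pt X + t *: tg X D + t ^+ 2 *: nd D.
Proof. by rewrite PlE /pt !rmorph1 !mul1r rmorphXn; congr vec; ring. Qed.

Lemma pt_in_Pl X D Y : D != 0 -> reflect (exists t, Y = X + iota t * D) (pt Y \in Pl X D).
Proof.
move=> D0; apply: (iffP (mem_Pl _ _ _)) => [[k [l [m /vecI[<- -> _]]]]|[t ->]].
  by exists l; rewrite rmorph1 mul1r.
by exists 1, t, (t ^+ 2); rewrite -PlE pt_shift.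
Qed.

Lemma Pl_shift X D t : D != 0 -> Pl (X + iota t * D) D = Pl X D.
Proof.
move=> D0; apply/eqP; rewrite eqEdim !Pl_dim // leqnn andbT !subv_add -!memvE.
apply/andP; split; first apply/andP; first split.
- by apply/pt_in_Pl => //; exists t.
- apply/mem_Pl; exists 0, 1, (2%:R * t); rewrite /tg rmorph0 rmorph1 rmorphM rmorph_nat.
  congr vec; ring.
- by rewrite memvE addvSr.
Qed.

Lemma CP_Pl X D : D != 0 -> Pl X D \in CP.
Proof.
move=> D0; have [|t u|t|t|i ->] := @plane_of_points _ _ _ _ _ _ cf (Pl X D) (fun t => pt (X + iota t * D)).
- exact: Pl_dim.
- by move/pt_inj/addrI/(mulIf D0)/fmorph_inj.
- exact: fr_cs fr _.
- by apply/pt_in_Pl => //; exists t.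
exact: fsvalP.
Qed.

(** Two points [pt X] and [pt Y] of the plane determine it by (A2), and [Pl X (Y - X)] contains
    both. *)
Lemma CP_form pi : pi \in CP -> exists X D, D != 0 /\ pi = Pl X D.
Proof.
move=> piC; pose i : CP := [` piC]%fset.
have : (1 < #|cblock (@cplane F CP) (cvec C h) i|)%N by rewrite (cblock_card cf); apply: q_gt1 cf.
case/card_gt1P => a [b [ai bi ab]]; move: ai bi; rewrite !in_cblock.
move=> /andP[ca api] /andP[cb bpi].
have [X Ea] := fr_csP fr ca; have [Y Eb] := fr_csP fr cb.
have D0 : Y - X != 0 by rewrite subr_eq0; apply: contraNneq ab => e; rewrite Ea Eb e.
exists X, (Y - X); split=> //.
pose j : CP := [` CP_Pl X D0]%fset.
have aj : a \in cplane j.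
  rewrite /cplane /= Ea -/(pt X); apply/pt_in_Pl => //.
  by exists 0; rewrite rmorph0 mul0r addr0.
have bj : b \in cplane j.
  rewrite /cplane /= Eb -/(pt Y); apply/pt_in_Pl => //.
  by exists 1; rewrite rmorph1 mul1r addrC subrK.
by have := cf_inj cf ca cb ab api bpi aj bj => /(congr1 val).
Qed.

Lemma C_form P : P \in C <-> exists X, P = <[pt X]>%VS.
Proof.
split=> [PC|[X ->]]; last by have /cvecP[] := fr_cs fr X.
have [v /(fr_csP fr)[X ->] ->] := C_vec C_affine hS PC.
by exists X.
Qed.

Lemma vline_pt_inj X Y : (<[pt X]> = <[pt Y]>)%VS -> X = Y.
Proof. by move/vline_h1_inj => /(_ h); rewrite !(fr_h fr) => /(_ erefl erefl)/pt_inj. Qed.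

Lemma points_in_Pl X D P : D != 0 ->
  P \in points_in C (Pl X D) <-> exists t, P = <[pt (X + iota t * D)%R]>%VS.
Proof.
move=> D0; rewrite !inE /=; split.
  move=> /andP[/C_form[Y ->]]; rewrite -memvE => /(pt_in_Pl _ _ D0)[t ->].
  by exists t.
case=> t ->; apply/andP; split; first by apply/C_form; exists (X + iota t * D).
by rewrite -memvE; apply/pt_in_Pl => //; exists t.
Qed.

(* The K-line through [vec 0 U W], of dimension 2 over F. *)
Definition kline (U W : K) : subspace F 4 :=
  (<[vec 0%R U W]> + <[vec 0%R (kap * U)%R (kap * W)%R]>)%VS.
Local Notation ks := kline.

Lemma mem_ks U W v : reflect (exists Z, v = vec 0 (Z * U) (Z * W)) (v \in ks U W).
Proof.
apply: (iffP (mem_span2 _ _ _)) => [[k [l ->]]|[Z ->]].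
  exists (iota k + kap * iota l); rewrite !scaleE addE !mulr0 addr0.
  by congr vec; ring.
have [x [y ->]] := fr_deg fr Z; exists x, y.
by rewrite !scaleE addE !mulr0 addr0; congr vec; ring.
Qed.

Lemma ks_dim U W : (U != 0) || (W != 0) -> \dim (ks U W) = 2%N.
Proof.
move=> UW; apply: dim_span2 => k l; rewrite !scaleE addE => /vec_eq0[_ E1 E2].
apply: (fr_free fr); case/orP: UW => [u|w]; [apply: (mulIf u)|apply: (mulIf w)]; rewrite mul0r.
  by rewrite -E1; ring.
by rewrite -E2; ring.
Qed.

Lemma ks_inf U W : (ks U W <= Sinf)%VS.
Proof. by apply/subvP => v /mem_ks[Z ->]; rewrite vec_in_inf. Qed.

Lemma ks_mem_eq U W U' W' : (U' != 0) || (W' != 0) -> vec 0 U' W' \in ks U W -> ks U' W' = ks U W.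
Proof.
move=> n' /mem_ks[Z /vecI[_ EU EW]].
have Z0 : Z != 0.
  by apply: contraTneq n' => z; rewrite EU EW z !mul0r eqxx.
have n : (U != 0) || (W != 0).
  by apply: contraTT n'; rewrite !negb_or !negbK EU EW => /andP[/eqP-> /eqP->]; rewrite !mulr0 eqxx.
apply/eqP; rewrite eqEdim !ks_dim // leqnn andbT; apply/subvP => v /mem_ks[Z' ->].
by apply/mem_ks; exists (Z' * Z); rewrite EU EW !mulrA.
Qed.

Lemma ks_gen U W : vec 0 U W \in ks U W.
Proof. by apply/mem_ks; exists 1; rewrite !mul1r. Qed.

Lemma point_inf P : is_point P -> (P <= Sinf)%VS ->
  exists U W, ((U != 0) || (W != 0)) /\ P = <[vec 0%R U W]>%VS.
Proof.
move=> /point_gen[v v0 ->]; rewrite -memvE => /vec_inf[U [W Ev]].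
exists U, W; rewrite -Ev; split=> //; apply: contraNT v0.
by rewrite negb_or !negbK Ev => /andP[/eqP-> /eqP->]; rewrite vec0.
Qed.

Lemma vec_neq0 U W : (U != 0) || (W != 0) -> vec 0 U W != 0.
Proof. by apply: contraTneq => /vec_eq0[_ -> ->]; rewrite eqxx. Qed.

End Frame.

Lemma form_quartic (F : finFieldType) (M : 'M[F]_3) (x y z : 'rV[F]_3) :
  (7 <= fcard F)%N ->
  (forall t, (x + t *: y + t ^+ 2 *: z) *m M *m (x + t *: y + t ^+ 2 *: z)^T = 0) ->
  z *m M *m z^T = 0.
Proof.
move=> q7 H; pose B (u w : 'rV[F]_3) := (u *m M *m w^T) 0 0.
have [_ _ _ _ Bz] : [/\ B x x = 0, B x y + B y x = 0, B x z + B y y + B z x = 0,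
    B y z + B z y = 0 & B z z = 0].
  apply: (quartic_zero q7) => t; transitivity (B (x + t *: y + t ^+ 2 *: z) (x + t *: y + t ^+ 2 *: z)).
    have tr : (x + t *: y + t ^+ 2 *: z)^T = x^T + t *: y^T + t ^+ 2 *: z^T.
      by apply/matrixP => i j; rewrite !mxE.
    rewrite /B tr !mulmxDl !mulmxDr -!scalemxAl -?scalemxAl -?scalemxAr -?scalemxAl -?scalemxAr !mxE.
    by ring.
  by rewrite /B H mxE.
by apply/matrixP => i j; rewrite !ord1 [RHS]mxE; exact: Bz.
Qed.

(* Along b0 + t b1 + t^2 b2 the quadratic form is a quartic in t with at least
   seven roots, whose leading coefficient is the value at b2. *)
Lemma conic_through_parabola (F : finFieldType) n (pi : subspace F n)
    (O : set (subspace F n)) (b0 b1 b2 : 'rV[F]_n.+1) : (7 <= fcard F)%N ->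
  is_conic pi O -> b0 \in pi -> b1 \in pi -> b2 \in pi -> b2 != 0 ->
  (forall t, O <[b0 + t *: b1 + t ^+ 2 *: b2]>%VS) -> O <[b2]>%VS.
Proof.
move=> q7 [e [M [be _ _ ->]]] p0 p1 p2 b2n Ht.
pose x v : 'rV[F]_3 := \row_i coord e i v.
have xL a b c u v w : x (a *: u + b *: v + c *: w) = a *: x u + b *: x v + c *: x w.
  by apply/rowP => i; rewrite !mxE !linearD !linearZ.
have fe : free e := basis_free be.
have xE v : v \in pi -> v = \sum_(i < 3) x v 0 i *: e`_i.
  by move=> vp; rewrite {1}(coord_basis be vp); apply: eq_bigr => i _; rewrite mxE.
have xsum (y : 'rV[F]_3) : x (\sum_(i < 3) y 0 i *: e`_i) = y.
  by apply/rowP => i; rewrite mxE coord_sum_free.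
have x0 v : v \in pi -> v != 0 -> x v != 0.
  move=> vp; apply: contraNneq => z; rewrite (xE v vp) z big1 // => i _.
  by rewrite mxE scale0r.
exists (x b2); split; [exact: x0| |by rewrite -xE].
apply: (form_quartic (x := x b0) (y := x b1)) => // t.
set v := b0 + t *: b1 + t ^+ 2 *: b2.
have -> : x b0 + t *: x b1 + t ^+ 2 *: x b2 = x v by rewrite /v -[b0]scale1r xL !scale1r.
have [y [_ yM Ev]] := Ht t; rewrite -/v in Ev.
have : v \in <[\sum_(i < 3) y 0 i *: e`_i]>%VS by rewrite -Ev memv_line.
case/vlineP => k ->.
have -> : x (k *: \sum_(i < 3) y 0 i *: e`_i) = k *: y.
  have := xL k 0 0 (\sum_(i < 3) y 0 i *: e`_i) 0 0.
  by rewrite !scale0r !addr0 => ->; rewrite xsum.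
by rewrite linearZ /= -!scalemxAl -scalemxAr yM !scaler0.
Qed.

(** * Infinite points, tangents and the spread *)

Section Frame.
Variables (F K : finFieldType) (Sinf : subspace F 4) (C CP : {fset subspace F 4}).
Variables (h : {scalar 'rV[F]_5}) (iota : {rmorphism F -> K}) (kap : K)
  (vec : F -> K -> K -> 'rV[F]_5).
Hypotheses (q_odd : odd #|F|) (hS : forall v, (v \in Sinf) = (h v == 0))
  (C_affine : forall P, P \in C -> is_point P /\ affine Sinf P)
  (cf : configuration h Sinf (@cplane F CP) (cvec C h))
  (fr : complex_frame h (cvec C h) iota kap vec).
Local Notation pt := (conic_vec vec).
Local Notation tg := (tangent_vec vec).
Local Notation nd := (node_vec vec).
Local Notation Pl := (conic_plane vec).
Local Notation ks := (kline kap vec).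

Let scaleE := fr_scale fr.
Let vecI := fr_inj fr.
Let vec0 := vec0 fr.
Let t0 : (2%:R : F) != 0 := two_F q_odd.
Let tK : (2%:R : K) != 0 := two_K iota q_odd.

Lemma pt_in X D : pt X \in Pl X D.
Proof. by rewrite memvE /Pl -addvA addvSl. Qed.
Lemma tg_in X D : tg X D \in Pl X D.
Proof. by rewrite memvE; apply: subv_trans (addvSl _ _); apply: addvSr. Qed.
Lemma nd_in X D : nd D \in Pl X D.
Proof. by rewrite memvE /Pl addvSr. Qed.

Lemma nd_neq0 D : D != 0 -> nd D != 0.
Proof. by move=> D0; apply: (vec_neq0 fr); rewrite sqrf_eq0 D0 orbT. Qed.
Lemma tg_neq0 X D : D != 0 -> tg X D != 0.
Proof. by move=> D0; apply: (vec_neq0 fr); rewrite D0. Qed.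
Lemma pt_neq0 X : pt X != 0.
Proof. by apply/eqP => /(vec_eq0 fr)[/eqP]; rewrite oner_eq0. Qed.

Lemma pt_notin X : pt X \notin Sinf.
Proof. by rewrite (vec_in_inf hS fr) oner_eq0. Qed.

Lemma nd_notC D : <[nd D]>%VS \notin C.
Proof.
apply/negP => /(C_form hS C_affine fr)[X e]; have := pt_notin X.
have : pt X \in <[nd D]>%VS by rewrite e memv_line.
by case/vlineP => k ->; rewrite memvZ // (vec_in_inf hS fr).
Qed.

Lemma Pl_basis X D : D != 0 -> basis_of (Pl X D) [tuple pt X; tg X D; nd D].
Proof.
move=> D0; rewrite basisEdim (Pl_dim fr) // andbT.
by rewrite !span_cons span_nil addv0 addvA.
Qed.

(** A conic through all the points [pt (X + iota t * D)] contains [nd D] as well, by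
    [conic_through_parabola]; as this point is not in C, it is [N]. Conversely, in the basis [pt X],
    [tg X D], [nd D] the arc and this point form the conic x1^2 = x0 x2. *)
Lemma infty_point_Pl X D N : D != 0 -> infty_point_of C (Pl X D) N <-> N = <[nd D]>%VS.
Proof.
move=> D0; split=> [H|->].
  have : completed_arc C (Pl X D) N <[nd D]>%VS.
    apply: (conic_through_parabola (cf_q cf) H (pt_in X D) (tg_in X D) (nd_in X D) (nd_neq0 D0)) => t.
    left; apply/(points_in_Pl hS C_affine fr _ _ D0); exists t.
    by rewrite (pt_shift fr) scale1r.
  case=> [|-> //] /=; rewrite !inE /= => /andP[].
  by rewrite (negPf (nd_notC D)).
exists [tuple pt X; tg X D; nd D], (sym3 0 2%:R 0 0 (-1) 0); split.
- exact: Pl_basis.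
- exact: sym3_tr.
- exact: sym3_parabola_unit.
apply/seteqP; split=> P /=.
  case=> [/(points_in_Pl hS C_affine fr _ _ D0)[t ->]|->].
    exists (row3 1 t (t ^+ 2)); rewrite row3_neq0 oner_eq0 sum_row3 /= sym3_form (pt_shift fr); split=> //.
    by apply/scalar1_eq0; ring.
  exists (row3 0 0 1); rewrite row3_neq0 oner_eq0 !andbF sum_row3 /= sym3_form; split=> //.
    by apply/scalar1_eq0; ring.
  by rewrite !scale0r !add0r scale1r.
case=> x; rewrite (row3E x) row3_neq0 sym3_form sum_row3 /=.
set x0 := x 0 _; set x1 := x 0 _; set x2 := x 0 _ => -[xn /scalar1_eq0 q0 ->].
have {}q0 : x1 ^+ 2 = x0 * x2.
  by apply: (mulfI t0); apply/eqP; rewrite -subr_eq0 -[X in _ == X]q0; apply/eqP; ring.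
case: (eqVneq x0 0) => [z|n0].
  have x10 : x1 = 0 by apply/eqP; rewrite -sqrf_eq0 q0 z mul0r.
  rewrite z x10 eqxx /= in xn; right; rewrite z x10 !scale0r !add0r.
  apply: vline_eq; rewrite ?nd_neq0 // ?scaler_eq0 ?negb_or ?xn ?nd_neq0 //.
  by apply/vlineP; exists x2.
left; apply/(points_in_Pl hS C_affine fr _ _ D0); exists (x1 / x0).
have e : x0 *: pt X + x1 *: tg X D + x2 *: nd D = x0 *: pt (X + iota (x1 / x0) * D).
  rewrite (pt_shift fr) !scalerDr !scalerA mulr1 mulrCA divff // mulr1; congr (_ + _ *: _).
  by rewrite expr_div_n q0; field.
rewrite e; apply: vline_eq; rewrite ?scaler_eq0 ?negb_or ?n0 ?pt_neq0 //.
by apply/vlineP; exists x0.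
Qed.

(** A line of the plane through [pt X] has an infinite point s tg + m nd. If s = 0 it contains
    [nd D]; if s and m are nonzero it meets the arc again at parameter m / s. So m = 0 on a
    tangent. *)
Lemma tangent_point_Pl X D Y : D != 0 ->
  tangent_point Sinf C <[pt X]>%VS (Pl X D) Y <-> Y = <[tg X D]>%VS.
Proof.
move=> D0; split; last first.
  move=> ->; exists <[nd D]>%VS, (<[pt X]> + <[tg X D]>)%VS; split.
  - exact/infty_point_Pl.
  - split.
    + rewrite /is_line (dim_line2 (h := h)) ?tg_neq0 // (fr_h fr) //.
    + by rewrite subv_add -!memvE pt_in tg_in.
    apply/seteqP; split=> P /=; last first.
      move=> ->; split; last exact: addvSl.
      left; apply/(points_in_Pl hS C_affine fr _ _ D0); exists 0.
      by rewrite rmorph0 mul0r addr0.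
    case=> [[/(points_in_Pl hS C_affine fr _ _ D0)[t ->]|->]]; rewrite -memvE => /mem_span2[k [l]].
      rewrite (pt_shift fr) => E.
      have [_ _ t2] : [/\ 1 - k = 0, t - l = 0 & t ^+ 2 = 0].
        apply: (Pl_free fr (X := X) D0); rewrite !scalerBl.
        transitivity (1 *: pt X + t *: tg X D + t ^+ 2 *: nd D - (k *: pt X + l *: tg X D)).
          by apply/rowP => i; rewrite !mxE; ring.
        by rewrite E subrr.
      move/eqP: t2; rewrite sqrf_eq0 => /eqP t00.
      by rewrite t00 expr0n !scale0r !addr0 scale1r.
    move=> E; have [_ _ /eqP] : [/\ - k = 0, - l = 0 & 1 = 0 :> F].
      apply: (Pl_free fr (X := X) D0).
      by rewrite scale1r E !scaleNr; apply/rowP => i; rewrite !mxE; ring.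
    by rewrite oner_eq0.
  apply/vspaceP => v; rewrite memv_cap; apply/idP/andP => [/vlineP[k ->]|[/mem_span2[k [l ->]]]].
    split; first by rewrite memvZ // memvE addvSr.
    by rewrite memvZ // (vec_in_inf hS fr).
  rewrite hS linearD !linearZ /= !(fr_h fr) mulr1 mulr0 addr0 => /eqP->.
  by rewrite scale0r add0r memvZ // memv_line.
case=> N [l [/(infty_point_Pl _ _ D0) -> [/eqP dl lP El] ->]].
have inO P : completed_arc C (Pl X D) <[nd D]>%VS P -> (P <= l)%VS -> P = <[pt X]>%VS.
  by move=> H1 H2; have : [set <[pt X]>%VS]%classic P by rewrite -El.
have ptl : pt X \in l.
  have : [set <[pt X]>%VS]%classic <[pt X]>%VS by [].
  by rewrite -El => -[_] /=; rewrite -memvE.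
have lS : ~~ (l <= Sinf)%VS by apply/subvPn; exists (pt X); rewrite ?pt_notin.
have /point_gen[w w0 Ew] : is_point (l :&: Sinf)%VS by rewrite /is_point (dim_capS hS) // dl.
have : w \in (l :&: Sinf)%VS by rewrite Ew memv_line.
rewrite memv_cap => /andP[wl wS].
have /(mem_span3 _ _ _ _)[k [s [m Ek]]] := subvP lP _ wl.
have k0 : k = 0.
  move: wS; rewrite Ek (PlE fr) (vec_in_inf hS fr) => /eqP //.
rewrite k0 scale0r add0r in Ek.
case: (eqVneq s 0) => [s0|s0].
  have m0 : m != 0 by apply: contraNneq w0 => z; rewrite Ek s0 z !scale0r addr0.
  have ndl : nd D \in l.
    by rewrite -[nd D](scalerK m0) memvZ //; move: wl; rewrite Ek s0 scale0r add0r.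
  have e : <[nd D]>%VS = <[pt X]>%VS by apply: inO; [right | rewrite -memvE].
  have := nd_notC D; rewrite e; case/negP.
  by apply/(C_form hS C_affine fr); exists X.
case: (eqVneq m 0) => [m0|m0].
  rewrite Ew Ek m0 scale0r addr0; apply: vline_eq; rewrite ?scaler_eq0 ?negb_or ?s0 ?tg_neq0 //.
  by apply/vlineP; exists s.
have ql : pt (X + iota (m / s) * D) \in l.
  have -> : pt (X + iota (m / s) * D) = pt X + (m / s ^+ 2) *: w.
    rewrite (pt_shift fr) scale1r Ek scalerDr !scalerA addrA; congr (_ + _ *: _ + _ *: _); by field.
  by rewrite memvD ?memvZ.
have := inO <[pt (X + iota (m / s) * D)%R]>%VS; rewrite -memvE => /(_ _ ql) H.
have : X + iota (m / s) * D = X.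
  apply: (vline_pt_inj fr); apply: H; left.
  by apply/(points_in_Pl hS C_affine fr _ _ D0); exists (m / s).
move/eqP; rewrite -subr_eq0 addrC addKr mulf_eq0 (negPf D0) orbF (iota_eq0 iota) => /eqP ms.
by move: m0; rewrite -[m](divfK s0) ms mul0r eqxx.
Qed.

(** The vectors (0, D, 2XD) are the K-multiples of (0, 1, 2X). *)
Lemma t_of_line X : line_of_points (t_of Sinf C CP <[pt X]>%VS) (ks 1 (2%:R * X)).
Proof.
have n1 : ((1 : K) != 0) || (2%:R * X != 0) by rewrite oner_neq0.
split; first by rewrite /is_line (ks_dim fr).
apply/seteqP; split=> P /=.
  case=> pi [/(CP_form cf fr)[X0 [D [D0 ->]]]]; rewrite -memvE => /(pt_in_Pl fr _ _ D0)[t Xt].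
  rewrite -(Pl_shift fr X0 t D0) -Xt => /(tangent_point_Pl _ _ D0) ->; split.
    by rewrite /is_point dim_vline tg_neq0.
  rewrite -memvE; apply/(mem_ks fr); exists D; rewrite /tg mulr1; congr vec; ring.
case=> /point_gen[v v0 ->]; rewrite -memvE => /(mem_ks fr)[Z Ev].
have Z0 : Z != 0 by apply: contraNneq v0 => z; rewrite Ev z !mul0r vec0.
exists (Pl X Z); split; first exact: CP_Pl cf fr _ _ Z0.
  by rewrite -memvE pt_in.
apply/(tangent_point_Pl _ _ Z0); rewrite Ev /tg mulr1; congr (<[vec _ _ _]>%VS); ring.
Qed.

(** A point (0, U, W) with U nonzero is a tangent direction, so it is on a C-line and is not a
    0-point. A point (0, 0, Y) is on a C-plane only as the infinite point of that plane; if it is on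
    none, it is a 0-point. *)
Lemma t_infty_line : line_of_points (t_infty Sinf C CP) (ks 0 1).
Proof.
have n1 : ((0 : K) != 0) || ((1 : K) != 0) by rewrite oner_neq0 orbT.
split; first by rewrite /is_line (ks_dim fr).
apply/seteqP; split=> P /=.
  case=> [[pi /(CP_form cf fr)[X [D [D0 ->]]] /(infty_point_Pl _ _ D0) ->]|[pP PS Hz]].
    split; first by rewrite /is_point dim_vline nd_neq0.
    by rewrite -memvE; apply/(mem_ks fr); exists (D ^+ 2); rewrite mulr0 mulr1.
  have [U [W [n Ew]]] := point_inf hS fr pP PS; split=> //; rewrite Ew -memvE.
  case: (eqVneq U 0) => [->|U0]; first by apply/(mem_ks fr); exists W; rewrite mulr0 mulr1.
  have := Hz _ (CP_Pl cf fr (W / (2%:R * U)) U0); case/negP.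
  rewrite subv_cap PS andbT Ew -memvE.
  have -> : vec 0 U W = tg (W / (2%:R * U)) U.
    by rewrite /tg; congr vec; field; rewrite tK U0.
  exact: tg_in.
case=> pP; move: (pP) => /point_gen[v v0 EP]; rewrite EP -memvE => /(mem_ks fr)[Y Ev].
rewrite mulr0 mulr1 in Ev.
case: (pselect (zero_point Sinf CP P)) => [H|H]; first by right; rewrite -EP.
left; have PS : (P <= Sinf)%VS by rewrite EP -memvE Ev (vec_in_inf hS fr).
have [pi piC Ppi] : exists2 pi, pi \in CP & (P <= pi :&: Sinf)%VS.
  apply: contrapT => Hn; apply: H; split=> // pi piC; apply/negP => Hp; apply: Hn.
  by exists pi.
exists pi => //; have [X [D [D0 Epi]]] := CP_form cf fr piC.
move: Ppi; rewrite Epi subv_cap EP -memvE Ev => /andP[/(mem_Pl fr)[k [l [m /vecI[<- E1 EY]]]] _].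
move: E1 EY; rewrite rmorph0 !mul0r !add0r => /esym/eqP.
rewrite mulf_eq0 (negPf D0) orbF (iota_eq0 iota) => /eqP ->.
rewrite rmorph0 mul0r add0r => EY; apply/(infty_point_Pl _ _ D0).
have Em : vec 0 0 Y = m *: nd D by rewrite scaleE EY !mulr0.
rewrite Em; apply: vline_eq; rewrite ?nd_neq0 //; first by rewrite -Em -Ev.
by apply/vlineP; exists m.
Qed.

(** For U nonzero the slope W / U equals 2X for X = W / (2U), so the K-line is that of the tangents
    at X; U = 0 gives the line of infinite points and 0-points. *)
Lemma spread_ofP l : spread_of Sinf C CP l <->
  exists U W, ((U != 0) || (W != 0)) /\ l = ks U W.
Proof.
split.
  case=> [[P /(C_form hS C_affine fr)[X ->] Hl]|Hl].
    exists 1, (2%:R * X); rewrite oner_neq0; split=> //.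
    exact: line_of_points_inj Hl (t_of_line X).
  exists 0, 1; rewrite oner_neq0 orbT; split=> //.
  exact: line_of_points_inj Hl t_infty_line.
case=> U [W [n ->]]; case: (eqVneq U 0) => [U0|U0].
  right; have -> : ks U W = ks 0 1; last exact: t_infty_line.
  apply: (ks_mem_eq fr n); apply/(mem_ks fr); exists W; by rewrite mulr0 mulr1 U0.
left; exists <[pt (W / U / 2%:R)%R]>%VS; first by apply/(C_form hS C_affine fr); eexists.
have -> : ks U W = ks 1 (2%:R * (W / U / 2%:R)); last exact: t_of_line.
apply: (ks_mem_eq fr n); apply/(mem_ks fr); exists U; rewrite mulr1; congr vec.
by field; rewrite tK U0.
Qed.

End Frame.

(** A set closed under the vector operations is its own span; this makes a subspace of
    [theta_set]. *)
Lemma mem_span_finset (F : finFieldType) n (A : {set 'rV[F]_n}) :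
  0 \in A -> {in A &, forall u v, u + v \in A} -> (forall k, {in A, forall u, k *: u \in A}) ->
  forall v, (v \in <<enum A>>%VS) = (v \in A).
Proof.
move=> A0 AD AZ v; apply/idP/idP => [|vA]; last by rewrite memv_span // mem_enum.
move/(coord_span (X := in_tuple (enum A))) => ->.
apply: (big_ind (fun w => w \in A)) => // i _.
apply: AZ; rewrite -mem_enum; apply: mem_nth; exact: ltn_ord.
Qed.

(** * Regularity of the spread *)

Section Frame.
Variables (F K : finFieldType) (Sinf : subspace F 4) (C CP : {fset subspace F 4}).
Variables (h : {scalar 'rV[F]_5}) (iota : {rmorphism F -> K}) (kap : K)
  (vec : F -> K -> K -> 'rV[F]_5).
Hypotheses (q_odd : odd #|F|) (hS : forall v, (v \in Sinf) = (h v == 0))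
  (C_affine : forall P, P \in C -> is_point P /\ affine Sinf P)
  (cf : configuration h Sinf (@cplane F CP) (cvec C h))
  (fr : complex_frame h (cvec C h) iota kap vec)
  (dSinf : \dim Sinf = 4%N) (cardK : #|K| = (#|F| ^ 2)%N).
Local Notation V := 'rV[F]_5.
Local Notation ks := (kline kap vec).
Local Notation Sp := (spread_of Sinf C CP).

Let addE := fr_add fr.
Let scaleE := fr_scale fr.
Let vecI := fr_inj fr.
Let vec0 := vec0 fr.
Let SpP := spread_ofP q_odd hS C_affine cf fr.

Lemma spread : is_spread Sinf Sp.
Proof.
split=> [l /SpP[U [W [n ->]]]|P pP PS].
  by rewrite /is_line (ks_dim fr n) (ks_inf hS fr).
have [U [W [n ->]]] := point_inf hS fr pP PS.
exists (ks U W); split.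
  by split; [apply/SpP; exists U, W | rewrite -memvE; apply: (ks_gen fr)].
by move=> l [/SpP[U' [W' [_ ->]]]]; rewrite -memvE => /(ks_mem_eq fr n).
Qed.

Lemma meets_ks (m : subspace F 4) U W v : v != 0 -> v \in m -> v \in ks U W -> Defs.meets m (ks U W).
Proof.
move=> v0 vm vk; exists <[v]>%VS; split; rewrite -?memvE //.
by rewrite /is_point dim_vline v0.
Qed.

(* The transversals of the K-lines of u, w, u + w are the F-lines <Z u, Z w>; an
   F-line meeting those for Z = 1, kap, 1 + kap is a K-line. *)
Lemma regulus_ks U1 W1 U2 W2 l : U1 * W2 - U2 * W1 != 0 ->
  regulus Sinf (ks U1 W1) (ks U2 W2) (ks (U1 + U2) (W1 + W2)) l -> Sp l.
Proof.
move=> d0 [/eqP dl lS Hl].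
have indep a b : a * U1 + b * U2 = 0 -> a * W1 + b * W2 = 0 -> a = 0 /\ b = 0.
  move=> E1 E2; split; apply: (mulIf d0); rewrite mul0r.
    transitivity ((a * U1 + b * U2) * W2 - (a * W1 + b * W2) * U2); first by ring.
    by rewrite E1 E2; ring.
  transitivity ((a * W1 + b * W2) * U1 - (a * U1 + b * U2) * W1); first by ring.
  by rewrite E1 E2; ring.
pose v Z a b : V := vec 0 (Z * (iota a * U1 + iota b * U2)) (Z * (iota a * W1 + iota b * W2)).
have vE Z a b : v Z a b = a *: vec 0 (Z * U1) (Z * W1) + b *: vec 0 (Z * U2) (Z * W2).
  by rewrite !scaleE addE !mulr0 addr0; congr vec; ring.
have v_eq0 Z a b : Z != 0 -> v Z a b = 0 -> a = 0 /\ b = 0.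
  move=> Z0 /(vec_eq0 fr)[_ /eqP + /eqP]; rewrite !mulf_eq0 (negPf Z0) /= => /eqP E1 /eqP E2.
  have [/eqP + /eqP] := indep _ _ E1 E2.
  by rewrite !(iota_eq0 iota) => /eqP-> /eqP->.
have trans Z : Z != 0 -> exists a b, v Z a b \in l /\ v Z a b != 0.
  move=> Z0; pose m : subspace F 4 := (<[vec 0%R (Z * U1)%R (Z * W1)%R]> + <[vec 0%R (Z * U2)%R (Z * W2)%R]>)%VS.
  have mP w : reflect (exists a b, w = v Z a b) (w \in m).
    by apply: (iffP (mem_span2 _ _ _)) => -[a [b ->]]; exists a, b; rewrite vE.
  have mL : is_line m.
    by rewrite /is_line; apply/eqP/dim_span2 => a b; rewrite -vE; apply: v_eq0.
  have mS : (m <= Sinf)%VS by apply/subvP => w /mP[a [b ->]]; rewrite (vec_in_inf hS fr).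
  have key a b U W : (a != 0) || (b != 0) -> U = iota a * U1 + iota b * U2 ->
      W = iota a * W1 + iota b * W2 -> Defs.meets m (ks U W).
    move=> ab -> ->; apply: (@meets_ks _ _ _ (v Z a b)).
    - by apply: contraTneq ab => /(v_eq0 _ _ _ Z0)[-> ->]; rewrite eqxx.
    - by apply/mP; exists a, b.
    - by apply/(mem_ks fr); exists Z.
  have [P [/point_gen[w w0 ->]]] : Defs.meets m l.
    apply: Hl => //.
    - by apply: (key 1 0); rewrite ?oner_neq0 // rmorph1 rmorph0; ring.
    - by apply: (key 0 1); rewrite ?oner_neq0 ?orbT // rmorph1 rmorph0; ring.
    - by apply: (key 1 1); rewrite ?oner_neq0 // rmorph1; ring.
  rewrite -!memvE => /mP[a [b Ew]] wl; exists a, b; by rewrite -Ew.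
have kfree x y x' y' : iota x + kap * iota y = iota x' + kap * iota y' -> x = x' /\ y = y'.
  move=> e; have [/eqP + /eqP] : x - x' = 0 /\ y - y' = 0.
    apply: (fr_free fr); rewrite !rmorphB.
    transitivity (iota x + kap * iota y - (iota x' + kap * iota y')); first by ring.
    by rewrite e subrr.
  by rewrite !subr_eq0 => /eqP-> /eqP->.
have kap0 : kap != 0.
  apply/eqP => z; have [_ /eqP] : (0 : F) = 0 /\ (1 : F) = 0.
    by apply: kfree; rewrite z !mul0r.
  by rewrite oner_eq0.
have kap1 : 1 + kap != 0.
  apply/eqP => z; have [/eqP] : (1 : F) = 0 /\ (1 : F) = 0.
    by apply: kfree; rewrite rmorph1 rmorph0 mulr1 mulr0 addr0.
  by rewrite oner_eq0.
have [a0 [b0 [l0 n0]]] := trans 1 (oner_neq0 _).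
have [a1 [b1 [l1 n1]]] := trans kap kap0.
have [a [b [l2 n2]]] := trans _ kap1.
have comb s t : s *: v 1 a0 b0 + t *: v kap a1 b1 =
   vec 0 ((iota (s * a0) + kap * iota (t * a1)) * U1 + (iota (s * b0) + kap * iota (t * b1)) * U2)
         ((iota (s * a0) + kap * iota (t * a1)) * W1 + (iota (s * b0) + kap * iota (t * b1)) * W2).
  by rewrite !scaleE addE !mulr0 addr0; congr vec; rewrite !rmorphM; ring.
have ab_neq Z x y s : v Z x y != 0 -> s * x = 0 -> s * y = 0 -> s = 0.
  move=> H Ex Ey; apply/eqP; apply: contraNT H => s0.
  have -> : x = 0 by apply: (mulfI s0); rewrite mulr0.
  have -> : y = 0 by apply: (mulfI s0); rewrite mulr0.
  by rewrite vE !scale0r addr0.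
have ind s t : s *: v 1 a0 b0 + t *: v kap a1 b1 = 0 -> s = 0 /\ t = 0.
  rewrite comb => /(vec_eq0 fr)[_ E1 E2]; have [F1 F2] := indep _ _ E1 E2.
  have [s1 t1] := fr_free fr F1; have [s2 t2] := fr_free fr F2.
  by split; [apply: ab_neq n0 s1 s2 | apply: ab_neq n1 t1 t2].
have El : l = (<[v 1%R a0 b0]> + <[v kap a1 b1]>)%VS.
  by apply/esym/eqP; rewrite eqEdim dl (dim_span2 ind) subv_add -!memvE l0 l1.
have := l2; rewrite {1}El => /mem_span2[s [t]]; rewrite comb => /vecI[_ E1 E2].
(* The vectors of [l] on the three transversals are dependent. Comparing the coefficients of 1 and
   kap gives (a, b) = s (a0, b0) = t (a1, b1), so the three lie on one K-line. *)
have [F1 F2] : (1 + kap) * iota a - (iota (s * a0) + kap * iota (t * a1)) = 0 /\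
               (1 + kap) * iota b - (iota (s * b0) + kap * iota (t * b1)) = 0.
  apply: indep.
    transitivity ((1 + kap) * (iota a * U1 + iota b * U2) - ((iota (s * a0) + kap * iota (t * a1)) * U1 +
       (iota (s * b0) + kap * iota (t * b1)) * U2)); first by ring.
    by rewrite E1 subrr.
  transitivity ((1 + kap) * (iota a * W1 + iota b * W2) - ((iota (s * a0) + kap * iota (t * a1)) * W1 +
     (iota (s * b0) + kap * iota (t * b1)) * W2)); first by ring.
  by rewrite E2 subrr.
have [as0 at1] : a = s * a0 /\ a = t * a1.
  by apply: kfree; apply/eqP; rewrite -subr_eq0 -F1; apply/eqP; ring.
have [bs0 bt1] : b = s * b0 /\ b = t * b1.
  by apply: kfree; apply/eqP; rewrite -subr_eq0 -F2; apply/eqP; ring.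
apply/SpP; exists (iota a * U1 + iota b * U2), (iota a * W1 + iota b * W2).
have nz : (iota a * U1 + iota b * U2 != 0) || (iota a * W1 + iota b * W2 != 0).
  apply: contraNT n2; rewrite negb_or !negbK => /andP[/eqP z1 /eqP z2].
  by rewrite /v z1 z2 !mulr0 vec0.
split=> //; apply/esym/eqP; rewrite eqEdim (ks_dim fr nz) dl leqnn andbT El subv_add -!memvE.
apply/andP; split; apply/mem_span2.
  by exists s, 0; rewrite scale0r addr0 scaleE mulr0 as0 bs0 !rmorphM; congr vec; ring.
by exists 0, t; rewrite scale0r add0r scaleE mulr0 at1 bt1 !rmorphM; congr vec; ring.
Qed.

Lemma ks_neq U1 W1 U2 W2 : (U1 != 0) || (W1 != 0) -> (U2 != 0) || (W2 != 0) ->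
  ks U1 W1 != ks U2 W2 -> U1 * W2 - U2 * W1 != 0.
Proof.
move=> n1 n2; apply: contraNN; rewrite subr_eq0 => /eqP e; apply/eqP/esym.
apply: (ks_mem_eq fr n2); apply/(mem_ks fr).
case: (eqVneq U1 0) n1 => [z1|u1 _] /= => [w1|].
  have U20 : U2 = 0 by apply: (mulIf w1); rewrite mul0r -e z1 mul0r.
  by exists (W2 / W1); rewrite divfK // U20 z1 mulr0.
exists (U2 / U1); rewrite divfK //; congr vec; apply: (mulfI u1).
by rewrite e mulrA mulrCA divff ?mulr1.
Qed.

Lemma regular_spread : is_regular_spread Sinf Sp.
Proof.
split; first exact: spread.
move=> l1 l2 l3 /SpP[U1 [W1 [n1 ->]]] /SpP[U2 [W2 [n2 ->]]] /SpP[U3 [W3 [n3 ->]]].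
move=> ne12 ne13 ne23; have d0 := ks_neq n1 n2 ne12.
set d := U1 * W2 - U2 * W1 in d0.
(* Cramer's rule. Absorbing al and be into the generators makes the third line that of their sum, as
   [regulus_ks] requires. *)
pose al := (U3 * W2 - W3 * U2) / d; pose be := (U1 * W3 - W1 * U3) / d.
have EU : U3 = al * U1 + be * U2 by rewrite /al /be /d; field.
have EW : W3 = al * W1 + be * W2 by rewrite /al /be /d; field.
have al0 : al != 0.
  apply: contraNneq ne23 => z; apply/eqP/esym/(ks_mem_eq fr n3)/(mem_ks fr).
  by exists be; rewrite EU EW z !mul0r !add0r.
have be0 : be != 0.
  apply: contraNneq ne13 => z; apply/eqP/esym/(ks_mem_eq fr n3)/(mem_ks fr).
  by exists al; rewrite EU EW z !mul0r !addr0.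
have n1' : (al * U1 != 0) || (al * W1 != 0) by rewrite mulf_eq0 (negPf al0) mulf_eq0 (negPf al0).
have n2' : (be * U2 != 0) || (be * W2 != 0) by rewrite mulf_eq0 (negPf be0) mulf_eq0 (negPf be0).
have <- : ks (al * U1) (al * W1) = ks U1 W1.
  by apply: (ks_mem_eq fr n1'); apply/(mem_ks fr); exists al.
have <- : ks (be * U2) (be * W2) = ks U2 W2.
  by apply: (ks_mem_eq fr n2'); apply/(mem_ks fr); exists be.
rewrite EU EW => l; apply: regulus_ks.
have -> : al * U1 * (be * W2) - be * U2 * (al * W1) = al * be * d by rewrite /d; ring.
by apply: mulf_neq0 => //; apply: mulf_neq0.
Qed.

End Frame.

(** * Bruck-Bose plane *)

Section Rows.
Variable K : fieldType.

Lemma row3D x0 x1 x2 y0 y1 y2 :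
  row3 x0 x1 x2 + row3 y0 y1 y2 = row3 (x0 + y0) (x1 + y1) (x2 + y2) :> 'rV[K]_3.
Proof. by apply/rowP; apply: ord3P; rewrite !mxE. Qed.

Lemma row3Z k x0 x1 x2 : k *: row3 x0 x1 x2 = row3 (k * x0) (k * x1) (k * x2) :> 'rV[K]_3.
Proof. by apply/rowP; apply: ord3P; rewrite !mxE. Qed.

Lemma row3_inj x0 x1 x2 y0 y1 y2 : row3 x0 x1 x2 = row3 y0 y1 y2 :> 'rV[K]_3 ->
  [/\ x0 = y0, x1 = y1 & x2 = y2].
Proof.
by move/rowP => E; move: (E ord0) (E (lift ord0 ord0)) (E (lift ord0 (lift ord0 ord0))); rewrite !mxE.
Qed.

Lemma row3_exists (z : 'rV[K]_3) : exists x0 x1 x2, z = row3 x0 x1 x2.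
Proof. by rewrite (row3E z); do 3!eexists. Qed.

Definition line_inf : subspace K 2 := (<[row3 0%R 1%R 0%R]> + <[row3 0%R 0%R 1%R]>)%VS.

Lemma mem_line_inf x0 x1 x2 : (row3 x0 x1 x2 \in line_inf) = (x0 == 0).
Proof.
apply/mem_span2/eqP => [[k [l]]|->]; first by rewrite !row3Z row3D => /row3_inj[-> _ _]; rewrite !mulr0 addr0.
by exists x1, x2; rewrite !row3Z row3D !mulr0 !mulr1 !addr0 !add0r.
Qed.

Lemma dim_line_inf : \dim line_inf = 2%N.
Proof.
apply: dim_span2 => k l; rewrite !row3Z row3D => /eqP; rewrite row3_neq0.
by rewrite !mulr0 !mulr1 !addr0 !add0r => /and3P[_ /eqP-> /eqP->].
Qed.

Lemma point_row3 (W : subspace K 2) : is_point W ->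
  (exists X Y, W = <[row3 1%R X Y]>%VS) \/
  (exists U V, ((U != 0) || (V != 0)) /\ W = <[row3 0%R U V]>%VS).
Proof.
case/point_gen => z z0 ->; have [x0 [x1 [x2 Ez]]] := row3_exists z.
case: (eqVneq x0 0) => [x00|n0].
  right; exists x1, x2; rewrite Ez x00; split=> //.
  by move: z0; rewrite Ez x00 row3_neq0 eqxx /= negb_and.
left; exists (x1 / x0), (x2 / x0); apply: vline_eq => //.
  by rewrite row3_neq0 oner_eq0.
by apply/vlineP; exists x0; rewrite row3Z mulr1 Ez; congr row3; field.
Qed.

Lemma span_row3 X Y U V : (U != 0) || (V != 0) ->
  \dim (<[row3 1%R X Y]> + <[row3 0%R U V : 'rV[K]_3]>) = 2%N.
Proof.
move=> n; apply: dim_span2 => k l; rewrite !row3Z row3D => /eqP; rewrite row3_neq0.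
rewrite mulr1 mulr0 addr0 => /and3P[/eqP-> /eqP + /eqP]; rewrite !mul0r !add0r.
move=> E1 E2; split=> //; case/orP: n => n0; [apply: (mulIf n0)|apply: (mulIf n0)].
  by rewrite mul0r.
by rewrite mul0r.
Qed.

Lemma line_row3 (W : subspace K 2) : is_line W -> W = line_inf \/
  exists X Y U V, ((U != 0) || (V != 0)) /\ W = (<[row3 1%R X Y]> + <[row3 0%R U V]>)%VS.
Proof.
move=> /eqP dW; case: (boolP (W <= line_inf)%VS) => [WL|/subvPn[z zW zL]].
  by left; apply/eqP; rewrite eqEdim WL dW dim_line_inf.
right; have [x0 [x1 [x2 Ez]]] := row3_exists z.
have n0 : x0 != 0 by move: zL; rewrite Ez mem_line_inf.
have d1 : (0 < \dim (W :&: line_inf))%N.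
  have := dimv_sum_cap W line_inf; rewrite dW dim_line_inf.
  have := dimvS (subvf (W + line_inf)%VS); rewrite dimvf /dim /=; clear; lia.
have c0 : (W :&: line_inf)%VS != 0%VS by rewrite -dimv_eq0 -lt0n.
have := memv_pick (W :&: line_inf); rewrite -vpick0 in c0.
move: (vpick _) c0 => w w0; have [y0 [U [V Ew]]] := row3_exists w.
rewrite memv_cap {2}Ew mem_line_inf => /andP[wW /eqP y00].
have n : (U != 0) || (V != 0) by move: w0; rewrite Ew y00 row3_neq0 eqxx /= negb_and.
exists (x1 / x0), (x2 / x0), U, V; split=> //.
apply/esym/eqP; rewrite eqEdim dW (span_row3 _ _ n) leqnn andbT subv_add -!memvE.
have -> : row3 0 U V = w by rewrite Ew y00.
rewrite wW andbT.
have -> : row3 1 (x1 / x0) (x2 / x0) = x0^-1 *: z by rewrite Ez row3Z; congr row3; field.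
by rewrite memvZ.
Qed.

(** [None] is the infinite point of the parabola Y = X^2. *)
Definition par_row (t : option K) : 'rV[K]_3 :=
  if t is Some X then row3 1 X (X ^+ 2) else row3 0 0 1.

(** A Vandermonde argument of size 3, or of size 2 when one of the points is at infinity. *)
Lemma par_row_free i j k : i != j -> i != k -> j != k ->
  free [:: par_row i; par_row j; par_row k].
Proof.
have two X Y (b c : K) : X != Y -> b + c = 0 -> b * X + c * Y = 0 -> b = 0 /\ c = 0.
  move=> XY bc E; have nXY : X - Y != 0 by rewrite subr_eq0.
  have b0 : b = 0.
    apply: (mulIf nXY); rewrite mul0r -[RHS]subr0 -{1}E -(mul0r Y) -bc; ring.
  by move: bc; rewrite b0 add0r.
have three X Y Z (a b c : K) : X != Y -> X != Z -> a + b + c = 0 ->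
    a * X + b * Y + c * Z = 0 -> a * X ^+ 2 + b * Y ^+ 2 + c * Z ^+ 2 = 0 -> a = 0.
  move=> XY XZ E0 E1 E2; have n1 : X - Y != 0 by rewrite subr_eq0.
  have n2 : X - Z != 0 by rewrite subr_eq0.
  apply: (mulIf n1); apply: (mulIf n2); rewrite !mul0r.
  transitivity (a * X ^+ 2 + b * Y ^+ 2 + c * Z ^+ 2 - (Y + Z) * (a * X + b * Y + c * Z)
     + Y * Z * (a + b + c)); first by ring.
  by rewrite E0 E1 E2 !mulr0 subr0 addr0.
have someN X Y : Some X != Some Y :> option K -> X != Y by apply: contraNneq => ->.
move=> ij ik jk; apply: free3I => a b c.
move: i j k ij ik jk => [X|] [Y|] [Z|] //=; rewrite !row3Z !row3D => ij ik jk /eqP;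
  rewrite row3_neq0 ?mulr0 ?addr0 ?add0r ?mulr1 => /and3P[/eqP E0 /eqP E1 /eqP E2].
- have {ij ik jk}[[XY XZ] YZ] := (someN _ _ ij, someN _ _ ik, someN _ _ jk).
  have a0 := three _ _ _ _ _ _ XY XZ E0 E1 E2.
  rewrite a0 !mul0r !add0r in E0 E1 *; have [-> ->] := two _ _ _ _ YZ E0 E1.
  by [].
- have [a0 b0] := two _ _ _ _ (someN _ _ ij) E0 E1.
  by split=> //; move: E2; rewrite a0 b0 !mul0r !add0r.
- have [a0 c0] := two _ _ _ _ (someN _ _ ik) E0 E1.
  by split=> //; move: E2; rewrite a0 c0 !mul0r add0r addr0.
- have [b0 c0] := two _ _ _ _ (someN _ _ jk) E0 E1.
  by split=> //; move: E2; rewrite b0 c0 !mul0r !addr0.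
Qed.

End Rows.

(** * The isomorphism with PG(2, K) *)

Section Frame.
Variables (F K : finFieldType) (Sinf : subspace F 4) (C CP : {fset subspace F 4}).
Variables (h : {scalar 'rV[F]_5}) (iota : {rmorphism F -> K}) (kap : K)
  (vec : F -> K -> K -> 'rV[F]_5).
Hypotheses (q_odd : odd #|F|) (hS : forall v, (v \in Sinf) = (h v == 0))
  (C_affine : forall P, P \in C -> is_point P /\ affine Sinf P)
  (cf : configuration h Sinf (@cplane F CP) (cvec C h))
  (fr : complex_frame h (cvec C h) iota kap vec)
  (dSinf : \dim Sinf = 4%N) (cardK : #|K| = (#|F| ^ 2)%N).
Local Notation V := 'rV[F]_5.
Local Notation ks := (kline kap vec).
Local Notation Sp := (spread_of Sinf C CP).

Let addE := fr_add fr.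
Let scaleE := fr_scale fr.
Let vecI := fr_inj fr.
Let vec0 := vec0 fr.
Let SpP := spread_ofP q_odd hS C_affine cf fr.

Definition theta_set (W : subspace K 2) : {set V} :=
  [set v | [exists p : F * K * K, (v == vec p.1.1 p.1.2 p.2) && (row3 (iota p.1.1) p.1.2 p.2 \in W)]].

(* The F-subspace of F^5 = F x K x K whose vectors, read in K^3, lie in W. *)
Definition theta (W : subspace K 2) : subspace F 4 := <<enum (theta_set W)>>%VS.

Lemma in_theta_set W a X Y : (vec a X Y \in theta_set W) = (row3 (iota a) X Y \in W).
Proof.
rewrite inE; apply/existsP/idP => [[[[b X'] Y'] /= /andP[/eqP/vecI[-> -> ->]]] //|H].
by exists (a, X, Y); rewrite /= eqxx.
Qed.

Lemma mem_theta W a X Y : (vec a X Y \in theta W) = (row3 (iota a) X Y \in W).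
Proof.
rewrite mem_span_finset ?in_theta_set //.
- by rewrite -vec0 in_theta_set rmorph0 (_ : row3 0 0 0 = 0) ?mem0v //; apply/eqP; rewrite row3_neq0 eqxx.
- move=> u v; have [b [X1 [Y1 ->]]] := fr_span fr u; have [c [X2 [Y2 ->]]] := fr_span fr v.
  by rewrite addE !in_theta_set rmorphD -row3D; apply: memvD.
move=> k u; have [b [X1 [Y1 ->]]] := fr_span fr u.
by rewrite scaleE !in_theta_set rmorphM -row3Z; apply: memvZ.
Qed.

(** [theta] sees only the rows whose first coordinate is in F; any other row is first scaled to have
    first coordinate 1. *)
Lemma theta_sub W W' : (theta W <= theta W')%VS = (W <= W')%VS.
Proof.
apply/idP/idP => /subvP H; apply/subvP => z; last first.
  by have [a [X [Y ->]]] := fr_span fr z; rewrite !mem_theta; apply: H.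
have [x0 [x1 [x2 ->]]] := row3_exists z.
have key a X Y : row3 (iota a) X Y \in W -> row3 (iota a) X Y \in W'.
  by rewrite -!mem_theta; apply: H.
case: (eqVneq x0 0) => [->|n0]; first by have := key 0 x1 x2; rewrite rmorph0.
have -> : row3 x0 x1 x2 = x0 *: row3 (iota 1) (x1 / x0) (x2 / x0).
  by rewrite row3Z rmorph1 mulr1; congr row3; field.
move=> zW; apply: memvZ; apply: key.
by rewrite -[row3 _ _ _](scalerK n0) memvZ.
Qed.

Lemma theta_inj W W' : theta W = theta W' -> W = W'.
Proof. by move=> e; apply/eqP; rewrite eqEsubv -!theta_sub e subvv. Qed.

Lemma theta_aff X Y : theta <[row3 1%R X Y]>%VS = <[vec 1%R X Y]>%VS.
Proof.
apply/vspaceP => v; have [a [X' [Y' ->]]] := fr_span fr v; rewrite mem_theta.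
apply/vlineP/vlineP => -[k].
  by rewrite row3Z mulr1 => /row3_inj[<- -> ->]; exists a; rewrite scaleE mulr1.
by rewrite scaleE mulr1 => /vecI[-> -> ->]; exists (iota k); rewrite row3Z mulr1.
Qed.

Lemma theta_ks U W : theta <[row3 0%R U W]>%VS = ks U W.
Proof.
apply/vspaceP => v; have [a [X' [Y' ->]]] := fr_span fr v; rewrite mem_theta.
apply/vlineP/(mem_ks fr) => -[k].
  rewrite row3Z mulr0 => /row3_inj[/eqP]; rewrite fmorph_eq0 => /eqP-> -> ->.
  by exists k.
by move=> /vecI[-> -> ->]; exists k; rewrite row3Z mulr0 rmorph0.
Qed.

Lemma theta_line_inf : theta (line_inf K) = Sinf.
Proof.
apply/vspaceP => v; have [a [X' [Y' ->]]] := fr_span fr v; rewrite mem_theta.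
by rewrite mem_line_inf (vec_in_inf hS fr) fmorph_eq0.
Qed.

Lemma theta_line X Y U W : theta (<[row3 1%R X Y]> + <[row3 0%R U W]>)%VS =
  (<[vec 1%R X Y]> + ks U W)%VS.
Proof.
apply/vspaceP => v; have [a [X' [Y' ->]]] := fr_span fr v; rewrite mem_theta.
apply/mem_span2/memv_addP => [[k [l]]|[_ /vlineP[k ->] [_ /(mem_ks fr)[Z ->]]]].
  rewrite !row3Z row3D mulr1 mulr0 addr0 => /row3_inj[<- -> ->].
  exists (a *: vec 1 X Y); first by rewrite memvZ ?memv_line.
  exists (vec 0 (l * U) (l * W)); first by apply/(mem_ks fr); exists l.
  by rewrite scaleE addE mulr1 addr0.
rewrite scaleE addE mulr1 addr0 => /vecI[-> -> ->]; exists (iota k), Z.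
by rewrite !row3Z row3D mulr1 mulr0 addr0.
Qed.

Lemma vec1_affine X Y : affine Sinf <[vec 1%R X Y]>%VS.
Proof. by rewrite /affine -memvE (vec_in_inf hS fr) oner_eq0. Qed.

Lemma vec1_neq0 X Y : vec 1 X Y != 0.
Proof. by apply/eqP => /(vec_eq0 fr)[/eqP]; rewrite oner_eq0. Qed.

(** Points off the line x0 = 0 become affine points of PG(4, q); points on it become the K-lines of
    the spread. *)
Lemma bb_pointP P : bb_point Sinf Sp P <-> exists2 W, is_point W & theta W = P.
Proof.
split=> [[[/point_gen[v v0 ->]]|/SpP[U [W [n ->]]]]|[W]].
- have [a [X [Y Ev]]] := fr_span fr v; rewrite /affine -memvE Ev (vec_in_inf hS fr) => a0.
  exists <[row3 1%R (X / iota a)%R (Y / iota a)%R]>%VS.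
    by rewrite /is_point dim_vline row3_neq0 oner_eq0.
  have n : iota a != 0 by rewrite fmorph_eq0.
  have E : vec a X Y = a *: vec 1 (X / iota a) (Y / iota a).
    by rewrite scaleE mulr1; congr vec; field.
  rewrite theta_aff; apply/esym/vline_eq.
  + by rewrite -Ev.
  + exact: vec1_neq0.
  by apply/vlineP; exists a.
- exists <[row3 0%R U W]>%VS; last exact: theta_ks.
  by rewrite /is_point dim_vline row3_neq0 eqxx /= negb_and n.
case/point_row3 => [[X [Y ->]] <-|[U [U' [n ->]]] <-].
  left; rewrite theta_aff; split; last exact: vec1_affine.
  by rewrite /is_point dim_vline vec1_neq0.
by right; rewrite theta_ks; apply/SpP; exists U, U'.
Qed.

Lemma bb_lineP m : bb_line Sinf Sp m <-> exists2 W, is_line W & theta W = m.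
Proof.
split=> [[[/eqP dm am /SpP[U [W [n Em]]]]|->]|[W]].
- have [v vm] := aff_exists hS am; have Ev := aff_decomp hS vm.
  move: vm; rewrite in_aff => /andP[_ /eqP hv].
  have [a [X [Y EX]]] := fr_span fr v; rewrite EX (fr_h fr) in hv.
  exists (<[row3 1%R X Y]> + <[row3 0%R U W]>)%VS; first by rewrite /is_line span_row3.
  by rewrite theta_line -Ev Em EX hv.
- exists (line_inf K); last exact: theta_line_inf.
  by rewrite /is_line dim_line_inf.
case/line_row3 => [-> <-|[X [Y [U [U' [n ->]]]]] <-]; first by right; rewrite theta_line_inf.
left; rewrite theta_line.
have E : ((<[vec 1%R X Y]> + ks U U') :&: Sinf = ks U U')%VS.
  apply/vspaceP => v; rewrite memv_cap; apply/andP/idP => [[]|H].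
    case/memv_addP => _ /vlineP[k ->] [w wk ->]; rewrite hS linearD linearZ /= (fr_h fr).
    have : w \in Sinf by apply: subvP wk; apply: (ks_inf hS fr).
    by rewrite hS => /eqP ->; rewrite mulr1 addr0 => /eqP->; rewrite scale0r add0r.
  by split; [apply: subvP (addvSr _ _) _ H | apply: subvP (ks_inf hS fr _ _) _ H].
have aff1 : affine Sinf (<[vec 1%R X Y]> + ks U U')%VS.
  by apply: contra (vec1_affine X Y); apply: subv_trans; apply: addvSl.
split=> //; last by apply/SpP; exists U, U'.
have := dim_capS hS aff1; rewrite E (ks_dim fr n) /is_plane.
by case: (\dim (_ + _)%VS) => [|[|[|[|]]]].
Qed.

(** [phi] and [psi] are inverses of [theta], which preserves and reflects inclusion; [0%VS] is their
    default value elsewhere. *)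
Lemma bb_iso_exists : exists phi : subspace F 4 -> subspace K 2, bb_iso Sinf Sp phi.
Proof.
have /choice[phi Hphi] : forall P, exists W, bb_point Sinf Sp P -> is_point W /\ theta W = P.
  move=> P; case: (pselect (bb_point Sinf Sp P)) => [/bb_pointP[W Wp E]|n]; first by exists W.
  by exists 0%VS.
have /choice[psi Hpsi] : forall m, exists W, bb_line Sinf Sp m -> is_line W /\ theta W = m.
  move=> m; case: (pselect (bb_line Sinf Sp m)) => [/bb_lineP[W Wp E]|n]; first by exists W.
  by exists 0%VS.
exists phi; split; first split.
- by move=> P /Hphi[].
- move=> P Q; rewrite !inE => /Hphi[_ EP] /Hphi[_ EQ] e.
  by rewrite -EP e EQ.
- move=> W Wp; have bp : bb_point Sinf Sp (theta W) by apply/bb_pointP; exists W.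
  by exists (theta W) => //; have [_ /theta_inj] := Hphi _ bp.
exists psi; split; first split.
- by move=> P /Hpsi[].
- move=> P Q; rewrite !inE => /Hpsi[_ EP] /Hpsi[_ EQ] e.
  by rewrite -EP e EQ.
- move=> W Wp; have bp : bb_line Sinf Sp (theta W) by apply/bb_lineP; exists W.
  by exists (theta W) => //; have [_ /theta_inj] := Hpsi _ bp.
by move=> P m /Hphi[_ EP] /Hpsi[_ Em]; rewrite -{1}EP -{1}Em theta_sub.
Qed.

Lemma closureP P : bb_closure Sinf C CP P <-> exists t, P = theta <[par_row t]>%VS.
Proof.
have tl := t_infty_line q_odd hS C_affine cf fr.
split=> [[/= /(C_form hS C_affine fr)[X ->]|/= H]|[[X|] ->]].
- by exists (Some X); rewrite theta_aff.
- by exists None; rewrite theta_ks; apply: line_of_points_inj H tl.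
- by left => /=; apply/(C_form hS C_affine fr); exists X; rewrite theta_aff.
by right => /=; rewrite theta_ks.
Qed.

Lemma par_row_neq0 t : par_row t != 0 :> 'rV[K]_3.
Proof. by case: t => [X|]; rewrite /par_row row3_neq0 oner_eq0 ?andbF. Qed.

(* Collinearity is preserved by phi, so the image is an oval of PG(2, K). *)
Lemma conic_image (phi : subspace F 4 -> subspace K 2) : bb_iso Sinf Sp phi ->
  is_conic fullv (phi @` bb_closure Sinf C CP)%classic.
Proof.
case=> [[phiP phiI _] [psi [[_ _ psiS] inc]]].
pose P t := theta <[par_row t : 'rV[K]_3]>%VS.
have bP t : bb_point Sinf Sp (P t).
  by apply/bb_pointP; exists <[par_row t]>%VS; rewrite // /is_point dim_vline par_row_neq0.
have gen t : exists v, v != 0 /\ phi (P t) = <[v]>%VS.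
  by have /point_gen[v v0 E] : is_point (phi (P t)) := phiP _ (bP t); exists v.
have [v Hv] := fin_all_exists gen.
have K_odd : odd #|K| by rewrite cardK oddX q_odd.
have arc i j k : i != j -> i != k -> j != k -> free [:: v i; v j; v k].
  move=> ij ik jk; have fr3 := par_row_free ij ik jk.
  have [vi vj vk] : [/\ v i != 0, v j != 0 & v k != 0] by split; exact: (Hv _).1.
  have njk : v j \notin <[v k]>%VS.
    apply/negP => H; have e := vline_eq vj vk H.
    have : P j = P k.
      by apply: phiI; rewrite ?inE // (Hv j).2 (Hv k).2.
    move/theta_inj => e'; move: fr3; rewrite free_cons free_cons span_seq1 => /and3P[_ + _].
    by rewrite -e' memv_line.
  have fjk : free [:: v j; v k] by rewrite free_cons span_seq1 njk seq1_free.
  rewrite free_cons fjk andbT; apply/negP => H.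
  have lW : is_line <<[:: v j; v k]>>%VS by rewrite /is_line; move: fjk; rewrite /free.
  (* A line through three images would come from a line of P(S), that is from a line [W] of PG(2, K)
     with three points of the parabola. *)
  have [m bm Em] := psiS _ lW.
  have /bb_lineP[W /eqP dW EW] := bm.
  have inW t : v t \in <<[:: v j; v k]>>%VS -> par_row t \in W.
    move=> tW; rewrite memvE -theta_sub EW (inc _ _ (bP t) bm) Em (Hv t).2 -memvE.
    exact: tW.
  have : (<<[:: par_row i; par_row j; par_row k]>> <= W)%VS.
    apply/span_subvP => z; rewrite !inE => /or3P[] /eqP->; apply: inW => //;
    by apply: memv_span; rewrite !inE eqxx ?orbT.
  by move/dimvS; rewrite dW; move: fr3; rewrite /free => /eqP->.
have cT : #|{: option K}| = #|K|.+1 by rewrite card_option.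
have [e [M [be Ms Mu EM]]] := segre cT K_odd arc.
exists e, M; split=> //; apply/seteqP; split=> Q /=.
  case=> R /closureP[t ->] <-; apply/EM; exists t; exact: (Hv t).2.
move=> /EM[t ->]; exists (P t); last exact: (Hv t).2.
by apply/closureP; exists t.
Qed.

End Frame.

(** The identification with PG(2, K) is determined only up to collineations, so the last clause is
    stated for every one of them; the clause before it shows that one exists. *)
Theorem theorem3p25 (F K : finFieldType) (Sinf : subspace F 4)
    (C CP : {fset subspace F 4})
    (q_odd : odd #|F|) (q_ge7 : (7 <= #|F|)%N)
    (card_K : #|K| = (#|F| ^ 2)%N)
    (Sinf_hyperplane : is_hyperplane Sinf)
    (card_C : #|` C|%fset = (#|F| ^ 2)%N)
    (C_affine : forall P, P \in C -> is_point P /\ affine Sinf P)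
    (CP_affine : forall pi, pi \in CP -> is_plane pi /\ affine Sinf pi)
    (A1 : axiom_A1 C CP)
    (A2 : axiom_A2 C CP)
    (A3 : axiom_A3 Sinf C CP) :
  [/\ forall A, A \in C -> exists l, line_of_points (t_of Sinf C CP A) l,
      exists l, line_of_points (t_infty Sinf C CP) l,
      is_regular_spread Sinf (spread_of Sinf C CP),
      exists phi : subspace F 4 -> subspace K 2,
        bb_iso Sinf (spread_of Sinf C CP) phi &
      forall phi : subspace F 4 -> subspace K 2,
        bb_iso Sinf (spread_of Sinf C CP) phi ->
        is_conic fullv (phi @` bb_closure Sinf C CP)%classic].
Proof.
have [h hS] := hyperplane_functional (eqP Sinf_hyperplane).
have cf := configuration_of_axioms q_odd q_ge7 card_C C_affine CP_affine A1 A2 A3 hS.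
have [iota [kap [vec fr]]] := complex_form cf card_K.
split.
- move=> A /(C_form hS C_affine fr)[X ->].
  by eexists; apply: (t_of_line q_odd hS C_affine cf fr).
- by eexists; apply: (t_infty_line q_odd hS C_affine cf fr).
- exact: (regular_spread q_odd hS C_affine cf fr).
- exact: (bb_iso_exists q_odd hS C_affine cf fr).
- exact: (conic_image q_odd hS C_affine cf fr card_K).
Qed.
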